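(* Under the homomorphism $\mu:\mathcal U_q^{T,+}\to{U'_q}(\widehat{gl_2})^{\triangleright,+}$ given in the context, the quantum determinant $\Gamma(u)=\mathrm{tr}_{12}\big(P^-_{12}(\mathsf K_{\mathcal U}(u)\otimes\mathbb I)R^{(0)}(\mathbb I\otimes\mathsf K_{\mathcal U}(uq))\big)$ is mapped as $$\Gamma(u)\ \stackrel{\mu}{\mapsto}\ \left(\frac{\bar\epsilon_+\bar\epsilon_-(q-q^{-1})^2-q^3u^2\,\bar k_+\bar k_-(q+q^{-1})^2}{q^3u^2(q-q^{-1})^2}\right)\exp\Big(-(q-q^{-1})\sum_{n=1}^\infty\gamma_n(q^2u^2\lambda)^{-n}\Big),$$ where $\bar k_+=q^{-1}(q-q^{-1})$, $\bar k_-=q-q^{-1}$, $\bar\epsilon_+=q+q^{-1}$, $\bar\epsilon_-=q(q+q^{-1})C^{-1}$, $\lambda=C^{3/2}$.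
   Context: Notation: $\mathbb N=\{0,1,2,\dots\}$; base field $\mathbb C(q)$, $q$ an indeterminate; $[X,Y]=XY-YX$, $[X,Y]_q=qXY-q^{-1}YX$; $\bar\rho=q^{-1}(q^2-q^{-2})^2=\bar k_+\bar k_-(q+q^{-1})^2$. $\mathcal U_q^{T,+}$ is the unital associative $\mathbb C(q)$-algebra with generators $\{Y^+_{-k},Y^+_{k+1},Z^+_{k+1},\tilde Z^+_{k+1}\mid k\in\mathbb N\}$ and the following relations for all $k,\ell\in\mathbb N$: $[Y^+_1,Y^+_{-k}]=[Y^+_{k+1},Y^+_0]=\frac{Z^+_{k+1}-\tilde Z^+_{k+1}}{q+q^{-1}}$; $[Y^+_1,\tilde Z^+_{k+1}]_q=[Z^+_{k+1},Y^+_1]_q=\bar\rho\, Y^+_{k+2}$; $[\tilde Z^+_{k+1},Y^+_0]_q=[Y^+_0,Z^+_{k+1}]_q=\bar\rho\, Y^+_{-k-1}$; $[Y^+_{k+1},Y^+_{\ell+1}]=0$, $[Y^+_{-k},Y^+_{-\ell}]=0$; $[Y^+_{k+1},Y^+_{-\ell}]+[Y^+_{-k},Y^+_{\ell+1}]=0$; $[Y^+_{k+1},\tilde Z^+_{\ell+1}]+[\tilde Z^+_{k+1},Y^+_{\ell+1}]=0$; $[Y^+_{k+1},Z^+_{\ell+1}]+[Z^+_{k+1},Y^+_{\ell+1}]=0$; $[Y^+_{-k},\tilde Z^+_{\ell+1}]+[\tilde Z^+_{k+1},Y^+_{-\ell}]=0$; $[Y^+_{-k},Z^+_{\ell+1}]+[Z^+_{k+1},Y^+_{-\ell}]=0$;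 $[\tilde Z^+_{k+1},\tilde Z^+_{\ell+1}]=0$, $[Z^+_{k+1},Z^+_{\ell+1}]=0$; $[Z^+_{k+1},\tilde Z^+_{\ell+1}]+[\tilde Z^+_{k+1},Z^+_{\ell+1}]=0$. Generating functions, with $U=qu^2/(q+q^{-1})$: $\mathsf Y_+(u)=\sum_{k\in\mathbb N}Y^+_{k+1}U^{-k-1}$, $\mathsf Y_-(u)=\sum_{k\in\mathbb N}Y^+_{-k}U^{-k-1}$, $\mathsf Z_+(u)=\sum_{k\in\mathbb N}\tilde Z^+_{k+1}U^{-k-1}$, $\mathsf Z_-(u)=\sum_{k\in\mathbb N}Z^+_{k+1}U^{-k-1}$. The K-operator of $\mathcal U_q^{T,+}$ is $$\mathsf K_{\mathcal U}(u)=\begin{pmatrix}uq\,\mathsf Y_+(u)&\frac{1}{\bar k_-(q+q^{-1})}\mathsf Z_+(u)+\frac{\bar k_+(q+q^{-1})}{q-q^{-1}}\\ \frac{1}{\bar k_+(q+q^{-1})}\mathsf Z_-(u)+\frac{\bar k_-(q+q^{-1})}{q-q^{-1}}&uq\,\mathsf Y_-(u)\end{pmatrix}.$$ $R^{(0)}=\mathrm{diag}(1,q^{-1},q^{-1},1)$ on $\mathbb C^2\otimes\mathbb C^2$, $P$ is the permutation operator, $P^-_{12}=(1-P)/2$, $\mathrm{tr}_{12}$ is the trace over $\mathbb C^2\otimes\mathbb C^2$. $U_q(\widehat{gl_2})$ is the unital associative algebra with generators $\mathsf x^\pm_k$ ($k\in\mathbb Z$), $\mathsf k^+_{j,-\ell},\mathsf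 k^-_{j,\ell}$ ($\ell\in\mathbb N$, $j=1,2$), and central, mutually inverse elements $q^{\pm c/2}$, with the following relations (FRT presentation). Let $$\tilde R(z)=\begin{pmatrix}1&0&0&0\\0&\frac{z-1}{zq-q^{-1}}&\frac{z(q-q^{-1})}{zq-q^{-1}}&0\\0&\frac{q-q^{-1}}{zq-q^{-1}}&\frac{z-1}{zq-q^{-1}}&0\\0&0&0&1\end{pmatrix},\quad L^\pm(z)=\begin{pmatrix}\mathsf k_1^\pm(z)&\mathsf k_1^\pm(z)\mathsf f^\pm(z)\\ \mathsf e^\pm(z)\mathsf k_1^\pm(z)&\mathsf k_2^\pm(z)+\mathsf e^\pm(z)\mathsf k_1^\pm(z)\mathsf f^\pm(z)\end{pmatrix},$$ $\mathsf e^+(z)=(q-q^{-1})\sum_{k\ge0}q^{k(c/2-1)}\mathsf x^-_{-k}z^k$, $\mathsf e^-(z)=-(q-q^{-1})\sum_{k\ge1}q^{k(c/2+1)}\mathsf x^-_kz^{-k}$, $\mathsf f^+(z)=(q-q^{-1})\sum_{k\ge1}q^{-k(c/2+1)}\mathsf x^+_{-k}z^k$, $\mathsf f^-(z)=-(q-q^{-1})\sum_{k\ge0}q^{-k(c/2-1)}\mathsf x^+_kz^{-k}$, $\mathsf k^+_j(z)=\sum_{k\ge0}\mathsf k^+_{j,-k}z^k$, $\mathsf k^-_j(z)=\sum_{k\ge0}\mathsf k^-_{j,k}z^{-k}$. The relations are $\mathsf k^+_{i,0}\mathsf k^-_{i,0}=\mathsf k^-_{i,0}\mathsf k^+_{i,0}=1$,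 $\tilde R(z/w)(L^\pm(z)\otimes\mathbb I)(\mathbb I\otimes L^\pm(w))=(\mathbb I\otimes L^\pm(w))(L^\pm(z)\otimes\mathbb I)\tilde R(z/w)$ (expanded in $z/w$ or $w/z$), and $\tilde R(q^cz/w)(L^+(z)\otimes\mathbb I)(\mathbb I\otimes L^-(w))=(\mathbb I\otimes L^-(w))(L^+(z)\otimes\mathbb I)\tilde R(q^{-c}z/w)$ (expanded in $z/w$). Elements $a_{i,m}$ ($m\in\mathbb Z\setminus\{0\}$, $i=1,2$) are defined by $\mathsf k^\pm_i(z)=\mathsf k^\pm_{i,0}\exp\big(\pm(q-q^{-1})\sum_{n\ge1}a_{i,\mp n}z^{\pm n}\big)$. One writes $a_{1,m}=\frac{1}{q^m+q^{-m}}(\mathsf h_m+\gamma_m)$, $a_{2,m}=-\frac{1}{q^m+q^{-m}}(q^{2m}\mathsf h_m-\gamma_m)$, i.e. $\gamma_m=q^ma_{1,m}+q^{-m}a_{2,m}$ (central in $U_q(\widehat{gl_2})$) and $\mathsf h_m=q^{-m}(a_{1,m}-a_{2,m})$. Also $C^{1/2}=q^{c/2}$, $\mathsf K=\mathsf k^-_{2,0}(\mathsf k^-_{1,0})^{-1}$, and $\psi(z)=\mathsf K\exp\big((q-q^{-1})\sum_{k\ge1}\mathsf h_kz^{-k}\big)$. ${U'_q}(\widehat{gl_2})^{\triangleright,+}$ is the subalgebra of $U_q(\widehat{gl_2})$ generated by $\{C^{-k/2}\mathsf K^{-1}\mathsf x^+_k,\ C^{(k+1)/2}\mathsf x^-_{k+1},\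 a_{1,k+1},\ a_{2,k+1}\mid k\in\mathbb N\}$ and $\{\mathsf K^{\pm1},C^{\pm1/2}\}$. Set $\gamma'_n=-\frac{(q-q^{-1})^{2n-1}}{n}\big(\frac{\bar\epsilon_+\bar\epsilon_-\lambda}{\bar\rho q}\big)^n$ and $$g(u)=\exp\Big(-(q-q^{-1})\sum_{n\ge1}\frac{\mathsf h_n+\gamma'_n}{q^n+q^{-n}}(qu^2\lambda)^{-n}\Big),$$ $$c(u)=\exp\Big(-(q-q^{-1})\sum_{n\ge1}\frac{\gamma'_n}{q^n+q^{-n}}(qu^2\lambda)^{-n}\Big),\quad \mathsf c(u)=\exp\Big(-(q-q^{-1})\sum_{n\ge1}\frac{\gamma_n}{q^n+q^{-n}}(qu^2\lambda)^{-n}\Big).$$ The (injective) homomorphism $\mu$ is given by $$\mathsf Y_\pm(u)\mapsto N_\pm(u)\,c(u)^{-1}\mathsf c(u),\qquad \mathsf Z_\pm(u)\mapsto\Big(M_\pm(u)+\frac{\bar\rho}{q-q^{-1}}\Big)c(u)^{-1}\mathsf c(u)-\frac{\bar\rho}{q-q^{-1}},$$ where $$N_+(u)=g(u)\Big(-\bar k_-(q^2+1)(qu^2)^{-1}\sum_{k\ge0}q^kC^{-k/2}\mathsf K^{-1}\mathsf x^+_k(qu^2\lambda)^{-k}+\bar\epsilon_+(qu^2)^{-1}\mathsf K^{-1}\Big),$$ $$N_-(u)=\Big(-\bar k_+(q^{-2}+1)\sum_{k\ge0}q^{k+1}C^{(k+1)/2}\mathsf x^-_{k+1}(qu^2\lambda)^{-k-1}+\bar\epsilon_-q^{-1}(qu^2)^{-1}\Big(\psi(u^2\lambda)+(q-q^{-1})^2\sum_{k,\ell\ge0}q^{k-\ell}C^{(k-\ell+1)/2}\mathsf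 x^-_{k+1}\mathsf x^+_\ell(qu^2\lambda)^{-k-\ell-1}\Big)\Big)g(u),$$ $$M_+(u)=\Big(\frac{\bar\rho}{q-q^{-1}}-\bar\epsilon_-\bar k_-q^{-1}(q^2-q^{-2})(qu^2)^{-1}\sum_{k\ge0}q^{-k}C^{-k/2}\mathsf x^+_k(qu^2\lambda)^{-k}\Big)g(u)-\frac{\bar\rho}{q-q^{-1}},$$ $$M_-(u)=g(u)\Big(\frac{\bar\rho}{q-q^{-1}}\mathsf K^{-1}\psi(u^2\lambda)-\bar\epsilon_+\bar k_+(q^2-q^{-2})\sum_{k\ge0}q^{-k+1}C^{(k+1)/2}\mathsf x^-_{k+1}\mathsf K^{-1}(qu^2\lambda)^{-k-1}+\bar\rho(q-q^{-1})\sum_{k,\ell\ge0}q^{-k+\ell}C^{(k-\ell+1)/2}\mathsf K^{-1}\mathsf x^-_{k+1}\mathsf x^+_\ell(qu^2\lambda)^{-k-\ell-1}\Big)-\frac{\bar\rho}{q-q^{-1}}.$$ *)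

(* Defs.v *)
From HB Require Import structures.
From mathcomp Require Import all_boot all_order all_algebra.
From mathcomp Require Import boolp reals.
From mathcomp Require Import complex mxtens monalg.

Set Implicit Arguments.
Unset Strict Implicit.
Unset Printing Implicit Defensive.

Import GRing.Theory.
Local Open Scope ring_scope.

Section FreeAlgebra.
Variables (F : fieldType) (X : choiceType).

Definition free_alg := {malg F[{fmonom X}]}.

HB.instance Definition _ :=
  GRing.Lalgebra.copy free_alg {malg F[{fmonom X}]}.

Fact free_scalerAr (c : F) (x y : free_alg) : c *: (x * y) = x * (c *: y).
Proof.
have comm (g : {malg F[{fmonom X}]}) : malgC c * g = g * malgC c.
  rewrite mul_malgC malgM_def fgmulgU malgZ_def.
  by apply: eq_bigr => k _; rewrite mulm1 mulrC.
have E (g : {malg F[{fmonom X}]}) : c *: g = g * malgC c.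
  by rewrite -comm mul_malgC.
by rewrite [LHS]E -mulrA [in RHS]E.
Qed.

HB.instance Definition _ :=
  GRing.Lalgebra_isAlgebra.Build F free_alg free_scalerAr.

Definition free_gen (x : X) : free_alg := << fmu x >>%R.

Variable v : X -> F.

Definition fmeval (m : {fmonom X}) : F := \prod_(x <- (m : seq X)) v x.

Fact fmeval_morph : mmorphism fmeval.
Proof.
split=> [m1 m2|]; rewrite /fmeval.
  by rewrite fmM big_cat.
by rewrite fm1 big_nil.
Qed.

HB.instance Definition _ :=
  isMultiplicative.Build {fmonom X} F fmeval fmeval_morph.

Definition free_eval : free_alg -> F := mmap idfun fmeval.
HB.instance Definition _ := GRing.RMorphism.on free_eval.
HB.instance Definition _ := GRing.Linear.on free_eval.

Lemma free_eval_gen x : free_eval (free_gen x) = v x.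
Proof.
by rewrite /free_eval mmapU mul1r /fmeval fmuE big_cons big_nil mulr1.
Qed.

End FreeAlgebra.

Local Open Scope quotient_scope.

Section QuotientAlgebra.
Variables (F : fieldType) (A : algType F) (r : A -> A -> Prop).

(* The two-sided ideal generated by the x - y with r x y. *)
Inductive ideal_gen : A -> Prop :=
| Ideal0 : ideal_gen 0
| IdealD x y : ideal_gen x -> ideal_gen y -> ideal_gen (x + y)
| IdealM a b x y : r x y -> ideal_gen (a * (x - y) * b).

Lemma ideal_genMl a x : ideal_gen x -> ideal_gen (a * x).
Proof.
elim=> [|y z _ Hy _ Hz|c b y z ryz]; first by rewrite mulr0; exact: Ideal0.
  by rewrite mulrDr; exact: IdealD.
by rewrite !mulrA -[a * c * _ * b]mulrA mulrA; exact: IdealM.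
Qed.

Lemma ideal_genMr a x : ideal_gen x -> ideal_gen (x * a).
Proof.
elim=> [|y z _ Hy _ Hz|c b y z ryz]; first by rewrite mul0r; exact: Ideal0.
  by rewrite mulrDl; exact: IdealD.
by rewrite -mulrA; exact: IdealM.
Qed.

Definition ideal_pred : {pred A} := fun x => `[< ideal_gen x >].

Fact ideal_zmod_closed : zmod_closed ideal_pred.
Proof.
split=> [|x y /asboolP Ix /asboolP Iy]; apply/asboolP; first exact: Ideal0.
by apply: IdealD => //; rewrite -mulN1r; exact: ideal_genMl.
Qed.

HB.instance Definition _ :=
  GRing.isZmodClosed.Build A ideal_pred ideal_zmod_closed.

(* An algType has 1 != 0, so that a quotient is formed from a proof that the
   ideal is proper. *)
Definition consistent := ~ ideal_gen 1.

Hypothesis r_cons : consistent.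

Definition quo_alg of consistent : Type := Quotient.quot ideal_pred.
Local Notation Q := (quo_alg r_cons).

HB.instance Definition _ := Choice.copy Q (Quotient.quot ideal_pred).
HB.instance Definition _ := EqQuotient.copy Q (Quotient.quot ideal_pred).
HB.instance Definition _ := GRing.Zmodule.copy Q (Quotient.quot ideal_pred).

Definition quo_pi (x : A) : Q := \pi_(Quotient.quot ideal_pred) x.

Lemma quo_piP x y : reflect (ideal_gen (x - y)) (quo_pi x == quo_pi y).
Proof. by rewrite -Quotient.idealrBE; exact: asboolP. Qed.

Lemma quo_rel x y : r x y -> quo_pi x = quo_pi y.
Proof.
move=> rxy; apply/eqP/quo_piP.
by rewrite -[x - y]mul1r -[1 * _]mulr1; exact: IdealM.
Qed.

Lemma quo_reprK (x : Q) : quo_pi (repr x) = x.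
Proof. exact: (@reprK _ (Quotient.quot ideal_pred)). Qed.

Lemma quo_repr x : ideal_gen (repr (quo_pi x) - x).
Proof. by apply/quo_piP/eqP; exact: quo_reprK. Qed.

Fact quo_pi_additive : zmod_morphism quo_pi.
Proof. by move=> x y; rewrite /quo_pi raddfB. Qed.

HB.instance Definition _ := GRing.isZmodMorphism.Build A Q quo_pi quo_pi_additive.

Let quo_piD x y : quo_pi (x + y) = quo_pi x + quo_pi y.
Proof. exact: raddfD. Qed.

Definition quo_one : Q := quo_pi 1.
Definition quo_mul (x y : Q) : Q := quo_pi (repr x * repr y).
Definition quo_scale (c : F) (x : Q) : Q := quo_pi (c *: repr x).

Lemma quo_piM x y : quo_pi (x * y) = quo_mul (quo_pi x) (quo_pi y).
Proof.
apply/esym/eqP/quo_piP; set x' := repr _; set y' := repr _.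
have -> : x' * y' - x * y = (x' - x) * y' + x * (y' - y).
  by rewrite mulrBl mulrBr addrA subrK.
by apply: IdealD; [apply: ideal_genMr|apply: ideal_genMl]; exact: quo_repr.
Qed.

Lemma quo_piZ c x : quo_pi (c *: x) = quo_scale c (quo_pi x).
Proof.
apply/esym/eqP/quo_piP; rewrite -scalerBr -mulr_algl.
by apply: ideal_genMl; exact: quo_repr.
Qed.

Lemma quo_ind (P : Q -> Prop) : (forall x, P (quo_pi x)) -> forall x, P x.
Proof. by move=> H x; rewrite -(quo_reprK x). Qed.

Fact quo_mulA : associative quo_mul.
Proof.
by elim/quo_ind=> x; elim/quo_ind=> y; elim/quo_ind=> z; rewrite -!quo_piM mulrA.
Qed.

Fact quo_mul1 : left_id quo_one quo_mul.
Proof. by elim/quo_ind=> x; rewrite -quo_piM mul1r. Qed.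

Fact quo_mulr1 : right_id quo_one quo_mul.
Proof. by elim/quo_ind=> x; rewrite -quo_piM mulr1. Qed.

Fact quo_mulDl : left_distributive quo_mul +%R.
Proof.
elim/quo_ind=> x; elim/quo_ind=> y; elim/quo_ind=> z.
by rewrite -(quo_piD x y) -!quo_piM -quo_piD mulrDl.
Qed.

Fact quo_mulDr : right_distributive quo_mul +%R.
Proof.
elim/quo_ind=> x; elim/quo_ind=> y; elim/quo_ind=> z.
by rewrite -(quo_piD y z) -!quo_piM -quo_piD mulrDr.
Qed.

Fact quo_one_neq0 : quo_one != 0.
Proof.
by apply/negP; rewrite -(raddf0 quo_pi) => /quo_piP; rewrite subr0.
Qed.

HB.instance Definition _ := GRing.Zmodule_isNzRing.Build Q
  quo_mulA quo_mul1 quo_mulr1 quo_mulDl quo_mulDr quo_one_neq0.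

Fact quo_scalerA a b x : quo_scale a (quo_scale b x) = quo_scale (a * b) x.
Proof. by elim/quo_ind: x => x; rewrite -!quo_piZ scalerA. Qed.

Fact quo_scale1 : left_id 1 quo_scale.
Proof. by elim/quo_ind=> x; rewrite -quo_piZ scale1r. Qed.

Fact quo_scalerDr : right_distributive quo_scale +%R.
Proof.
move=> c; elim/quo_ind=> x; elim/quo_ind=> y.
by rewrite -(quo_piD x y) -!quo_piZ -quo_piD scalerDr.
Qed.

Fact quo_scalerDl x : {morph quo_scale^~ x : a b / a + b}.
Proof.
by move=> a b; elim/quo_ind: x => x; rewrite -!quo_piZ -quo_piD scalerDl.
Qed.

HB.instance Definition _ := GRing.Zmodule_isLmodule.Build F Q
  quo_scalerA quo_scale1 quo_scalerDr quo_scalerDl.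

Fact quo_scalerAl (c : F) (x y : Q) : c *: (x * y) = (c *: x) * y.
Proof.
elim/quo_ind: x => x; elim/quo_ind: y => y.
by rewrite /GRing.mul /GRing.scale /= -!(quo_piM, quo_piZ) scalerAl.
Qed.

HB.instance Definition _ := GRing.Lmodule_isLalgebra.Build F Q quo_scalerAl.

Fact quo_scalerAr (c : F) (x y : Q) : c *: (x * y) = x * (c *: y).
Proof.
elim/quo_ind: x => x; elim/quo_ind: y => y.
by rewrite /GRing.mul /GRing.scale /= -!(quo_piM, quo_piZ) scalerAr.
Qed.

HB.instance Definition _ := GRing.Lalgebra_isAlgebra.Build F Q quo_scalerAr.

Fact quo_pi_monoid : monoid_morphism quo_pi.
Proof. by split=> // x y; exact: quo_piM. Qed.

HB.instance Definition _ := GRing.isMonoidMorphism.Build A Q quo_pi quo_pi_monoid.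
HB.instance Definition _ := GRing.isScalable.Build F A Q *:%R quo_pi quo_piZ.

End QuotientAlgebra.

Section Subalgebra.
Variables (F : fieldType) (A : algType F) (S : A -> Prop).

Inductive subalg_gen : A -> Prop :=
| SubGen x : S x -> subalg_gen x
| Sub1 : subalg_gen 1
| SubZ c x : subalg_gen x -> subalg_gen (c *: x)
| SubD x y : subalg_gen x -> subalg_gen y -> subalg_gen (x + y)
| SubM x y : subalg_gen x -> subalg_gen y -> subalg_gen (x * y).

Definition subalg_pred : {pred A} := fun x => `[< subalg_gen x >].

Record subalg := Subalg { subalg_val : A; _ : subalg_val \in subalg_pred }.

HB.instance Definition _ := [isSub for subalg_val].
HB.instance Definition _ := [Choice of subalg by <:].

Fact subalg_closed_pred : GRing.subsemialg_closed subalg_pred.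
Proof.
split; first by apply/asboolP/Sub1.
- split; first by apply/asboolP; rewrite -(scale0r 1); apply/SubZ/Sub1.
  by move=> x y /asboolP ? /asboolP ?; apply/asboolP/SubD.
- by move=> c x /asboolP ?; apply/asboolP/SubZ.
- by move=> x y /asboolP ? /asboolP ?; apply/asboolP/SubM.
Qed.

HB.instance Definition _ :=
  GRing.SubChoice_isSubAlgebra.Build F A subalg_pred subalg subalg_closed_pred.

End Subalgebra.

Local Close Scope quotient_scope.

(* Formal power series with coefficients in a noncommutative ring, in a central
   indeterminate 'T. *)
Record fps (A : Type) := Fps { fps_coef :> nat -> A }.

Lemma fpsP (A : Type) (s t : fps A) : (forall n, s n = t n) -> s = t.
Proof. by case: s t => [s] [t] /= /funext ->. Qed.

HB.instance Definition _ (A : Type) := gen_eqMixin (fps A).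
HB.instance Definition _ (A : Type) := gen_choiceMixin (fps A).

Section FpsZmod.
Variable A : zmodType.
Implicit Types s t : fps A.

Definition fps_add s t := Fps (fun n => s n + t n).
Definition fps_opp s := Fps (fun n => - s n).
Definition fps_zero : fps A := Fps (fun=> 0).

Fact fps_addA : associative fps_add.
Proof. by move=> x y z; apply/fpsP => n /=; rewrite addrA. Qed.
Fact fps_addC : commutative fps_add.
Proof. by move=> x y; apply/fpsP => n /=; rewrite addrC. Qed.
Fact fps_add0 : left_id fps_zero fps_add.
Proof. by move=> x; apply/fpsP => n /=; rewrite add0r. Qed.
Fact fps_addN : left_inverse fps_zero fps_opp fps_add.
Proof. by move=> x; apply/fpsP => n /=; rewrite addNr. Qed.

HB.instance Definition _ :=
  GRing.isZmodule.Build (fps A) fps_addA fps_addC fps_add0 fps_addN.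

Lemma fps0E n : (0 : fps A) n = 0. Proof. by []. Qed.
Lemma fpsDE s t n : (s + t) n = s n + t n. Proof. by []. Qed.
Lemma fpsNE s n : (- s) n = - s n. Proof. by []. Qed.
Lemma fpsBE s t n : (s - t) n = s n - t n. Proof. by []. Qed.

Lemma fps_sumE I r (P : pred I) (G : I -> fps A) n :
  (\sum_(i <- r | P i) G i) n = \sum_(i <- r | P i) G i n.
Proof. by apply: (big_morph (fun s : fps A => s n)). Qed.
End FpsZmod.

Section FpsRing.
Variable A : nzRingType.
Implicit Types s t : fps A.

Definition fpsC (a : A) : fps A := Fps (fun n => if n == 0%N then a else 0).
Definition fps_mul s t := Fps (fun n => \sum_(i < n.+1) s i * t (n - i)%N).

Fact fps_mulE s t n : fps_mul s t n = \sum_(i < n.+1) s i * t (n - i)%N.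
Proof. by []. Qed.

Fact fps_mul_rev s t n :
  fps_mul s t n = \sum_(i < n.+1) s (n - i)%N * t i.
Proof.
rewrite /= (reindex_inj rev_ord_inj) /=.
by apply: eq_bigr => j _; rewrite (sub_ordK j).
Qed.

Fact fps_mulA : associative fps_mul.
Proof.
move=> p q r; apply/fpsP=> i; rewrite fps_mulE [RHS]fps_mul_rev.
pose coef3 j k := p j * (q (i - j - k)%N * r k).
transitivity (\sum_(j < i.+1) \sum_(k < i.+1 | (k <= i - j)%N) coef3 j k).
  apply: eq_bigr => j _; rewrite fps_mul_rev.
  by rewrite big_distrr /= (big_ord_narrow_leq (leq_subr _ _)).
rewrite (exchange_big_dep predT) //; apply: eq_bigr => k _.
transitivity (\sum_(j < i.+1 | (j <= i - k)%N) coef3 j k).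
  apply: eq_bigl => j; rewrite -ltnS -(ltnS j) -!subSn ?leq_ord //.
  by rewrite -subn_gt0 -(subn_gt0 j) -!subnDA addnC.
rewrite (big_ord_narrow_leq (leq_subr _ _)) fps_mulE big_distrl /=.
by apply: eq_bigr => j _; rewrite /coef3 -!subnDA addnC mulrA.
Qed.

Fact fps_mul1 : left_id (fpsC 1) fps_mul.
Proof.
move=> p; apply/fpsP => i; rewrite /= big_ord_recl /= mul1r subn0.
by rewrite big1 ?addr0 // => j _; rewrite mul0r.
Qed.

Fact fps_mulr1 : right_id (fpsC 1) fps_mul.
Proof.
move=> p; apply/fpsP => i; rewrite fps_mul_rev big_ord_recl /= mulr1 subn0.
by rewrite big1 ?addr0 // => j _; rewrite mulr0.
Qed.

Fact fps_mulDl : left_distributive fps_mul +%R.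
Proof.
move=> p q r; apply/fpsP => i /=; rewrite -big_split /=.
by apply: eq_bigr => j _; rewrite mulrDl.
Qed.

Fact fps_mulDr : right_distributive fps_mul +%R.
Proof.
move=> p q r; apply/fpsP => i /=; rewrite -big_split /=.
by apply: eq_bigr => j _; rewrite mulrDr.
Qed.

Fact fps_one_neq0 : fpsC 1 != 0.
Proof.
by apply/eqP => /(congr1 (fun s : fps A => s 0%N)) /= /eqP; rewrite oner_eq0.
Qed.

HB.instance Definition _ := GRing.Zmodule_isNzRing.Build (fps A)
  fps_mulA fps_mul1 fps_mulr1 fps_mulDl fps_mulDr fps_one_neq0.

Lemma fps1E n : (1 : fps A) n = (n == 0%N)%:R.
Proof. by rewrite /GRing.one /=; case: eqP. Qed.

Lemma fpsME s t n : (s * t) n = \sum_(i < n.+1) s i * t (n - i)%N.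
Proof. by []. Qed.

Definition fpsX : fps A := Fps (fun n => (n == 1%N)%:R).

(* The j-th summand contributes to the coefficients of order at least j only,
   provided that s has constant term 1. *)
Definition invS s : fps A := Fps (fun n => \sum_(j < n.+1) ((1 - s) ^+ j) n).

Lemma fpsX_coef_small s j n : s 0%N = 0 -> (n < j)%N -> (s ^+ j) n = 0.
Proof.
move=> s0; elim: j n => // j IH n ltnj.
rewrite exprS fpsME big_ord_recl /= s0 mul0r add0r big1 // => i _.
rewrite IH ?mulr0 // /bump leq0n add1n.
by apply: (@leq_trans n); rewrite // ltn_subrL (leq_ltn_trans _ (ltn_ord i)).
Qed.

Lemma mulS_invS s : s 0%N = 1 -> s * invS s = 1.
Proof.
move=> s0; set t := 1 - s; have t0 : t 0%N = 0 by rewrite fpsBE fps1E s0 subrr.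
have -> : s = 1 - t by rewrite opprB addrC subrK.
apply/fpsP => n.
have trunc m : (m <= n)%N -> invS (1 - t) m = (\sum_(j < n.+1) t ^+ j) m.
  move=> lemn; rewrite fps_sumE /= subKr (big_ord_widen n.+1 (fun j => (t ^+ j) m)) //.
  rewrite [RHS](bigID (fun j : 'I_n.+1 => (j < m.+1)%N)) /= [X in _ + X]big1 ?addr0 //.
  by move=> j; rewrite -leqNgt => /fpsX_coef_small ->.
transitivity (((1 - t) * (\sum_(j < n.+1) t ^+ j)) n).
  by rewrite !fpsME; apply: eq_bigr => i _; rewrite trunc // leq_subr.
rewrite -opprB mulNr -subrX1 opprB fpsBE fpsX_coef_small ?subr0 //.
Qed.

Lemma mul_invS s : s 0%N = 1 -> invS s * s = 1.
Proof.
move=> s0; have t0 : invS s 0%N = 1.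
  by rewrite /= big_ord_recl big_ord0 addr0 expr0 fps1E.
transitivity (invS s * s * (invS s * invS (invS s))).
  by rewrite (mulS_invS t0) mulr1.
by rewrite -mulrA (mulrA s) mulS_invS // mul1r mulS_invS.
Qed.

Lemma fpsX_coef_cong s t n j :
  (forall k, (k <= n)%N -> s k = t k) -> (s ^+ j) n = (t ^+ j) n.
Proof.
elim: j n => [|j IH] n eqst; first by rewrite !expr0.
rewrite !exprS !fpsME; apply: eq_bigr => i _.
congr (_ * _); first by apply: eqst; rewrite -ltnS.
by apply: IH => k lek; apply: eqst; exact: leq_trans lek (leq_subr _ _).
Qed.
End FpsRing.

Notation "''T'" := (@fpsX _) (at level 0) : ring_scope.

Section FpsAlgebra.
Variables (F : fieldType) (A : algType F).
Implicit Types (s t : fps A) (c : F).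

Definition fps_scale c s := Fps (fun n => c *: s n).

Fact fps_scalerA a b s : fps_scale a (fps_scale b s) = fps_scale (a * b) s.
Proof. by apply/fpsP => n /=; rewrite scalerA. Qed.
Fact fps_scale1 : left_id 1 fps_scale.
Proof. by move=> s; apply/fpsP => n /=; rewrite scale1r. Qed.
Fact fps_scalerDr : right_distributive fps_scale +%R.
Proof. by move=> c s t; apply/fpsP => n /=; rewrite scalerDr. Qed.
Fact fps_scalerDl s : {morph fps_scale^~ s : a b / a + b}.
Proof. by move=> a b; apply/fpsP => n /=; rewrite scalerDl. Qed.

HB.instance Definition _ := GRing.Zmodule_isLmodule.Build F (fps A)
  fps_scalerA fps_scale1 fps_scalerDr fps_scalerDl.

Fact fps_scalerAl c s t : c *: (s * t) = (c *: s) * t.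
Proof.
apply/fpsP => n; rewrite /= scaler_sumr.
by apply: eq_bigr => i _; rewrite scalerAl.
Qed.

HB.instance Definition _ := GRing.Lmodule_isLalgebra.Build F (fps A) fps_scalerAl.

Fact fps_scalerAr c s t : c *: (s * t) = s * (c *: t).
Proof.
apply/fpsP => n; rewrite /= scaler_sumr.
by apply: eq_bigr => i _; rewrite scalerAr.
Qed.

HB.instance Definition _ := GRing.Lalgebra_isAlgebra.Build F (fps A) fps_scalerAr.

Lemma fpsZE c s n : (c *: s) n = c *: s n. Proof. by []. Qed.

(* As in invS, the truncation is exact if s has no constant term. *)
Definition expS s : fps A :=
  Fps (fun n => \sum_(j < n.+1) (j`!%:R^-1 : F) *: (s ^+ j) n).

(* The logarithm: the unique t without constant term such that expS t = s
   (see lnSP and expS_inj), which exists if s has constant term 1. *)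
Definition lnS s : fps A :=
  if pselect (exists t, t 0%N = 0 /\ expS t = s) is left h
  then projT1 (cid h) else 0.

Lemma fpsX_coef_eq s t n j : s 0%N = 0 -> t 0%N = 0 ->
  (forall k, (k < n)%N -> s k = t k) -> j != 1%N -> (s ^+ j) n = (t ^+ j) n.
Proof.
move=> s0 t0 eqst; case: j => [|[|j]]; [by move=> _| by move/eqP|move=> _].
rewrite [s ^+ _]exprS [t ^+ _]exprS !fpsME; apply: eq_bigr => -[i ltin] _ /=.
case: i ltin => [|i] ltin; first by rewrite s0 t0 !mul0r.
have [ltn|] := ltnP i.+1 n; last first.
  move=> len; have -> : (n - i.+1 = 0)%N by apply/eqP; rewrite subn_eq0.
  by rewrite !fpsX_coef_small ?mulr0.
congr (_ * _); first exact: eqst.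
apply: fpsX_coef_cong => k lek; apply: eqst.
by apply: leq_ltn_trans lek _; rewrite ltn_subrL /= (leq_ltn_trans _ ltn).
Qed.

Lemma expS0 s : expS s 0%N = 1.
Proof. by rewrite /= big_ord_recl big_ord0 addr0 expr0 fps1E fact0 invr1 scale1r. Qed.

Lemma expS_coefB s t n : s 0%N = 0 -> t 0%N = 0 ->
  (forall k, (k < n)%N -> s k = t k) -> expS s n - expS t n = s n - t n.
Proof.
case: n => [|n] s0 t0 eqst; first by rewrite !expS0 s0 t0 !subrr.
rewrite /= -sumrB (bigD1 (lift ord0 ord0)) //= big1 ?addr0 => [|j jn1].
  by rewrite /bump /= !expr1 invr1 !scale1r.
by rewrite (fpsX_coef_eq (t := t) s0) ?subrr.
Qed.

Lemma expS_inj s t : s 0%N = 0 -> t 0%N = 0 -> expS s = expS t -> s = t.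
Proof.
move=> s0 t0 est; apply/fpsP; elim/ltn_ind => n IH.
by apply/eqP; rewrite -subr_eq0 -(expS_coefB s0 t0 IH) est subrr.
Qed.

Lemma expS_surj s : s 0%N = 1 -> exists t, t 0%N = 0 /\ expS t = s.
Proof.
move=> s0.
pose next t m : fps A :=
  Fps (fun n => if n == m then t n + (s n - expS t n) else t n).
pose approx := fix approx m : fps A :=
  if m is m'.+1 then next (approx m') m' else 0.
pose t : fps A := Fps (fun n => approx n.+1 n).
have approx_ge m n : (m <= n)%N -> approx m n = 0.
  elim: m => //= m IH ltmn; rewrite (gtn_eqF ltmn) IH //; exact: ltnW.
have approx_lt m n : (n < m)%N -> approx m n = t n.
  elim: m => // m IH; rewrite ltnS leq_eqVlt => /orP[/eqP-> //|ltnm].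
  by rewrite /= (ltn_eqF ltnm) IH.
have nextE u m n :
  next u m n = if n == m then u n + (s n - expS u n) else u n by [].
have a0 m : approx m 0%N = 0.
  elim: m => // m IH; rewrite -[approx m.+1]/(next (approx m) m) nextE IH.
  by rewrite expS0 s0 subrr addr0 if_same.
have t0 : t 0%N = 0 by rewrite -(approx_lt 1%N) // a0.
exists t; split=> //; apply/fpsP => n.
have := expS_coefB t0 (a0 n) (fun k ltk => esym (approx_lt n k ltk)).
rewrite -[t n]/(next (approx n) n n) nextE eqxx (approx_ge n n) // add0r subr0.
by move/eqP; rewrite subr_eq subrK => /eqP.
Qed.

Lemma lnSP s : s 0%N = 1 -> lnS s 0%N = 0 /\ expS (lnS s) = s.
Proof.
move=> s0; rewrite /lnS; case: pselect => [h|]; last by case; exact: expS_surj.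
exact: (projT2 (cid h)).
Qed.

End FpsAlgebra.

Definition map_fps (A B : Type) (f : A -> B) (s : fps A) : fps B :=
  Fps (fun n => f (s n)).

Section MapFps.
Variables (A B : nzRingType) (f : {rmorphism A -> B}).

Fact map_fps_additive : zmod_morphism (map_fps f).
Proof. by move=> s t; apply/fpsP => n /=; rewrite raddfB. Qed.

Fact map_fps_monoid : monoid_morphism (map_fps f).
Proof.
split.
  apply/fpsP => n; rewrite (fps1E B) -[LHS]/(f ((1 : fps A) n)).
  by rewrite fps1E rmorph_nat.
move=> s t; apply/fpsP => n; rewrite /= rmorph_sum.
by apply: eq_bigr => i _; rewrite rmorphM.
Qed.

HB.instance Definition _ :=
  GRing.isZmodMorphism.Build (fps A) (fps B) (map_fps f) map_fps_additive.
HB.instance Definition _ :=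
  GRing.isMonoidMorphism.Build (fps A) (fps B) (map_fps f) map_fps_monoid.
End MapFps.

Section MapFpsLinear.
Variables (F : fieldType) (A B : algType F) (f : {lrmorphism A -> B}).

Fact map_fps_scalable : scalable (map_fps f).
Proof. by move=> c s; apply/fpsP => n /=; rewrite linearZ. Qed.

HB.instance Definition _ :=
  GRing.isScalable.Build F (fps A) (fps B) *:%R (map_fps f) map_fps_scalable.
End MapFpsLinear.

Lemma free_eval_consistent (F : fieldType) (X : choiceType) (v : X -> F)
    (r : free_alg F X -> free_alg F X -> Prop) :
  (forall x y, r x y -> free_eval v x = free_eval v y) -> consistent r.
Proof.
move=> rv; suff Iv x : ideal_gen r x -> free_eval v x = 0.
  by move=> /Iv /eqP; rewrite rmorph1 /= oner_eq0.
elim=> [|y z _ Hy _ Hz|a b y z ryz]; first by rewrite rmorph0.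
  by rewrite rmorphD /= Hy Hz addr0.
by rewrite !rmorphM rmorphB /= (rv _ _ ryz) subrr mulr0 mul0r.
Qed.

(* The matrix with the given rows; entries are numbered from 0. *)
Definition rows_mx (R : nzRingType) m n (rows : seq (seq R)) : 'M[R]_(m, n) :=
  \matrix_(i < m, j < n) nth 0 (nth [::] rows i) j.

(* -------------------------------------------------------------------- *)

Inductive UqT_gen :=
| Yneg of nat   (* Yneg k is Y_{-k} *)
| Ypos of nat   (* Ypos k is Y_{k+1} *)
| Zpos of nat   (* Zpos k is Z_{k+1} *)
| Ztil of nat.  (* Ztil k is \tilde Z_{k+1} *)

HB.instance Definition _ := gen_eqMixin UqT_gen.
HB.instance Definition _ := gen_choiceMixin UqT_gen.

Section UqTAlgebra.
Variables (F : fieldType) (q : F).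

(* rho is \bar\rho, kbarp and kbarm are \bar k_+ and \bar k_-, and epsp, epsm
   (below) are \bar\epsilon_+ and \bar\epsilon_-. *)
Definition rho : F := q^-1 * (q ^+ 2 - q ^- 2) ^+ 2.
Definition kbarp : F := q^-1 * (q - q^-1).
Definition kbarm : F := q - q^-1.
Definition epsp : F := q + q^-1.

Definition comm (A : algType F) (x y : A) : A := x * y - y * x.
Definition qcomm (A : algType F) (x y : A) : A :=
  q *: (x * y) - q^-1 *: (y * x).

Section UqTRelations.
Variables (A : algType F) (g : UqT_gen -> A).
Let Ym k := g (Yneg k).
Let Yp k := g (Ypos k).
Let Z k := g (Zpos k).
Let Zt k := g (Ztil k).

Inductive UqT_rel : A -> A -> Prop :=
| UqT_Y1Ym k : UqT_rel (comm (Yp 0) (Ym k)) ((q + q^-1)^-1 *: (Z k - Zt k))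
| UqT_YpY0 k : UqT_rel (comm (Yp k) (Ym 0)) ((q + q^-1)^-1 *: (Z k - Zt k))
| UqT_Y1Zt k : UqT_rel (qcomm (Yp 0) (Zt k)) (rho *: Yp k.+1)
| UqT_ZY1 k : UqT_rel (qcomm (Z k) (Yp 0)) (rho *: Yp k.+1)
| UqT_ZtY0 k : UqT_rel (qcomm (Zt k) (Ym 0)) (rho *: Ym k.+1)
| UqT_Y0Z k : UqT_rel (qcomm (Ym 0) (Z k)) (rho *: Ym k.+1)
| UqT_YpYp k l : UqT_rel (comm (Yp k) (Yp l)) 0
| UqT_YmYm k l : UqT_rel (comm (Ym k) (Ym l)) 0
| UqT_YpYm k l : UqT_rel (comm (Yp k) (Ym l) + comm (Ym k) (Yp l)) 0
| UqT_YpZt k l : UqT_rel (comm (Yp k) (Zt l) + comm (Zt k) (Yp l)) 0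
| UqT_YpZ k l : UqT_rel (comm (Yp k) (Z l) + comm (Z k) (Yp l)) 0
| UqT_YmZt k l : UqT_rel (comm (Ym k) (Zt l) + comm (Zt k) (Ym l)) 0
| UqT_YmZ k l : UqT_rel (comm (Ym k) (Z l) + comm (Z k) (Ym l)) 0
| UqT_ZtZt k l : UqT_rel (comm (Zt k) (Zt l)) 0
| UqT_ZZ k l : UqT_rel (comm (Z k) (Z l)) 0
| UqT_ZZt k l : UqT_rel (comm (Z k) (Zt l) + comm (Zt k) (Z l)) 0.

Lemma UqT_rel_aug (v : {lrmorphism A -> F | *%R}) :
  (forall x, v (g x) = 0) -> forall x y, UqT_rel x y -> v x = v y.
Proof.
move=> vg; have C a b : v (comm a b) = 0.
  by rewrite /comm rmorphB !rmorphM /= mulrC subrr.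
have Q a b : v (qcomm (g a) b) = 0.
  by rewrite /qcomm rmorphB /= !linearZ_LR /= !rmorphM /= vg mul0r !mulr0 subrr.
have D a b c d : v (comm a b + comm c d) = 0 by rewrite rmorphD /= !C addr0.
move=> x y; case=> *; rewrite /Ym /Yp /Z /Zt ?(C, Q, D) ?rmorph0 //;
  by rewrite linearZ_LR /= ?rmorphB /= !vg ?subrr mulr0.
Qed.
End UqTRelations.

Fact UqT_consistent : consistent (UqT_rel (@free_gen F UqT_gen)).
Proof.
apply: (@free_eval_consistent _ _ (fun=> 0)).
by apply: UqT_rel_aug => x; exact: free_eval_gen.
Qed.

Definition UqT := quo_alg UqT_consistent.
HB.instance Definition _ := GRing.Algebra.on UqT.

Definition UqT_elt (x : UqT_gen) : UqT := quo_pi UqT_consistent (free_gen F x).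
End UqTAlgebra.

(* -------------------------------------------------------------------- *)

Inductive Uq_gen :=
| Xplus of int          (* x^+_k *)
| Xminus of int         (* x^-_k *)
| Kplus of 'I_2 & nat   (* Kplus i l is k^+_{i+1,-l} *)
| Kminus of 'I_2 & nat  (* Kminus i l is k^-_{i+1,l} *)
| Chalf                 (* q^{c/2} *)
| Chalfinv.             (* q^{-c/2} *)

HB.instance Definition _ := gen_eqMixin Uq_gen.
HB.instance Definition _ := gen_choiceMixin Uq_gen.

Section LOperators.
Variables (F : fieldType) (q : F) (A : algType F) (g : Uq_gen -> A).

(* Cpow m is C^{m/2} = q^{m c/2}. *)
Definition Cpow (m : int) : A :=
  match m with Posz n => g Chalf ^+ n | Negz n => g Chalfinv ^+ n.+1 end.

(* Series with a + (resp. -) are expanded in z (resp. z^{-1}). *)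
Definition e_plus : fps A :=
  (q - q^-1) *: Fps (fun k => q ^- k *: (Cpow k * g (Xminus (- k%:Z)))).
Definition e_minus : fps A :=
  - (q - q^-1) *: Fps (fun k =>
      if k == 0%N then 0 else q ^+ k *: (Cpow k * g (Xminus k))).
Definition f_plus : fps A :=
  (q - q^-1) *: Fps (fun k =>
      if k == 0%N then 0 else q ^- k *: (Cpow (- k%:Z) * g (Xplus (- k%:Z)))).
Definition f_minus : fps A :=
  - (q - q^-1) *: Fps (fun k => q ^+ k *: (Cpow (- k%:Z) * g (Xplus k))).
Definition k_plus (i : 'I_2) : fps A := Fps (fun k => g (Kplus i k)).
Definition k_minus (i : 'I_2) : fps A := Fps (fun k => g (Kminus i k)).

Definition Lmx (k1 k2 e f : fps A) : 'M[fps A]_2 :=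
  rows_mx 2 2 [:: [:: k1    ; k1 * f          ];
                  [:: e * k1; k2 + e * k1 * f ]].

Definition L_plus : 'M[fps A]_2 := Lmx (k_plus 0) (k_plus 1) e_plus f_plus.
Definition L_minus : 'M[fps A]_2 := Lmx (k_minus 0) (k_minus 1) e_minus f_minus.

(* The coefficient of z^m in L^+(z) (pos = true) or in L^-(z). *)
Definition Lcoef (pos : bool) (m : int) : 'M[A]_2 :=
  if (if pos then 0 <= m else m <= 0)
  then map_mx (fun s : fps A => s `|m|%N) (if pos then L_plus else L_minus)
  else 0.

Definition Rmx (a b c : fps F) : 'M[fps F]_(2 * 2) :=
  rows_mx (2 * 2) (2 * 2) [:: [:: 1; 0; 0; 0];
                              [:: 0; a; b; 0];
                              [:: 0; c; a; 0];
                              [:: 0; 0; 0; 1]].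

(* \tilde R(x) as a power series in T = x (dir = true) or in T = x^{-1}.
   In the first case, 1 / (x q - q^{-1}) = - q / (1 - q^2 T); in the second,
   1 / (x q - q^{-1}) = T d with d = q^{-1} / (1 - q^{-2} T). *)
Definition Rtilde (dir : bool) : 'M[fps F]_(2 * 2) :=
  if dir then
    let d := fpsC (- q) * invS (1 - fpsC (q ^+ 2) * 'T) in
    Rmx (('T - 1) * d) (fpsC (q - q^-1) * 'T * d) (fpsC (q - q^-1) * d)
  else
    let d := fpsC q^-1 * invS (1 - fpsC (q ^- 2) * 'T) in
    Rmx ((1 - 'T) * d) (fpsC (q - q^-1) * d) (fpsC (q - q^-1) * 'T * d).

Definition Rcoef (dir : bool) (n : nat) : 'M[A]_(2 * 2) :=
  map_mx (fun s : fps F => (s n)%:A) (Rtilde dir).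

(* The coefficients of z^a w^b in the two sides of
     \tilde R(t z/w) (L(z) (x) 1) (1 (x) L'(w))
       = (1 (x) L'(w)) (L(z) (x) 1) \tilde R(t' z/w),
   with t, t' central (and t = t' = 1 for the expansion in w/z).  The sums over
   n are finite: in the cases used below, L(z) and L'(w) have no terms that
   would contribute for n > |a| + |b|. *)
Definition dirz (dir : bool) (n : nat) : int := if dir then n%:Z else - n%:Z.

Definition RLL dir (t : A) (pos pos' : bool) (a b : int) : 'M[A]_(2 * 2) :=
  \sum_(n < (`|a| + `|b|).+1)
    (t ^+ n *: Rcoef dir n) *m (Lcoef pos (a - dirz dir n) *t 1%:M)
                            *m (1%:M *t Lcoef pos' (b + dirz dir n)).

Definition LLR dir (t : A) (pos pos' : bool) (a b : int) : 'M[A]_(2 * 2) :=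
  \sum_(n < (`|a| + `|b|).+1)
    (1%:M *t Lcoef pos' (b + dirz dir n)) *m (Lcoef pos (a - dirz dir n) *t 1%:M)
                                          *m (t ^+ n *: Rcoef dir n).
Inductive Uq_rel : A -> A -> Prop :=
| Uq_CCinv : Uq_rel (g Chalf * g Chalfinv) 1
| Uq_CinvC : Uq_rel (g Chalfinv * g Chalf) 1
| Uq_Ccentral x : Uq_rel (g Chalf * g x) (g x * g Chalf)
| Uq_Cinvcentral x : Uq_rel (g Chalfinv * g x) (g x * g Chalfinv)
| Uq_kpkm i : Uq_rel (g (Kplus i 0) * g (Kminus i 0)) 1
| Uq_kmkp i : Uq_rel (g (Kminus i 0) * g (Kplus i 0)) 1
| Uq_RLL_same (pos dir : bool) (a b : int) i j :
    Uq_rel (RLL dir 1 pos pos a b i j) (LLR dir 1 pos pos a b i j)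
| Uq_RLL_mixed (a b : int) i j :
    Uq_rel (RLL true (Cpow 2) true false a b i j)
           (LLR true (Cpow (- 2)) true false a b i j).

Section Augmentation.
Variable v : {lrmorphism A -> F | *%R}.
Hypothesis vX : forall k, v (g (Xplus k)) = 0.
Hypothesis vY : forall k, v (g (Xminus k)) = 0.
Hypothesis vKp : forall i n, v (g (Kplus i n)) = (n == 0%N)%:R.
Hypothesis vKm : forall i n, v (g (Kminus i n)) = (n == 0%N)%:R.
Hypothesis vC : v (g Chalf) = 1.
Hypothesis vCi : v (g Chalfinv) = 1.

Let v_Cpow m : v (Cpow m) = 1.
Proof. by case: m => n; rewrite /Cpow rmorphXn /= ?vC ?vCi expr1n. Qed.

Let v_k pos i : map_fps v (if pos then k_plus i else k_minus i) = 1.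
Proof. by apply/fpsP => n; rewrite fps1E; case: pos; rewrite /= ?vKp ?vKm. Qed.

Let v_0 c (s : nat -> A) :
  (forall n, v (s n) = 0) -> map_fps v (c *: Fps s) = 0.
Proof. by move=> s0; apply/fpsP => n; rewrite /= linearZ_LR /= s0 mulr0. Qed.

Let v_e pos : map_fps v (if pos then e_plus else e_minus) = 0.
Proof.
case: pos; apply: v_0 => n; last case: eqP => _; rewrite ?rmorph0 //;
  by rewrite linearZ_LR /= rmorphM /= vY !mulr0.
Qed.

Let v_f pos : map_fps v (if pos then f_plus else f_minus) = 0.
Proof.
case: pos; apply: v_0 => n; first case: eqP => _; rewrite ?rmorph0 //;
  by rewrite linearZ_LR /= rmorphM /= vX !mulr0.
Qed.

Let v_L pos : map_mx (map_fps v) (if pos then L_plus else L_minus) = 1%:M.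
Proof.
have -> : (if pos then L_plus else L_minus)
  = Lmx (if pos then k_plus 0 else k_minus 0)
        (if pos then k_plus 1 else k_minus 1)
        (if pos then e_plus else e_minus)
        (if pos then f_plus else f_minus) by case: pos.
move: (v_k pos 0) (v_k pos 1) (v_e pos) (v_f pos).
move: (if pos then k_plus 0 else _) (if pos then k_plus 1 else _).
move: (if pos then e_plus else _) (if pos then f_plus else _).
move=> e f k1 k2 vk1 vk2 ve vf; apply/matrixP => i j; rewrite !mxE.
case: i => -[|[|//]] /= ?; case: j => -[|[|//]] /= ?;
  by rewrite ?rmorphD ?rmorphM /= ?vk1 ?vk2 ?ve ?vf ?mulr0 ?mul0r ?addr0.
Qed.

Let v_Lcoef pos m : map_mx v (Lcoef pos m) = (m == 0)%:R%:M.
Proof.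
rewrite /Lcoef; case: ifPn => [_|mpos]; last first.
  rewrite (_ : m == 0 = false) ?map_mx0 ?raddf0 //.
  by apply: contraNF mpos => /eqP ->; case: pos.
move: (v_L pos); move: (if pos then L_plus else _) => L vL.
apply/matrixP => i j; rewrite !mxE.
have /matrixP/(_ i j) := vL; rewrite !mxE => /(congr1 (fun s : fps F => s `|m|%N)).
rewrite /= => ->; case: (i == j); last by rewrite !mulr0n.
by rewrite mulr1n fps1E absz_eq0 mulr1n.
Qed.

Let v_tens (M N : 'M[A]_2) : map_mx v (M *t N) = map_mx v M *t map_mx v N.
Proof. by apply/matrixP => i j; rewrite !mxE rmorphM. Qed.

Let scalar_tens (c d : F) : (c%:M : 'M_2) *t (d%:M : 'M_2) = (c * d)%:M.
Proof.
apply/matrixP => i j; case: (mxtens_indexP i) => i1 i2.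
case: (mxtens_indexP j) => j1 j2; rewrite tensmxE !mxE.
rewrite (can_eq (@mxtens_indexK 2 2)) xpair_eqE.
by case: (i1 == j1); case: (i2 == j2); rewrite ?mulr1n ?mulr0n ?mulr0 ?mul0r.
Qed.

Let v_RLL dir t t' pos pos' a b : v t = 1 -> v t' = 1 ->
  map_mx v (RLL dir t pos pos' a b) = map_mx v (LLR dir t' pos pos' a b).
Proof.
move=> t1 t'1; rewrite /RLL /LLR !map_mx_sum; apply: eq_bigr => n _.
rewrite !map_mxM /= !map_mxZ /= !rmorphXn /= t1 t'1 !expr1n !scale1r.
rewrite !v_tens !v_Lcoef !map_mx1 !scalar_tens.
rewrite !mul_mx_scalar -!scalemxAl !mul_scalar_mx !scalerA.
by rewrite !mulr1 !mul1r mulrC.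
Qed.

Lemma Uq_rel_aug x y : Uq_rel x y -> v x = v y.
Proof.
case=> [||u|u|i|i|pos dir a b i j|a b i j].
- by rewrite rmorphM rmorph1 /= vC vCi mulr1.
- by rewrite rmorphM rmorph1 /= vC vCi mulr1.
- by rewrite !rmorphM /= mulrC.
- by rewrite !rmorphM /= mulrC.
- by rewrite rmorphM rmorph1 /= vKp vKm mulr1.
- by rewrite rmorphM rmorph1 /= vKp vKm mulr1.
- have /matrixP/(_ i j) := v_RLL dir pos pos a b (rmorph1 v) (rmorph1 v).
  by rewrite !mxE.
- have /matrixP/(_ i j) := v_RLL true true false a b (v_Cpow 2) (v_Cpow (- 2)).
  by rewrite !mxE.
Qed.
End Augmentation.
End LOperators.

Section UqAlgebra.
Variables (F : fieldType) (q : F).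

Fact Uq_consistent : consistent (Uq_rel q (@free_gen F Uq_gen)).
Proof.
pose v x : F := match x with
  | Xplus _ | Xminus _ => 0
  | Kplus _ n | Kminus _ n => (n == 0%N)%:R
  | Chalf | Chalfinv => 1
  end.
apply: (@free_eval_consistent _ _ v).
by apply: Uq_rel_aug => *; rewrite /= free_eval_gen.
Qed.

Definition Uq := quo_alg Uq_consistent.
HB.instance Definition _ := GRing.Algebra.on Uq.

Definition Uq_elt (x : Uq_gen) : Uq := quo_pi Uq_consistent (free_gen F x).
End UqAlgebra.

(* -------------------------------------------------------------------- *)
(* Series in u^{-1}: 'T stands for u^{-1}. *)

Section SpectralSeries.
Variables (F : fieldType) (A : algType F).
Implicit Types (s : fps A) (w : A) (a : nat -> A).

(* sum0 w a   is \sum_(k >= 0) a_k (w u^{-2})^k,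
   sum1 w a   is \sum_(k >= 0) a_k (w u^{-2})^{k+1},
   sum2 w b   is \sum_(k, l >= 0) b_{k,l} (w u^{-2})^{k+l+1},  w central. *)
Definition sum0 w a : fps A :=
  Fps (fun n => if odd n then 0 else a n./2 * w ^+ n./2).
Definition sum1 w a : fps A := sum0 w (fun n => if n is k.+1 then a k else 0).
Definition sum2 w (b : nat -> nat -> A) : fps A :=
  sum1 w (fun m => \sum_(k < m.+1) b k (m - k)%N).

(* u s(u), for s without constant term. *)
Definition mulu s : fps A := Fps (fun n => s n.+1).

(* s(c u) *)
Definition dilate (c : F) s : fps A := Fps (fun n => c ^- n *: s n).
End SpectralSeries.

Section QuantumDeterminant.
Variables (F : fieldType) (q : F).
Local Notation UT := (UqT q).
Local Notation elt := (UqT_elt q).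

Definition Uinv : UT := ((q + q^-1) / q)%:A.

Definition Y_plus_ser : fps UT := sum1 Uinv (fun k => elt (Ypos k)).
Definition Y_minus_ser : fps UT := sum1 Uinv (fun k => elt (Yneg k)).
Definition Z_plus_ser : fps UT := sum1 Uinv (fun k => elt (Ztil k)).
Definition Z_minus_ser : fps UT := sum1 Uinv (fun k => elt (Zpos k)).

Definition Kop : 'M[fps UT]_2 :=
  rows_mx 2 2
    [:: [:: q *: mulu Y_plus_ser;
            (kbarm q * (q + q^-1))^-1 *: Z_plus_ser
              + (kbarp q * (q + q^-1) / (q - q^-1))%:A];
        [:: (kbarp q * (q + q^-1))^-1 *: Z_minus_ser
              + (kbarm q * (q + q^-1) / (q - q^-1))%:A;
            q *: mulu Y_minus_ser]].

Definition R0 : 'M[fps UT]_(2 * 2) :=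
  rows_mx (2 * 2) (2 * 2) [:: [:: 1; 0        ; 0        ; 0];
                              [:: 0; (q^-1)%:A; 0        ; 0];
                              [:: 0; 0        ; (q^-1)%:A; 0];
                              [:: 0; 0        ; 0        ; 1]].

Definition Pmx : 'M[fps UT]_(2 * 2) :=
  rows_mx (2 * 2) (2 * 2) [:: [:: 1; 0; 0; 0];
                              [:: 0; 0; 1; 0];
                              [:: 0; 1; 0; 0];
                              [:: 0; 0; 0; 1]].

Definition Pminus : 'M[fps UT]_(2 * 2) := (2^-1 : F)%:A *: (1%:M - Pmx).

Definition Gamma : fps UT :=
  \tr (Pminus *m (Kop *t 1%:M) *m R0 *m (1%:M *t map_mx (dilate q) Kop)).
End QuantumDeterminant.

(* -------------------------------------------------------------------- *)

Section DrinfeldElements.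
Variables (F : fieldType) (q : F).
Local Notation U := (Uq q).
Local Notation elt := (Uq_elt q).
Local Notation C_ := (Cpow elt).

Definition xp (k : int) : U := elt (Xplus k).
Definition xm (k : int) : U := elt (Xminus k).

(* k^+_{i,0} and k^-_{i,0} are mutually inverse. *)
Definition Kelt : U := elt (Kminus 1 0) * elt (Kplus 0 0).
Definition Kinv : U := elt (Kminus 0 0) * elt (Kplus 1 0).

(* a_{i,m} for m > 0, from
     k^-_i(z) = k^-_{i,0} exp (- (q - q^{-1}) \sum_(n >= 1) a_{i,n} z^{-n}). *)
Definition a_elt (i : 'I_2) (m : nat) : U :=
  - (q - q^-1)^-1 *: lnS (fpsC (elt (Kplus i 0)) * k_minus elt i) m.

Definition gamma (m : nat) : U := q ^+ m *: a_elt 0 m + q ^- m *: a_elt 1 m.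
Definition h_elt (m : nat) : U := q ^- m *: (a_elt 0 m - a_elt 1 m).

(* psi(z), as a series in 'T = z^{-1}. *)
Definition psi : fps U :=
  fpsC Kelt * expS ((q - q^-1) *:
    Fps (fun k => if k == 0%N then 0 else h_elt k)).

Inductive Uprime_gen : U -> Prop :=
| Uprime_xp (k : nat) : Uprime_gen (C_ (- k%:Z) * Kinv * xp k)
| Uprime_xm (k : nat) : Uprime_gen (C_ k.+1 * xm k.+1)
| Uprime_a1 (k : nat) : Uprime_gen (a_elt 0 k.+1)
| Uprime_a2 (k : nat) : Uprime_gen (a_elt 1 k.+1)
| Uprime_K : Uprime_gen Kelt
| Uprime_Kinv : Uprime_gen Kinv
| Uprime_C : Uprime_gen (C_ 1)
| Uprime_Cinv : Uprime_gen (C_ (- 1)).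

Definition Uprime := subalg Uprime_gen.
HB.instance Definition _ := GRing.Algebra.on Uprime.

Definition epsm : U := (q * (q + q^-1)) *: C_ (- 2).
Definition lambda : U := C_ 3.
Definition lambda_inv : U := C_ (- 3).

Definition gamma' (n : nat) : U :=
  - ((q - q^-1) ^+ (2 * n - 1) / n%:R)
    *: ((epsp q / (rho q * q)) *: (epsm * lambda)) ^+ n.

(* (q u^2 lambda)^{-1} = ql u^{-2} *)
Definition ql : U := q^-1 *: lambda_inv.

Definition g_ser : fps U :=
  expS (- (q - q^-1) *: sum1 ql (fun k =>
    (q ^+ k.+1 + q ^- k.+1)^-1 *: (h_elt k.+1 + gamma' k.+1))).
(* c_ser is c(u), cc_ser is \mathsf c(u). *)
Definition c_ser : fps U :=
  expS (- (q - q^-1) *: sum1 ql (fun k =>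
    (q ^+ k.+1 + q ^- k.+1)^-1 *: gamma' k.+1)).
Definition cc_ser : fps U :=
  expS (- (q - q^-1) *: sum1 ql (fun k =>
    (q ^+ k.+1 + q ^- k.+1)^-1 *: gamma k.+1)).

(* (q u^2)^{-1} *)
Definition qu2_inv : fps U := q^-1 *: 'T ^+ 2.

(* psi(u^2 lambda) *)
Definition psi_u : fps U := sum0 lambda_inv psi.

Definition N_plus : fps U :=
  g_ser * (- (kbarm q * (q ^+ 2 + 1)) *: (qu2_inv * sum0 ql (fun k =>
               q ^+ k *: (C_ (- k%:Z) * Kinv * xp k)))
           + epsp q *: (qu2_inv * fpsC Kinv)).

Definition N_minus : fps U :=
  (- (kbarp q * (q ^- 2 + 1)) *: sum1 ql (fun k =>
       q ^+ k.+1 *: (C_ k.+1 * xm k.+1))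
   + fpsC epsm * (q^-1 *: (qu2_inv *
       (psi_u + (q - q^-1) ^+ 2 *: sum2 ql (fun k l =>
          q ^ (k%:Z - l%:Z) *: (C_ (k%:Z - l%:Z + 1) * xm k.+1 * xp l))))))
  * g_ser.

Definition M_plus : fps U :=
  ((rho q / (q - q^-1))%:A
   - fpsC epsm * ((kbarm q * q^-1 * (q ^+ 2 - q ^- 2)) *: (qu2_inv *
       sum0 ql (fun k => q ^- k *: (C_ (- k%:Z) * xp k)))))
  * g_ser - (rho q / (q - q^-1))%:A.

Definition M_minus : fps U :=
  g_ser * ((rho q / (q - q^-1)) *: (fpsC Kinv * psi_u)
   - (epsp q * kbarp q * (q ^+ 2 - q ^- 2)) *: sum1 ql (fun k =>
       q ^ (- k%:Z + 1) *: (C_ k.+1 * xm k.+1 * Kinv))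
   + (rho q * (q - q^-1)) *: sum2 ql (fun k l =>
       q ^ (- k%:Z + l%:Z) *:
         (C_ (k%:Z - l%:Z + 1) * Kinv * xm k.+1 * xp l)))
  - (rho q / (q - q^-1))%:A.

(* The formulas that determine mu, read in Uq[[u^{-1}]]. *)
Definition mu_spec (mu : UqT q -> Uprime) : Prop :=
  let mu_ := map_fps (fun x => subalg_val (mu x)) in
  let r : fps U := (rho q / (q - q^-1))%:A in
  [/\ mu_ (Y_plus_ser q) = N_plus * invS c_ser * cc_ser,
      mu_ (Y_minus_ser q) = N_minus * invS c_ser * cc_ser,
      mu_ (Z_plus_ser q) = (M_plus + r) * invS c_ser * cc_ser - r
    & mu_ (Z_minus_ser q) = (M_minus + r) * invS c_ser * cc_ser - r].
End DrinfeldElements.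

(* The field C(q), with C = R[i] for R a model of the real numbers. *)
Definition Cq (R : realType) : fieldType := {fraction {poly R[i]}}.
Definition q_ (R : realType) : Cq R := tofrac ('X : {poly R[i]}).

(* Main.v *)
(* Write z = q u^2 lambda, let L = L^-(z) and L' = L(q^2 z).  Restricting the RTT
   relation to w = q^2 z shows that L_{1k} L'_{2l} - q^{-1} L_{2k} L'_{1l} equals
   qdet times the q-antisymmetric tensor, with qdet = k_1(z) k_2(q^2 z) by the Gauss
   decomposition; fusing two RTT relations gives that qdet is central.  Its logarithm is
   the generating series of the gamma_n, so gamma_n is central and
   g(u) c(u)^{-1} \mathsf c(u) collapses to k^+_{1,0} k_1(z).  The images of
   Y_+, Y_-, Z_+ and Z_- then become linear combinations of the entries in one row of
   L, multiplied by k^+_{1,0} or k^+_{2,0}.  The trace Gamma splits into two halves, and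
   in each of them the pairing of these combinations with the antisymmetry relation
   leaves the same scalar multiple of k^+_{1,0} k^+_{2,0} qdet. *)
Require Import Defs.
From HB Require Import structures.
From mathcomp Require Import all_boot all_order all_algebra.
From mathcomp Require Import boolp reals.
From mathcomp Require Import complex mxtens monalg.
From mathcomp Require Import ring zify.

Set Implicit Arguments.
Unset Strict Implicit.
Unset Printing Implicit Defensive.

Import Order.TTheory GRing.Theory Num.Theory.
Local Open Scope ring_scope.

(** * Coefficientwise commuting series *)

(** The coefficients do not commute, so exponentials may be merged and logarithms split only when
    the exponents are known to commute. Hence the commutation of [qdet] with the entries of L
    precedes every computation with the image of [mu]; it also gives that k_1 and k_2 commute, as
    k_2 is read off from [qdet] and k_1. The RTT relation is given by infinite sums in z/w.
    Multiplied by the denominator of the R-matrix, it becomes an identity of series in z^{-1} and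
    w^{-1} whose coefficients are linear forms, which can be cancelled when w^{-1} occurs in them.
    The value w = q^2 z is the zero of the denominator zq - w q^{-1}; there the cleared R-matrix has
    rank one. The second factor of Gamma leads to the same value, since z is proportional to u^2 and
    u becomes uq. The columns (q^{-1}, 1) and (1, C^{-1}(qu^2)^{-1}) have the q-determinant
    q^{-1}(C^{-1}(qu^2)^{-1} - 1). Times (q + q^{-1})^2, this is the rational prefactor. *)

Section Commuting.
Variable A : nzRingType.
Implicit Types (s t r : fps A) (a b : A).

(** Stronger than [s * t = t * s]: commutation of all pairs of coefficients survives dilation,
    [invS], [expS] and [lnS]. *)
Definition ccomm s t := forall i j, s i * t j = t j * s i.

Lemma ccomm_sym s t : ccomm s t -> ccomm t s.
Proof. by move=> H i j; rewrite H. Qed.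

Lemma ccommD s t r : ccomm s t -> ccomm s r -> ccomm s (t + r).
Proof. by move=> H1 H2 i j; rewrite fpsDE mulrDr mulrDl H1 H2. Qed.

Lemma ccommN s t : ccomm s t -> ccomm s (- t).
Proof. by move=> H i j; rewrite fpsNE mulrN mulNr H. Qed.

Lemma ccomm1 s : ccomm s 1.
Proof. by move=> i j; rewrite fps1E; case: eqP => _; rewrite ?mulr1 ?mul1r ?mulr0 ?mul0r. Qed.

Lemma ccommM s t r : ccomm s t -> ccomm s r -> ccomm s (t * r).
Proof.
move=> H1 H2 i j; rewrite fpsME mulr_sumr mulr_suml; apply: eq_bigr => k _.
by rewrite mulrA H1 -mulrA H2 mulrA.
Qed.

Lemma ccommX s t n : ccomm s t -> ccomm s (t ^+ n).
Proof.
move=> H; elim: n => [|n IH]; first by rewrite expr0; exact: ccomm1.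
by rewrite exprS; exact: ccommM.
Qed.

Lemma ccommC s a : (forall i, s i * a = a * s i) -> ccomm s (fpsC a).
Proof. by move=> H i j /=; case: eqP => _; rewrite ?H ?mulr0 ?mul0r. Qed.

Lemma ccomm_mul s t : ccomm s t -> s * t = t * s.
Proof.
move=> H; apply/fpsP => n; rewrite [LHS]fps_mul_rev fpsME.
by apply: eq_bigr => i _; rewrite H.
Qed.

Lemma ccomm_invS s t : ccomm s t -> ccomm s (invS t).
Proof.
move=> H i j /=; rewrite mulr_sumr mulr_suml; apply: eq_bigr => k _.
by apply: ccommX; apply: ccommD; [exact: ccomm1|exact: ccommN].
Qed.
End Commuting.

(** * Power series: constants, the indeterminate, substitutions *)

Section Constants.
Variable A : nzRingType.
Implicit Types (s t : fps A) (a b : A).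

Lemma fpsCM a s n : (fpsC a * s) n = a * s n.
Proof. by rewrite fpsME big_ord_recl /= subn0 big1 ?addr0 // => i _; rewrite mul0r. Qed.

Lemma mulfpsC s a n : (s * fpsC a) n = s n * a.
Proof. by rewrite [LHS]fps_mul_rev big_ord_recl /= subn0 big1 ?addr0 // => i _; rewrite mulr0. Qed.

Fact fpsC_zmod_morphism : zmod_morphism (@fpsC A).
Proof. by move=> a b; apply/fpsP => n; rewrite fpsBE /=; case: eqP; rewrite ?subr0. Qed.
HB.instance Definition _ :=
  GRing.isZmodMorphism.Build A (fps A) (@fpsC A) fpsC_zmod_morphism.

Fact fpsC_monoid_morphism : monoid_morphism (@fpsC A).
Proof.
split=> // a b; apply/fpsP => n; rewrite fpsCM /=.
by case: eqP; rewrite ?mulr0.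
Qed.
HB.instance Definition _ :=
  GRing.isMonoidMorphism.Build A (fps A) (@fpsC A) fpsC_monoid_morphism.

Lemma fpsTM s n : ('T * s) n = if n is n'.+1 then s n' else 0.
Proof.
rewrite fpsME big_ord_recl /= mul0r add0r.
case: n => [|n]; first by rewrite big_ord0.
rewrite big_ord_recl /= mul1r subSS subn0 big1 ?addr0 // => i _.
by rewrite mul0r.
Qed.

Lemma fpsTC s : 'T * s = s * 'T.
Proof. by apply: ccomm_mul => i j /=; case: eqP => _; rewrite ?mul1r ?mulr1 ?mul0r ?mulr0. Qed.

Lemma fpsT_lreg s t : 'T * s = 'T * t -> s = t.
Proof.
move=> H; apply/fpsP => n.
by have := congr1 (fun r : fps A => r n.+1) H; rewrite !fpsTM.
Qed.

Lemma fpsTX_lreg n s t : 'T ^+ n * s = 'T ^+ n * t -> s = t.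
Proof.
elim: n => [|n IH] in s t *; first by rewrite expr0 !mul1r.
by rewrite exprS -!mulrA => /fpsT_lreg; exact: IH.
Qed.

Lemma invS_uniq s t : s 0%N = 1 -> s * t = 1 -> t = invS s.
Proof. by move=> s0 st; rewrite -[t]mul1r -(mul_invS s0) -mulrA st mulr1. Qed.
End Constants.

Section Algebra.
Variables (F : fieldType) (A : algType F).
Implicit Types (s t : fps A) (c : F) (w : A).

Lemma fpsCZ c a : fpsC (c *: a) = c *: fpsC a :> fps A.
Proof. by apply/fpsP => n; rewrite fpsZE /=; case: eqP; rewrite ?scaler0. Qed.

Lemma ccommZ c s t : ccomm s t -> ccomm s (c *: t).
Proof. by move=> H i j; rewrite fpsZE -scalerAr -scalerAl H. Qed.

Fact dilate_zmod_morphism c : zmod_morphism (@dilate F A c).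
Proof. by move=> s t; apply/fpsP => n; rewrite /= scalerBr. Qed.
HB.instance Definition _ c :=
  GRing.isZmodMorphism.Build (fps A) (fps A) (dilate c) (dilate_zmod_morphism c).

Fact dilate_monoid_morphism c : monoid_morphism (@dilate F A c).
Proof.
split.
  apply/fpsP => -[|n]; rewrite -[LHS]/(_ *: (1 : fps A) _) !fps1E.
    by rewrite expr0 invr1 scale1r.
  by rewrite scaler0.
move=> s t; apply/fpsP => n /=; rewrite scaler_sumr; apply: eq_bigr => i _.
have lein : (i <= n)%N by rewrite -ltnS.
by rewrite -scalerAl -scalerAr scalerA -invfM -exprD addnC subnK.
Qed.
HB.instance Definition _ c :=
  GRing.isMonoidMorphism.Build (fps A) (fps A) (dilate c) (dilate_monoid_morphism c).

Fact dilate_scalable c : scalable (@dilate F A c).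
Proof. by move=> d s; apply/fpsP => n /=; rewrite !scalerA mulrC. Qed.
HB.instance Definition _ c :=
  GRing.isScalable.Build F (fps A) (fps A) *:%R (dilate c) (dilate_scalable c).

Lemma dilateC c a : dilate c (fpsC a) = fpsC a :> fps A.
Proof. by apply/fpsP => -[|n] /=; rewrite ?expr0 ?invr1 ?scale1r ?scaler0. Qed.

Lemma dilateT c : dilate c 'T = c^-1 *: 'T :> fps A.
Proof. by apply/fpsP => -[|[|n]] /=; rewrite ?expr1 // !scaler0. Qed.

Lemma dilate_dilate c d s : dilate c (dilate d s) = dilate (c * d) s.
Proof. by apply/fpsP => n /=; rewrite scalerA exprMn invfM. Qed.

Lemma dilate1 s : dilate 1 s = s.
Proof. by apply/fpsP => n /=; rewrite expr1n invr1 scale1r. Qed.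

Lemma ccomm_dilate c s t : ccomm s t -> ccomm s (dilate c t).
Proof. by move=> H i j; rewrite /= -scalerAr -scalerAl H. Qed.

Lemma mulfpsTu s : s 0%N = 0 -> 'T * mulu s = s.
Proof. by move=> s0; apply/fpsP => -[|n]; rewrite fpsTM. Qed.

Section Subst.
Variable w : A.
Hypothesis wC : forall a, w * a = a * w.

Lemma wXC n a : w ^+ n * a = a * w ^+ n.
Proof. by apply/esym/commrX; rewrite /GRing.comm wC. Qed.

Lemma sum0E (a : nat -> A) n :
  sum0 w a n = if odd n then 0 else a n./2 * w ^+ n./2.
Proof. by []. Qed.

(** [sum0 w] substitutes w T^2 for T, which is multiplicative because w is central. In the
    convolution the odd indices contribute nothing, and [h] lists the even ones. *)
Lemma sum0M s t : sum0 w (s * t) = sum0 w s * sum0 w t.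
Proof.
apply/fpsP => n; rewrite fpsME sum0E.
case: ifPn => [odn|evn].
  rewrite big1 // => i _; rewrite !sum0E.
  case: ifPn => [|evi]; first by rewrite mul0r.
  have lein : (i <= n)%N by rewrite -ltnS.
  by rewrite oddB // odn (negPf evi) mulr0.
have nE : n = (n./2).*2 by rewrite -[LHS]odd_double_half (negPf evn).
move: (n./2) nE => m -> {n evn}.
rewrite fpsME mulr_suml.
rewrite [RHS](bigID (fun i : 'I_m.*2.+1 => odd i)) /= [X in _ = X + _]big1 ?add0r; last first.
  by move=> i odi; rewrite odi mul0r.
pose h (i : 'I_m.+1) : 'I_m.*2.+1 := inord i.*2.
have hE i : h i = i.*2 :> nat by rewrite inordK // ltnS leq_double -ltnS.
rewrite (reindex_onto h (fun i => inord i./2)) /=; last first.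
  move=> i evi; apply/val_inj; rewrite /= hE inordK; last first.
    by rewrite ltnS -leq_double -[X in (_ <= X)%N]/(m.*2) (leq_trans _ (leq_ord i)) //
      -[X in (_ <= X)%N]odd_double_half leq_addl.
  by rewrite -[RHS]odd_double_half (negPf evi).
apply: eq_big => [i|i _].
  by rewrite hE odd_double doubleK inord_val eqxx.
rewrite hE odd_double doubleK -doubleB odd_double doubleK.
by rewrite mulrA -[s i * w ^+ i * _]mulrA wXC -!mulrA -exprD subnKC // -ltnS.
Qed.

Lemma sum0C a : sum0 w (fpsC a) = fpsC a.
Proof.
apply/fpsP => -[|[|n]]; rewrite sum0E /= ?expr0 ?mulr1 ?mul0r //.
by case: ifP.
Qed.

Lemma sum0Z c s : sum0 w (c *: s) = c *: sum0 w s.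
Proof. by apply/fpsP => n; rewrite fpsZE !sum0E; case: ifP; rewrite ?scaler0 // scalerAl. Qed.

Lemma sum0D s t : sum0 w (s + t) = sum0 w s + sum0 w t.
Proof. by apply/fpsP => n; rewrite fpsDE !sum0E; case: ifP; rewrite ?addr0 // mulrDl. Qed.

Lemma sum0X s n : sum0 w (s ^+ n) = sum0 w s ^+ n.
Proof.
by elim: n => [|n IH]; rewrite ?expr0 ?exprS ?sum0M ?IH //; exact: sum0C.
Qed.
End Subst.
End Algebra.

(** * Exponential and logarithm *)

Section Exponential.
Variables (F : fieldType) (A : algType F).
Implicit Types (s t : fps A) (c : F) (w : A).

Lemma expS_coef s n N : s 0%N = 0 -> (n <= N)%N ->
  expS s n = (\sum_(j < N.+1) (j`!%:R^-1 : F) *: s ^+ j) n.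
Proof.
move=> s0 lenN; rewrite fps_sumE /=.
rewrite (big_ord_widen N.+1 (fun j => (j`!%:R^-1 : F) *: (s ^+ j) n)) //.
rewrite [RHS](bigID (fun j : 'I_N.+1 => (j < n.+1)%N)) /= [X in _ + X]big1 ?addr0 //.
by move=> j; rewrite -leqNgt => /fpsX_coef_small -> //; rewrite scaler0.
Qed.

Lemma ccomm_expS s t : ccomm s t -> ccomm s (expS t).
Proof.
move=> H i j /=; rewrite mulr_sumr mulr_suml; apply: eq_bigr => k _.
by rewrite -scalerAr -scalerAl (ccommX _ H).
Qed.

Lemma ccomm_lnS s t : t 0%N = 1 -> ccomm s t -> ccomm s (lnS t).
Proof.
move=> t0 H; have [l0 le] := lnSP t0.
suff P j : (forall i, s i * lnS t j = lnS t j * s i) by move=> i j; exact: P.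
elim/ltn_ind: j => j IH i.
(* [r] is the part of the logarithm below j, which commutes with [s] by induction; the j-th
   coefficient of the logarithm is [t j] minus that of [expS r]. *)
pose r : fps A := Fps (fun k => if (k < j)%N then lnS t k else 0).
have r0 : r 0%N = 0 by rewrite /=; case: ifP.
have sr : ccomm s r.
  by move=> i' k /=; case: ifP => [ltkj|_]; rewrite ?IH ?mulr0 ?mul0r.
have E : lnS t j = t j - expS r j.
  rewrite -[in t j]le (expS_coefB l0 r0); last by move=> k ltkj; rewrite /= ltkj.
  by rewrite /= ltnn subr0.
by rewrite E mulrBr mulrBl H (ccomm_expS sr).
Qed.

Lemma expS_dilate c s : expS (dilate c s) = dilate c (expS s).
Proof.
apply/fpsP => n; rewrite /= scaler_sumr; apply: eq_bigr => j _.
by rewrite -rmorphXn /= !scalerA mulrC.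
Qed.

Lemma expS_0 : expS 0 = 1 :> fps A.
Proof.
apply/fpsP => n; rewrite /= big_ord_recl big1 ?addr0 => [|j _].
  by rewrite /= invr1 scale1r.
by rewrite exprS mul0r scaler0.
Qed.

Hypothesis char0 : [pchar F] =i pred0.

(** The binomial formula with both exponentials cut at n. The index square exceeds the triangle j +
    k <= n only by terms without a coefficient at n. *)
Lemma expSD s t : s 0%N = 0 -> t 0%N = 0 -> s * t = t * s ->
  expS (s + t) = expS s * expS t.
Proof.
move=> s0 t0 st; apply/fpsP => n.
pose E r := \sum_(j < n.+1) (j`!%:R^-1 : F) *: (r : fps A) ^+ j.
transitivity ((E s * E t) n); last first.
  rewrite !fpsME; apply: eq_bigr => i _.
  by rewrite -!expS_coef // ?leq_subr // -ltnS.
pose G j k : A := (j`!%:R^-1 * k`!%:R^-1 : F) *: (s ^+ j * t ^+ k) n.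
have Gsmall j k : (n < j + k)%N -> G j k = 0.
  move=> ltn; rewrite /G fpsME big1 ?scaler0 // => i _.
  have [ltij|leji] := ltnP i j; first by rewrite fpsX_coef_small ?mul0r.
  rewrite [X in _ * X]fpsX_coef_small ?mulr0 // ltn_subLR ?(leq_trans ltn) ?leq_add2r //.
  by rewrite -ltnS.
have -> : (E s * E t) n = \sum_(j < n.+1) \sum_(k < n.+1) G j k.
  rewrite /E mulr_suml fps_sumE; apply: eq_bigr => j _.
  rewrite mulr_sumr fps_sumE; apply: eq_bigr => k _.
  by rewrite -scalerAl -scalerAr scalerA.
transitivity (\sum_(N < n.+1) \sum_(k < n.+1 | (k <= N)%N) G (N - k)%N k).
  rewrite /=; apply: eq_bigr => N _.
  rewrite exprDn_comm // fps_sumE scaler_sumr.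
  rewrite (big_ord_widen n.+1 (fun k => (N`!%:R^-1 : F) *:
    ((s ^+ (N - k) * t ^+ k) *+ 'C(N, k)) n)) //.
  apply: eq_big => [k|k]; rewrite ltnS // => lekN.
  rewrite -scaler_nat fpsZE scalerA /G; congr (_ *: _).
  rewrite -(bin_fact lekN) natrM invfM mulrAC mulVf.
    by rewrite mul1r natrM invfM mulrC.
  by rewrite ((pcharf0P F).1 char0) -lt0n bin_gt0.
rewrite [LHS](exchange_big_dep predT) //= [RHS]exchange_big /=.
apply: eq_bigr => k _.
transitivity (\sum_(k <= N < n.+1) G (N - k)%N k); first by rewrite big_geq_mkord.
rewrite -{1}[nat_of_ord k]add0n big_addn.
have lek : (n.+1 - k <= n.+1)%N by exact: leq_subr.
rewrite big_mkord (big_ord_widen n.+1 (fun j => G (j + k - k)%N k) lek).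
rewrite big_mkcond; apply: eq_bigr => j _; rewrite addnK.
case: ifPn => //; rewrite -leqNgt leq_subLR addnC => ltn.
by rewrite Gsmall // addnC.
Qed.

Lemma expSN s : s 0%N = 0 -> expS s * expS (- s) = 1.
Proof.
move=> s0; rewrite -expSD ?subrr ?expS_0 ?fpsNE ?s0 ?oppr0 //.
by rewrite mulrN mulNr.
Qed.

Lemma invS_expS s : s 0%N = 0 -> invS (expS s) = expS (- s).
Proof. by move=> s0; apply/esym/invS_uniq; rewrite ?expS0 ?expSN. Qed.

Lemma expS_sum0 w s : (forall a, w * a = a * w) -> s 0%N = 0 ->
  expS (sum0 w s) = sum0 w (expS s).
Proof.
move=> wC s0; apply/fpsP => n; rewrite [RHS]sum0E.
transitivity (\sum_(j < n.+1) (j`!%:R^-1 : F) *: sum0 w (s ^+ j) n).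
  by apply: eq_bigr => j _; rewrite sum0X.
case: ifPn => odn.
  by rewrite big1 // => j _; rewrite sum0E odn scaler0.
rewrite (expS_coef s0 (_ : _ <= n)%N); last first.
  by rewrite -{2}[n]odd_double_half -addnn addnA leq_addl.
rewrite fps_sumE mulr_suml; apply: eq_bigr => j _.
by rewrite sum0E (negPf odn) fpsZE scalerAl.
Qed.
End Exponential.

(** * Series in two spectral parameters *)

(* A series in [fps (fps A)] is a series in y = w^{-1}, the outer
   indeterminate, and x = z^{-1}, the inner one. *)
Section TwoParameters.
Variables (F : fieldType) (A : algType F).
Implicit Types (s t : fps A) (S : fps (fps A)) (c d : F).

(** The shape c w^{-1} + d z^{-1} of an entry of the R-matrix once the denominator is cleared. *)
Definition xy_lin (c d : F) : fps (fps A) := c *: 'T + d *: fpsC 'T.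
Definition in_z s : fps (fps A) := fpsC s.
Definition in_w s : fps (fps A) := map_fps (@fpsC A) s.

Lemma xy_linC c d S : xy_lin c d * S = S * xy_lin c d.
Proof.
have xC : fpsC 'T * S = S * fpsC 'T.
  apply: ccomm_mul => i j /=; case: eqP => _; first exact: fpsTC.
  by rewrite mul0r mulr0.
by rewrite /xy_lin mulrDl mulrDr -!scalerAl -!scalerAr xC fpsTC.
Qed.

Lemma in_zw_coef s t m n : (in_z s * in_w t) m n = s n * t m.
Proof. by rewrite fpsCM mulfpsC. Qed.

Lemma in_wz_coef s t m n : (in_w t * in_z s) m n = t m * s n.
Proof. by rewrite mulfpsC fpsCM. Qed.

Lemma xy_lin_coef c d S m n : (xy_lin c d * S) m n =
  c *: (if m is m'.+1 then S m' n else 0) + d *: ('T * S m) n.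
Proof.
rewrite /xy_lin mulrDl -!scalerAl.
rewrite -[LHS]/(c *: ('T * S) m n + d *: (fpsC 'T * S) m n) (fpsTM S) fpsCM.
by case: m.
Qed.

Lemma xy_lin_zw_coef c d s t m n : (xy_lin c d * (in_z s * in_w t)) m n =
  c *: (s n * (if m is m'.+1 then t m' else 0))
  + d *: ((if n is n'.+1 then s n' else 0) * t m).
Proof.
rewrite xy_lin_coef fpsTM; case: m => [|m]; case: n => [|n];
  by rewrite ?in_zw_coef ?mulr0 ?mul0r.
Qed.

Lemma xy_lin_wz_coef c d s t m n : (xy_lin c d * (in_w t * in_z s)) m n =
  c *: ((if m is m'.+1 then t m' else 0) * s n)
  + d *: (t m * (if n is n'.+1 then s n' else 0)).
Proof.
rewrite xy_lin_coef fpsTM; case: m => [|m]; case: n => [|n];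
  by rewrite ?in_wz_coef ?mulr0 ?mul0r.
Qed.

Lemma fps2DE S S' m n : (S + S') m n = S m n + S' m n.
Proof. by []. Qed.

(** Induction on the degree n in x, for all m at once: the coefficient of y^{m+1} x^n in the product
    expresses c S_{m,n} through S_{m+1,n-1}. *)
Lemma xy_lin_eq0 c d S : c != 0 -> xy_lin c d * S = 0 -> S = 0.
Proof.
move=> c0 S0.
have E m n : c *: S m n = - (d *: ('T * S m.+1) n).
  by apply/eqP; rewrite -addr_eq0 -(xy_lin_coef _ _ _ m.+1) S0.
apply/fpsP => m; apply/fpsP => n; elim: n m => [|n IH] m;
  apply: (scalerI c0); rewrite E fpsTM ?IH ?scaler0 ?oppr0 //.
Qed.

Lemma xy_lin_lreg c d S S' : c != 0 ->
  xy_lin c d * S = xy_lin c d * S' -> S = S'.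
Proof.
move=> c0 SS'; apply/eqP; rewrite -subr_eq0; apply/eqP/(xy_lin_eq0 (d := d) c0).
by rewrite mulrBr SS' subrr.
Qed.

Definition xy_quad (a b c : F) : fps (fps A) :=
  a *: ('T * 'T) + b *: ('T * fpsC 'T) + c *: (fpsC 'T * fpsC 'T).

Lemma xy_quadD a b c a' b' c' :
  xy_quad a b c + xy_quad a' b' c' = xy_quad (a + a') (b + b') (c + c').
Proof.
rewrite /xy_quad !scalerDl [LHS]addrACA; congr (_ + _).
by rewrite addrACA.
Qed.

Lemma xy_quadZ e a b c : e *: xy_quad a b c = xy_quad (e * a) (e * b) (e * c).
Proof. by rewrite /xy_quad 2!scalerDr 3!scalerA. Qed.

Lemma xy_linM c d c' d' :
  xy_lin c d * xy_lin c' d' = xy_quad (c * c') (c * d' + d * c') (d * d').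
Proof.
rewrite /xy_lin /xy_quad mulrDl !mulrDr -!scalerAl -!scalerAr !scalerA.
by rewrite -(fpsTC (fpsC 'T)) scalerDl !addrA.
Qed.

Section Specialization.
Variable d : F.

(* The restriction to w = d z, i.e. to y = d^{-1} x. *)
Definition diag_spec S : fps A := Fps (fun n => \sum_(j < n.+1) d ^- j *: S j (n - j)%N).

Lemma diag_specD S S' : diag_spec (S + S') = diag_spec S + diag_spec S'.
Proof.
apply/fpsP => n; rewrite fpsDE /= -big_split; apply: eq_bigr => j _ /=.
by rewrite scalerDr.
Qed.

Lemma diag_spec_zw s t : diag_spec (in_z s * in_w t) = s * dilate d t.
Proof.
apply/fpsP => n; rewrite [RHS]fps_mul_rev /=; apply: eq_bigr => j _.
by rewrite in_zw_coef scalerAr.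
Qed.

Lemma diag_spec_wz s t : diag_spec (in_w t * in_z s) = dilate d t * s.
Proof.
apply/fpsP => n; apply: eq_bigr => j _.
by rewrite in_wz_coef scalerAl.
Qed.

Lemma diag_specZ c S : diag_spec (c *: S) = c *: diag_spec S.
Proof.
apply/fpsP => n; rewrite fpsZE /= scaler_sumr; apply: eq_bigr => j _.
by rewrite !scalerA mulrC.
Qed.

Lemma diag_spec_y S : diag_spec ('T * S) = d^-1 *: ('T * diag_spec S).
Proof.
apply/fpsP => -[|n]; rewrite fpsZE fpsTM.
  by rewrite [LHS]big_ord_recl big_ord0 fpsTM !scaler0 addr0.
rewrite [LHS]big_ord_recl fpsTM scaler0 add0r scaler_sumr.
apply: eq_bigr => j _; rewrite (fpsTM S) scalerA -invfM lift0 exprS.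
by rewrite subSS.
Qed.

Lemma diag_spec_x S : diag_spec (fpsC 'T * S) = 'T * diag_spec S.
Proof.
apply/fpsP => -[|n]; rewrite fpsTM.
  by rewrite [LHS]big_ord_recl big_ord0 fpsCM fpsTM scaler0 addr0.
rewrite [LHS]big_ord_recr fpsCM fpsTM [X in _ + X = _](_ : _ = 0) ?addr0; last first.
  by rewrite /= subnn scaler0.
apply: eq_bigr => j _; have lejn : (j <= n)%N by rewrite -ltnS.
by rewrite fpsCM fpsTM [nat_of_ord (widen_ord _ _)]/(nat_of_ord j) subSn.
Qed.

(** On w = d z every linear form is a multiple of x; [RTT_spec] cancels this common factor. *)
Lemma diag_spec_lin c c' S :
  diag_spec (xy_lin c c' * S) = (c / d + c') *: ('T * diag_spec S).
Proof.
rewrite /xy_lin mulrDl -!scalerAl diag_specD (diag_specZ c) (diag_specZ c') diag_spec_y diag_spec_x.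
by rewrite scalerA scalerDl.
Qed.
End Specialization.
End TwoParameters.

(** * Fusion of the RTT relation *)

Section Fusion.
Variables (S : nzRingType) (n : nat).
Variables (R R' L L' : 'I_n -> 'I_n -> S) (M : S).
Hypothesis RL' : forall i j k l, R i j * L' k l = L' k l * R i j.
Hypothesis R'L : forall i j k l, R' i j * L k l = L k l * R' i j.
Hypothesis RLM : forall i k,
  \sum_j R i j * L j k * M = \sum_j M * L i j * R j k.
Hypothesis RLM' : forall i k,
  \sum_j R' i j * L' j k * M = \sum_j M * L' i j * R' j k.

(** M passes L' first and then L. [R] concerns the spaces of L and M, and [R'] those of L' and M;
    the rearrangements use that [R] commutes with L' and [R'] with L. *)
Lemma fusion i j k l :
  \sum_i' \sum_j' R i i' * R' j j' * (L i' k * L' j' l) * M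
  = \sum_k' \sum_l' M * (L i k' * L' j l') * (R k' k * R' l' l).
Proof.
transitivity (\sum_i' \sum_l' R i i' * L i' k * M * L' j l' * R' l' l).
  apply: eq_bigr => i' _.
  transitivity (R i i' * L i' k * \sum_j' R' j j' * L' j' l * M).
    rewrite mulr_sumr; apply: eq_bigr => j' _.
    by rewrite !mulrA -(mulrA (R i i')) R'L !mulrA.
  rewrite RLM' mulr_sumr; apply: eq_bigr => l' _.
  by rewrite !mulrA.
rewrite exchange_big [RHS]exchange_big; apply: eq_bigr => l' _ /=.
transitivity ((\sum_i' R i i' * L i' k * M) * L' j l' * R' l' l).
  by rewrite !mulr_suml.
rewrite RLM !mulr_suml; apply: eq_bigr => k' _.
by rewrite !mulrA -[in LHS](mulrA (M * L i k')) RL' !mulrA.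
Qed.
End Fusion.

Lemma sum_ord2 (V : nmodType) (f : 'I_2 -> V) : \sum_i f i = f 0 + f 1.
Proof. by rewrite !big_ord_recl big_ord0 addr0; congr (_ + f _); apply/val_inj. Qed.

Lemma ord2P (i : 'I_2) : i = 0 \/ i = 1.
Proof. by case: i => -[|[|//]] lti; [left|right]; apply/val_inj. Qed.

Section ScalarMatrix.
Variables (B : nzRingType) (n : nat).
Implicit Types (X : 'M[B]_n.+1) (a : B).

Lemma mul_mx_scalarE X a i j : (X * a%:M) i j = X i j * a.
Proof.
rewrite mxE (bigD1 j) //= mxE eqxx mulr1n big1 ?addr0 // => k kj.
by rewrite mxE (negPf kj) mulr0n mulr0.
Qed.

Lemma mul_scalar_mxE X a i j : (a%:M * X) i j = a * X i j.
Proof. by rewrite -[a%:M * X]/(a%:M *m X) mul_scalar_mx mxE. Qed.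

Lemma scalar_mxME a b : (a * b)%:M = a%:M * b%:M :> 'M[B]_n.+1.
Proof. exact: scalar_mxM. Qed.
End ScalarMatrix.

(** * The quantum determinant and its commutation with L *)

Section RMatrix.
Variables (B : nzRingType) (D E : 'I_2 -> 'I_2 -> B).
Hypothesis DC : forall i j a, D i j * a = a * D i j.
Hypothesis EC : forall i j a, E i j * a = a * E i j.
Hypothesis E_id : forall i, E i i = 0.

(* The block (i, i') of the R-matrix with entries r_{ij,ij} = D i j and
   r_{ij,ji} = E i j. *)
Definition Rmat (i i' : 'I_2) : 'M[B]_2 :=
  \matrix_(p, p') if i == i' then (if p == p' then D i p else 0)
                  else if (p == i') && (p' == i) then E i p else 0.

Lemma RmatE i i' p p' : Rmat i i' p p' =
  if i == i' then (if p == p' then D i p else 0)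
  else if (p == i') && (p' == i) then E i p else 0.
Proof. by rewrite mxE. Qed.

Lemma RmatE_central i i' p p' a : Rmat i i' p p' * a = a * Rmat i i' p p'.
Proof.
by rewrite RmatE; case: ifP => _; case: ifP => _;
  rewrite ?mulr0 ?mul0r // ?DC ?EC.
Qed.

Lemma Rmat_central i i' a : Rmat i i' * a%:M = a%:M * Rmat i i'.
Proof.
by apply/matrixP => p s; rewrite mul_mx_scalarE mul_scalar_mxE RmatE_central.
Qed.

(** Row (i, j), column (k, l) of R (L x 1)(1 x M) = (1 x M)(L x 1) R, where R has at most two
    nonzero entries in each row and column. *)
Definition RTT_rel (L M : 'I_2 -> 'I_2 -> B) := forall i j k l,
  D i j * (L i k * M j l) + E i j * (L j k * M i l)
  = D k l * (M j l * L i k) + E l k * (M j k * L i l).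

Lemma RTT_mx L M : RTT_rel L M -> forall i k,
  \sum_j Rmat i j * (L j k)%:M * (\matrix_(p, s) M p s)
  = \sum_j (\matrix_(p, s) M p s) * (L i j)%:M * Rmat j k.
Proof.
move=> H i k; apply/matrixP => p s; rewrite !summxE.
have -> : \sum_j (Rmat i j * (L j k)%:M * (\matrix_(p, s) M p s)) p s
  = \sum_j \sum_p' Rmat i j p p' * (L j k * M p' s).
  apply: eq_bigr => j _; rewrite mxE; apply: eq_bigr => p' _.
  by rewrite mul_mx_scalarE [X in _ * _ * X]mxE mulrA.
have -> : \sum_j ((\matrix_(p, s) M p s) * (L i j)%:M * Rmat j k) p s
  = \sum_j \sum_p' Rmat j k p' s * (M p p' * L i j).
  apply: eq_bigr => j _; rewrite mxE; apply: eq_bigr => p' _.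
  by rewrite mul_mx_scalarE RmatE_central mxE.
rewrite !sum_ord2 !RmatE; move: (H i p k s).
case: (ord2P i) => ->; case: (ord2P p) => ->; case: (ord2P k) => ->;
  case: (ord2P s) => ->; rewrite ?E_id /= ?mul0r ?addr0 ?add0r // => e;
  by [rewrite e addrC | rewrite [LHS]addrC e | rewrite [LHS]addrC e addrC].
Qed.
End RMatrix.

Section QuantumDeterminantCentral.
Variables (B : nzRingType) (D E D' E' : 'I_2 -> 'I_2 -> B) (th tau : B).
Hypothesis DC : forall i j a, D i j * a = a * D i j.
Hypothesis EC : forall i j a, E i j * a = a * E i j.
Hypothesis E_id : forall i, E i i = 0.
Hypothesis DC' : forall i j a, D' i j * a = a * D' i j.
Hypothesis EC' : forall i j a, E' i j * a = a * E' i j.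
Hypothesis E_id' : forall i, E' i i = 0.
Hypothesis thC : forall a, th * a = a * th.
Variables (L L' M : 'I_2 -> 'I_2 -> B) (Q : B).
Hypothesis rel : RTT_rel D E L M.
Hypothesis rel' : RTT_rel D' E' L' M.
Hypothesis LL' : forall k l,
  L 0 k * L' 1 l - th * (L 1 k * L' 0 l)
  = if k == l then 0 else if k == 0 then Q else - th * Q.
(* With r the R-matrix, [r_{1i} r'_{2j} - th r_{2i} r'_{1j}] is tau times the
   antisymmetric tensor (1, - th) at (12, 21). *)
Hypothesis c12a : D 0 0 * D' 1 0 - th * (E 1 0 * E' 0 1) = tau.
Hypothesis c12b : D 0 1 * D' 1 1 = tau.
Hypothesis c21a : D 1 0 * D' 0 0 = tau.
Hypothesis c21b : E 0 1 * E' 1 0 - th * (D 1 1 * D' 0 1) = - th * tau.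
Hypothesis c11 : D 0 0 * E' 1 0 = th * (E 1 0 * D' 0 1).
Hypothesis c22 : E 0 1 * D' 1 0 = th * (D 1 1 * E' 0 1).

Local Notation R := (Rmat D E).
Local Notation R' := (Rmat D' E').

(** Contracted with the q-antisymmetric tensor of the first two spaces, R R' is the scalar tau times
    that tensor, and the identity on the third space. *)
Lemma Rmat_antisym i j : R 0 i * R' 1 j - th%:M * (R 1 i * R' 0 j)
  = (if i == j then 0 else if i == 0 then tau else - th * tau)%:M.
Proof.
have mxB (X Y : 'M[B]_2) p s : (X - Y) p s = X p s - Y p s by rewrite !mxE.
have mxM (X Y : 'M[B]_2) p s : (X * Y) p s = X p 0 * Y 0 s + X p 1 * Y 1 s.
  by rewrite mxE sum_ord2.
apply/matrixP => p s; rewrite mxB mul_scalar_mxE !mxM !RmatE mxE.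
case: (ord2P i) => ->; case: (ord2P j) => ->; case: (ord2P p) => ->;
  case: (ord2P s) => ->; rewrite /= ?mulr0 ?mul0r ?add0r ?addr0 ?mulr0 ?subr0 ?sub0r
    ?mulr1n ?mulr0n ?oppr0 //.
- by rewrite c11 subrr.
- by rewrite c21a mulNr.
- by rewrite c22 subrr.
Qed.

(** The fused relation is contracted with the q-antisymmetric tensor. On the left R R' yields tau
    and then L L' yields Q; on the right L L' yields Q and then R R' yields tau. Cancelling tau is
    left to the caller. *)
Lemma qdet_central p s : tau * (Q * M p s) = tau * (M p s * Q).
Proof.
pose MM : 'M[B]_2 := \matrix_(p, s) M p s.
have tauC a : tau * a = a * tau.
  by rewrite -c12b -mulrA DC' mulrA DC -mulrA.
have thM (X : 'M[B]_2) : th%:M * X = X * th%:M.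
  by apply/matrixP => i j; rewrite mul_scalar_mxE mul_mx_scalarE thC.
have tauM (X : 'M[B]_2) : tau%:M * X = X * tau%:M.
  by apply/matrixP => i j; rewrite mul_scalar_mxE mul_mx_scalarE tauC.
have F i j := fusion (fun a b c d => Rmat_central DC EC a b (L' c d))
  (fun a b c d => Rmat_central DC' EC' a b (L c d))
  (RTT_mx DC EC E_id rel) (RTT_mx DC' EC' E_id' rel') i j 0 1.
have : \sum_i \sum_j (R 0 i * R' 1 j - th%:M * (R 1 i * R' 0 j))
         * ((L i 0)%:M * (L' j 1)%:M) * MM
  = \sum_i \sum_j MM * ((L 0 i)%:M * (L' 1 j)%:M
         - th%:M * ((L 1 i)%:M * (L' 0 j)%:M)) * (R i 0 * R' j 1).
  transitivity (\sum_i \sum_j R 0 i * R' 1 j * ((L i 0)%:M * (L' j 1)%:M) * MM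
    - th%:M * \sum_i \sum_j R 1 i * R' 0 j * ((L i 0)%:M * (L' j 1)%:M) * MM).
    rewrite mulr_sumr -sumrB; apply: eq_bigr => i _.
    rewrite mulr_sumr -sumrB; apply: eq_bigr => j _.
    by rewrite !mulrBl !mulrA.
  rewrite !F mulr_sumr -sumrB; apply: eq_bigr => i _.
  rewrite mulr_sumr -sumrB; apply: eq_bigr => j _.
  by rewrite mulrBr mulrBl !mulrA thM.
under eq_bigr => i _ do under eq_bigr => j _ do rewrite Rmat_antisym.
under [in RHS]eq_bigr => i _ do under eq_bigr => j _ do
  rewrite -!scalar_mxME -raddfB /= LL'.
have E01 : L 0 0 * L' 1 1 - th * (L 1 0 * L' 0 1) = Q := LL' 0 1.
rewrite !sum_ord2 /= !raddf0 !mul0r !mulr0 !mul0r !add0r !addr0.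
have -> : tau%:M * ((L 0 0)%:M * (L' 1 1)%:M) * MM
    + (- th * tau)%:M * ((L 1 0)%:M * (L' 0 1)%:M) * MM = (tau * Q)%:M * MM.
  rewrite -!scalar_mxME -mulrDl -raddfD; congr (_%:M * _).
  by rewrite -[in RHS]E01 mulrBr !mulNr -(tauC th) -(mulrA tau).
have -> : MM * Q%:M * (R 0 0 * R' 1 1) + MM * (- th * Q)%:M * (R 1 0 * R' 0 1)
    = tau%:M * MM * Q%:M.
  rewrite mulNr raddfN /= mulrN mulNr thC scalar_mxME.
  rewrite (_ : MM * (Q%:M * th%:M) * (R 1 0 * R' 0 1)
               = MM * Q%:M * (th%:M * (R 1 0 * R' 0 1))); last by rewrite !mulrA.
  rewrite -mulrBr (Rmat_antisym 0 1) /=.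
  by rewrite -(mulrA MM) -tauM mulrA -tauM.
move/matrixP/(_ p s); rewrite mul_scalar_mxE mul_mx_scalarE mul_scalar_mxE.
by rewrite !mxE !mulrA.
Qed.
End QuantumDeterminantCentral.

(** The antisymmetry relation is contracted with the columns v and w, so only the components (0, 1)
    and (1, 0) survive. Centrality of v moves it past the entries of L'. *)
Lemma qdet_pairing (B : nzRingType) (th Q : B) (L L' : 'I_2 -> 'I_2 -> B) v0 v1 w0 w1 :
  (forall a, th * a = a * th) ->
  (forall a, v0 * a = a * v0) -> (forall a, v1 * a = a * v1) ->
  (forall k l, L 0 k * L' 1 l - th * (L 1 k * L' 0 l)
    = if k == l then 0 else if k == 0 then Q else - th * Q) ->
  (L 0 0 * v0 + L 0 1 * v1) * (L' 1 0 * w0 + L' 1 1 * w1)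
    - th * ((L 1 0 * v0 + L 1 1 * v1) * (L' 0 0 * w0 + L' 0 1 * w1))
  = Q * (v0 * w1 - th * (v1 * w0)).
Proof.
move=> thC v0C v1C LL.
have E (i k j l : 'I_2) v w : (forall a, v * a = a * v) ->
    (L i k * v) * (L' j l * w) = L i k * L' j l * (v * w).
  by move=> vC; rewrite -!mulrA (mulrA v) vC -!mulrA.
have cancel (a b c d x y : B) :
    a + (x + b) + (y + c + d) - (a + b + (c + d)) = x + y.
  by rewrite (addrCA a) -(addrA y) (addrACA x) addrK.
have eL k l : L 0 k * L' 1 l =
    (if k == l then 0 else if k == 0 then Q else - th * Q) + th * (L 1 k * L' 0 l).
  by rewrite -LL subrK.
rewrite !mulrDl !mulrDr !E // !eL /= !add0r !(mulrDl _ (th * _)) !(mulrA th) cancel.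
by rewrite mulrN !mulNr (thC Q) !mulrA.
Qed.

(** * The RTT relation restricted to w = q^2 z *)

Section SpectralRMatrix.
Variables (F : fieldType) (A : algType F) (q : F).
Hypothesis q0 : q != 0.
Local Notation B := (fps (fps A)).
Local Notation m := (q - q^-1).

(* The entries of x y (z q - w q^{-1}) \tilde R(z/w), where z^{-1} = c x and
   w^{-1} = y. *)
Definition Rdiag (c : F) (i j : 'I_2) : B :=
  if i == j then xy_lin A q (- (q^-1 * c)) else xy_lin A 1 (- c).
Definition Rexch (c : F) (i j : 'I_2) : B :=
  if i == j then 0 else if i == 0 then xy_lin A m 0 else xy_lin A 0 (m * c).

Lemma Rdiag_central c i j S : Rdiag c i j * S = S * Rdiag c i j.
Proof. by rewrite /Rdiag; case: ifP => _; exact: xy_linC. Qed.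

Lemma Rexch_central c i j S : Rexch c i j * S = S * Rexch c i j.
Proof.
rewrite /Rexch; case: ifP => _; first by rewrite mul0r mulr0.
by case: ifP => _; exact: xy_linC.
Qed.

Lemma Rexch_id c i : Rexch c i i = 0.
Proof. by rewrite /Rexch eqxx. Qed.

Lemma map_xy_lin d a b : map_fps (dilate d) (xy_lin A a b) = xy_lin A a (b / d).
Proof.
rewrite /xy_lin raddfD /= !linearZ /=; congr (_ *: _ + _).
  apply/fpsP => n /=; case: eqP => _; first exact: rmorph1.
  exact: raddf0.
apply/fpsP => n /=; case: eqP => _; last by rewrite raddf0 !scaler0.
by rewrite dilateT scalerA.
Qed.

Variable L : 'I_2 -> 'I_2 -> fps A.
Hypothesis rtt : RTT_rel (Rdiag 1) (Rexch 1)
  (fun i k => in_z (L i k)) (fun i k => in_w (L i k)).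

(** Dilating the inner series changes z to d z in L(z) and in R, but leaves L(w) alone. With d = q^2
    this is the second relation needed for the fusion. *)
Lemma RTT_dilate d : RTT_rel (Rdiag d^-1) (Rexch d^-1)
  (fun i k => in_z (dilate d (L i k))) (fun i k => in_w (L i k)).
Proof.
have zE s : map_fps (dilate d) (in_z s) = in_z (dilate d s).
  by apply/fpsP => n /=; case: eqP => _ //; exact: raddf0.
have wE s : map_fps (dilate d) (in_w s) = in_w s.
  by apply/fpsP => n; exact: dilateC.
have DE i j : map_fps (dilate d) (Rdiag 1 i j) = Rdiag d^-1 i j.
  by rewrite /Rdiag; case: ifP => _; rewrite map_xy_lin ?mulr1 mulNr ?mul1r.
have EE i j : map_fps (dilate d) (Rexch 1 i j) = Rexch d^-1 i j.
  rewrite /Rexch; case: ifP => _; first exact: raddf0.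
  by case: ifP => _; rewrite map_xy_lin ?mul0r ?mulr1.
move=> i j k l; have := congr1 (map_fps (dilate d)) (rtt i j k l).
by rewrite !rmorphD !rmorphM /= !zE !wE !DE !EE.
Qed.

Definition rdiag d (i j : 'I_2) : F := if i == j then q / d - q^-1 else d^-1 - 1.
Definition rexch d (i j : 'I_2) : F := if i == j then 0 else if i == 0 then m / d else m.

Lemma RTT_spec d i j k l :
  rdiag d i j *: (L i k * dilate d (L j l)) + rexch d i j *: (L j k * dilate d (L i l))
  = rdiag d k l *: (dilate d (L j l) * L i k) + rexch d l k *: (dilate d (L j k) * L i l).
Proof.
have DE i' j' S : diag_spec d (Rdiag 1 i' j' * S) = rdiag d i' j' *: ('T * diag_spec d S).
  by rewrite /Rdiag /rdiag; case: ifP => _; rewrite diag_spec_lin ?mulr1 ?div1r.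
have EE i' j' S : diag_spec d (Rexch 1 i' j' * S) = rexch d i' j' *: ('T * diag_spec d S).
  rewrite /Rexch /rexch; case: ifP => _.
    rewrite mul0r scale0r; apply/fpsP => n /=.
    by rewrite big1 // => p _; exact: scaler0.
  by case: ifP => _; rewrite diag_spec_lin ?mulr1 ?mul0r ?addr0 ?add0r.
have := congr1 (diag_spec d) (rtt i j k l).
rewrite !diag_specD !DE !EE !diag_spec_zw !diag_spec_wz.
rewrite !scalerAr -!mulrDr => /fpsT_lreg.
by rewrite -!scalerAr.
Qed.

Hypothesis m0 : m != 0.
Local Notation L' i j := (dilate (q ^+ 2) (L i j)).

Definition qdet : fps A := L 0 0 * L' 1 1 - q^-1 *: (L 1 0 * L' 0 1).

(** At d = q^2 the denominator zq - w q^{-1} vanishes and the R-matrix drops to rank one; its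
    entries are listed here. *)
Let rdiag0 i : rdiag (q ^+ 2) i i = 0.
Proof. by rewrite /rdiag eqxx; field. Qed.
Let rdiag1 i j : i != j -> rdiag (q ^+ 2) i j = - (q^-1 * m).
Proof. by rewrite /rdiag => /negPf ->; field. Qed.
Let rexch01 : rexch (q ^+ 2) 0 1 = q^-1 * m * q^-1.
Proof. by rewrite /rexch /=; field. Qed.
Let rexch10 : rexch (q ^+ 2) 1 0 = m.
Proof. by []. Qed.
Let rexch0 i : rexch (q ^+ 2) i i = 0.
Proof. by rewrite /rexch eqxx. Qed.

Lemma dilate_L01_L00 : L' 0 1 * L 0 0 = q *: (L' 0 0 * L 0 1).
Proof.
have := RTT_spec (q ^+ 2) 0 0 0 1.
rewrite rdiag0 rexch0 (rdiag1 (isT : (0 : 'I_2) != 1)) rexch10 !scale0r addr0.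
move/esym/eqP; rewrite scaleNr addrC subr_eq0 => /eqP.
rewrite mulrC -scalerA => /(scalerI m0) ->.
by rewrite scalerA mulfV // scale1r.
Qed.

Lemma RTT_antisym k l : (q^-1 * m) *: (L 0 k * L' 1 l - q^-1 *: (L 1 k * L' 0 l))
  = - (rdiag (q ^+ 2) k l *: (L' 1 l * L 0 k) + rexch (q ^+ 2) l k *: (L' 1 k * L 0 l)).
Proof.
rewrite -RTT_spec (rdiag1 (isT : (0 : 'I_2) != 1)) rexch01.
by rewrite scalerBr scalerA scaleNr opprD opprK.
Qed.

(** In the degenerate R-matrix the columns (k, k) vanish and column (1, 0) is - q^{-1} times column
    (0, 1). *)
Lemma qdet_antisym k l : L 0 k * L' 1 l - q^-1 *: (L 1 k * L' 0 l)
  = if k == l then 0 else if k == 0 then qdet else - q^-1 *: qdet.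
Proof.
have c0 : q^-1 * m != 0 by rewrite mulf_neq0 ?invr_eq0.
case: eqP => [->|]; last first.
  case: (ord2P k) => ->; case: (ord2P l) => -> //= _.
  have H01 := RTT_antisym 0 1; have H10 := RTT_antisym 1 0.
  rewrite (rdiag1 (isT : (0 : 'I_2) != 1)) rexch10 -/qdet in H01.
  rewrite (rdiag1 (isT : (1 : 'I_2) != 0)) rexch01 in H10.
  apply: (scalerI c0); rewrite H10.
  have -> : (q^-1 * m) *: (- q^-1 *: qdet) = - q^-1 *: ((q^-1 * m) *: qdet).
    by rewrite !scalerA mulrC.
  rewrite H01 scalerN scalerDr !scalerA !opprD -!scaleNr addrC.
  by congr (_ *: _ + _ *: _); field.
apply: (scalerI c0); rewrite scaler0 RTT_antisym rdiag0 rexch0 !scale0r addr0 oppr0.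
by [].
Qed.

Lemma ccomm_qdet p s : ccomm qdet (L p s).
Proof.
have r : RTT_rel (Rdiag (q ^+ 2)^-1) (Rexch (q ^+ 2)^-1)
  (fun i k => in_z (L' i k)) (fun i k => in_w (L i k)) := RTT_dilate (q ^+ 2).
pose th : B := (q^-1)%:A.
have thE S : th * S = q^-1 *: S by rewrite /th mulr_algl.
have thC S : th * S = S * th by rewrite thE /th mulr_algr.
have zM a b : in_z a * in_z b = in_z (a * b) by rewrite /in_z -rmorphM.
(* The product of [Rdiag 1 0 1] and [Rdiag (q ^+ 2)^-1 1 1], as [c12b] prescribes: two linear forms
   with a nonzero coefficient at w^{-1}, hence cancellable. *)
pose tau : B := xy_lin A 1 (- 1) * xy_lin A q (- (q^-1 * (q ^+ 2)^-1)).
suff : tau * (in_z qdet * in_w (L p s)) = tau * (in_w (L p s) * in_z qdet).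
  rewrite /tau -2!(mulrA (xy_lin A 1 _)).
  move/(xy_lin_lreg (oner_neq0 F))/(xy_lin_lreg q0) => e i j.
  by have := congr1 (fun S : B => S j i) e; rewrite in_zw_coef in_wz_coef.
apply: (@qdet_central B (Rdiag 1) (Rexch 1) (Rdiag (q ^+ 2)^-1) (Rexch (q ^+ 2)^-1)
  th tau (Rdiag_central 1) (Rexch_central 1) (Rexch_id 1)
  (Rdiag_central _) (Rexch_central _) (Rexch_id _) thC
  (fun i k => in_z (L i k)) (fun i k => in_z (L' i k)) (fun i k => in_w (L i k))
  (in_z qdet) rtt r).
- move=> k l; rewrite 2!zM thE -[q^-1 *: in_z _]fpsCZ -[LHS]raddfB /= qdet_antisym.
  case: ifP => _; first exact: raddf0.
  case: ifP => _ //.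
  by rewrite mulNr thE -fpsCZ -raddfN -scaleNr.
all: rewrite /tau /Rdiag /Rexch /= ?mulNr ?thE !xy_linM
  -?scaleNr ?xy_quadZ ?xy_quadD; congr (xy_quad _ _ _); by field.
Qed.
End SpectralRMatrix.

(** * Consequences for the Gauss decomposition *)

Section Gauss.
Variables (F : fieldType) (A : algType F) (q : F).
Hypotheses (q0 : q != 0) (m0 : q - q^-1 != 0).
Variables (k1 k2 e f : fps A) (kp1 kp2 : A).
Local Notation L := (fun i j : 'I_2 => Lmx k1 k2 e f i j).
Hypothesis rtt : RTT_rel (Rdiag A q 1) (Rexch A q 1)
  (fun i j => in_z (L i j)) (fun i j => in_w (L i j)).
Hypotheses (kp1k1 : kp1 * k1 0%N = 1) (k1kp1 : k1 0%N * kp1 = 1).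
Hypotheses (kp2k2 : kp2 * k2 0%N = 1) (k2kp2 : k2 0%N * kp2 = 1).
Hypothesis e0 : e 0%N = 0.
Local Notation dil := (dilate (q ^+ 2)).
Local Notation qd := (qdet q L).

Lemma Lmx00 : Lmx k1 k2 e f 0 0 = k1. Proof. by rewrite mxE. Qed.
Lemma Lmx01 : Lmx k1 k2 e f 0 1 = k1 * f. Proof. by rewrite mxE. Qed.
Lemma Lmx10 : Lmx k1 k2 e f 1 0 = e * k1. Proof. by rewrite mxE. Qed.
Lemma Lmx11 : Lmx k1 k2 e f 1 1 = k2 + e * k1 * f. Proof. by rewrite mxE. Qed.

(** [invS] inverts series with constant term 1, while that of k_1 is only invertible. Normalising by
    [kp1] on the left or on the right gives a left and a right inverse. *)
Definition k1_linv : fps A := invS (fpsC kp1 * k1) * fpsC kp1.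
Definition k1_rinv : fps A := fpsC kp1 * invS (k1 * fpsC kp1).

Lemma k1_linvK s : k1_linv * (k1 * s) = s.
Proof.
rewrite /k1_linv -mulrA (mulrA _ k1) mulrA mul_invS ?mul1r //.
by rewrite fpsCM kp1k1.
Qed.

Lemma k1_rinvK s : s * k1 * k1_rinv = s.
Proof.
rewrite /k1_rinv -mulrA (mulrA k1) mulS_invS ?mulr1 //.
by rewrite mulfpsC k1kp1.
Qed.

Lemma dilate_k1_lreg s t : dil k1 * s = dil k1 * t -> s = t.
Proof.
move=> H; have : dil k1_linv * (dil k1 * s) = dil k1_linv * (dil k1 * t) by rewrite H.
have linv : k1_linv * k1 = 1 by rewrite -[X in _ * X]mulr1 k1_linvK.
by rewrite !mulrA -!rmorphM /= linv rmorph1 !mul1r.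
Qed.

Lemma dilate_k1_rreg s t : s * dil k1 = t * dil k1 -> s = t.
Proof.
move=> H; have : s * dil k1 * dil k1_rinv = t * dil k1 * dil k1_rinv by rewrite H.
have rinv : k1 * k1_rinv = 1 by rewrite -[X in X * _]mul1r k1_rinvK.
by rewrite -!mulrA -!rmorphM /= rinv rmorph1 !mulr1.
Qed.

Lemma ccomm_k1k1 : ccomm k1 k1.
Proof.
move=> i j; have := rtt 0 0 0 0; rewrite (_ : Rexch A q 1 0 0 = 0) // !mul0r !addr0 Lmx00.
move/(xy_lin_lreg q0) => H.
by have := congr1 (fun S : fps (fps A) => S j i) H; rewrite in_zw_coef in_wz_coef.
Qed.

Lemma k1_dilate_e : k1 * dil e = q^-1 *: (e * k1).
Proof.
have := qdet_antisym q0 rtt m0 0 0; rewrite /= Lmx00 Lmx10 => /eqP.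
rewrite subr_eq0 rmorphM /= mulrA scalerAl => /eqP; exact: dilate_k1_rreg.
Qed.

Lemma dilate_f_k1 : dil f * k1 = q *: (k1 * f).
Proof.
have := dilate_L01_L00 q0 rtt m0; rewrite Lmx00 Lmx01 rmorphM /= -mulrA scalerAr.
exact: dilate_k1_lreg.
Qed.

Lemma qdetE : qd = k1 * dil k2.
Proof.
rewrite /qdet Lmx00 Lmx11 Lmx10 Lmx01 rmorphD !rmorphM /= mulrDr.
have -> : k1 * (dil e * dil k1 * dil f) = q^-1 *: (e * k1 * (dil k1 * dil f)).
  by rewrite !mulrA k1_dilate_e -!scalerAl.
by rewrite addrK.
Qed.

Lemma ccomm_qdet_k1 : ccomm qd k1.
Proof. by have := ccomm_qdet q0 rtt m0 0 0; rewrite Lmx00. Qed.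

Lemma ccomm_inv0 (s t : fps A) kp : kp * t 0%N = 1 -> t 0%N * kp = 1 ->
  ccomm s t -> ccomm s (fpsC kp).
Proof.
move=> kpt tkp st; apply: ccommC => i.
by rewrite -[LHS]mul1r -kpt -!mulrA (mulrA (t 0%N)) -st -(mulrA (s i)) tkp mulr1.
Qed.

Lemma ccomm_linv s : ccomm s k1 -> ccomm s k1_linv.
Proof.
move=> sk1; have skp := ccomm_inv0 kp1k1 k1kp1 sk1.
by apply: ccommM => //; apply: ccomm_invS; exact: ccommM.
Qed.

Lemma ccomm_rinv s : ccomm s k1 -> ccomm s k1_rinv.
Proof.
move=> sk1; have skp := ccomm_inv0 kp1k1 k1kp1 sk1.
by apply: ccommM => //; apply: ccomm_invS; exact: ccommM.
Qed.

(** Here and in the next two lemmas a Gauss factor is recovered from the entries of L, by dividing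
    by k_1 or by subtracting e k_1 f. *)
Lemma ccomm_qdet_e : ccomm qd e.
Proof.
rewrite -[X in ccomm _ X]k1_rinvK; apply: ccommM; last exact: ccomm_rinv ccomm_qdet_k1.
by rewrite -Lmx10; exact: (ccomm_qdet q0 rtt m0 1 0).
Qed.

Lemma ccomm_qdet_f : ccomm qd f.
Proof.
rewrite -[X in ccomm _ X]k1_linvK; apply: ccommM; first exact: ccomm_linv ccomm_qdet_k1.
by rewrite -Lmx01; exact: (ccomm_qdet q0 rtt m0 0 1).
Qed.

Lemma ccomm_qdet_k2 : ccomm qd k2.
Proof.
rewrite -[X in ccomm _ X](addrK (e * k1 * f)).
apply: ccommD; first by rewrite -Lmx11; exact: (ccomm_qdet q0 rtt m0 1 1).
apply: ccommN; apply: ccommM; last exact: ccomm_qdet_f.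
by apply: ccommM; [exact: ccomm_qdet_e|exact: ccomm_qdet_k1].
Qed.

(** By qdet = k_1(z) k_2(q^2 z), k_2 is k_1^{-1} qdet dilated by q^{-2}. *)
Lemma ccomm_dil_k2 s : ccomm s qd -> ccomm s k1 -> ccomm s k2.
Proof.
move=> sq sk1; rewrite (_ : k2 = dilate (q ^- 2) (k1_linv * qd)); last first.
  by rewrite qdetE k1_linvK dilate_dilate mulVf ?dilate1 // expf_neq0.
by apply: ccomm_dilate; apply: ccommM => //; exact: ccomm_linv.
Qed.

Lemma ccomm_k1k2 : ccomm k1 k2.
Proof. by apply: ccomm_dil_k2; [apply: ccomm_sym; exact: ccomm_qdet_k1|exact: ccomm_k1k1]. Qed.

Lemma ccomm_k2k2 : ccomm k2 k2.
Proof.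
apply: ccomm_dil_k2; first by apply: ccomm_sym; exact: ccomm_qdet_k2.
by apply: ccomm_sym; exact: ccomm_k1k2.
Qed.

Lemma k10_e : fpsC (k1 0%N) * e = q *: (e * fpsC (k1 0%N)).
Proof.
have c0 : (e * k1) 0%N = 0 by rewrite fpsME big_ord_recl big_ord0 /= e0 mul0r addr0.
have H : fpsC (k1 0%N) * (e * k1) = q *: (e * k1 * fpsC (k1 0%N)).
  apply/fpsP => n; rewrite fpsCM fpsZE mulfpsC.
  have := rtt 0 1 0 0; rewrite Lmx00 Lmx10 (_ : Rexch A q 1 0 0 = 0) // mul0r addr0.
  (* The coefficient of w^{-n-1} z^0, in which the constant coefficient of L_{10} drops out since e
     starts in degree 1. *)
  move/(congr1 (fun S : fps (fps A) => S n.+1 0%N)).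
  rewrite fpsDE (_ : Rdiag A q 1 0 1 = xy_lin A 1 (- 1)) //.
  rewrite (_ : Rexch A q 1 0 1 = xy_lin A (q - q^-1) 0) //.
  rewrite (_ : Rdiag A q 1 0 0 = xy_lin A q (- (q^-1 * 1))) //.
  rewrite !xy_lin_coef !in_zw_coef in_wz_coef c0.
  by rewrite !fpsTM !scaler0 mul0r scaler0 !addr0 scale1r.
rewrite -{1}[e]k1_rinvK mulrA H -scalerAl; congr (_ *: _).
have kr : fpsC (k1 0%N) * k1_rinv = k1_rinv * fpsC (k1 0%N); last first.
  by rewrite -(mulrA (e * k1)) kr mulrA k1_rinvK.
apply: ccomm_mul; apply: ccomm_rinv => i j /=.
by case: eqP => _; rewrite ?mul0r ?mulr0 // ccomm_k1k1.
Qed.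

(** The constant term k_{1,0} k_{2,0} of [qdet] commutes with e, so k_{2,0} passes e with the
    inverse of the factor in [k10_e]. *)
Lemma kp2_e : e * fpsC kp2 = q^-1 *: (fpsC kp2 * e).
Proof.
have k20 : (dil k2) 0%N = k2 0%N by rewrite /= expr0 invr1 scale1r.
have cD : fpsC (k1 0%N * k2 0%N) * e = e * fpsC (k1 0%N * k2 0%N).
  apply: ccomm_mul => i j /=; case: eqP => _; rewrite ?mul0r ?mulr0 //.
  have := ccomm_qdet_e 0 j.
  by rewrite qdetE fpsME big_ord_recl big_ord0 addr0 subnn k20.
have c12 : k1 0%N * k2 0%N = k2 0%N * k1 0%N by rewrite ccomm_k1k2.
have : q *: (fpsC (k2 0%N) * e) * fpsC (k1 0%N) = e * fpsC (k2 0%N) * fpsC (k1 0%N).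
  rewrite -[RHS]mulrA -[in RHS]rmorphM /= -c12 -cD c12 rmorphM /= -[RHS]mulrA k10_e.
  by rewrite -scalerAr -scalerAl mulrA.
have K1P1 : fpsC (k1 0%N) * fpsC kp1 = 1 by rewrite -rmorphM /= k1kp1.
have K2P2 : fpsC (k2 0%N) * fpsC kp2 = 1 by rewrite -rmorphM /= k2kp2.
have P2K2 : fpsC kp2 * fpsC (k2 0%N) = 1 by rewrite -rmorphM /= kp2k2.
move/(congr1 ( *%R^~ (fpsC kp1))); rewrite -!(mulrA _ (fpsC (k1 0%N))) K1P1 !mulr1.
move/(congr1 ( *:%R q^-1)); rewrite scalerA mulVf // scale1r => K2e.
by rewrite -[e in LHS]mul1r -P2K2 -(mulrA _ _ e) K2e -scalerAr -scalerAl mulrA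
  -(mulrA _ (fpsC (k2 0%N))) K2P2 mulr1.
Qed.
End Gauss.

(** * The RTT relation for [L_minus] *)

Section MorphismImage.
Local Arguments Cpow : simpl never.
Variables (F : fieldType) (q : F) (A B : algType F) (phi : {lrmorphism A -> B}).
Variable g : Uq_gen -> A.
Let h x := phi (g x).

Lemma map_Cpow m : phi (Cpow g m) = Cpow h m.
Proof. by case: m => n; rewrite /Cpow rmorphXn. Qed.

Lemma map_L_minus : map_mx (map_fps phi) (L_minus q g) = L_minus q h.
Proof.
have kE i : map_fps phi (k_minus g i) = k_minus h i by apply/fpsP.
have eE : map_fps phi (e_minus q g) = e_minus q h.
  apply/fpsP => n; rewrite /= linearZ /=; congr (_ *: _).
  by case: eqP => _; rewrite ?raddf0 // linearZ /= rmorphM /= map_Cpow.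
have fE : map_fps phi (f_minus q g) = f_minus q h.
  by apply/fpsP => n; rewrite /= 2!linearZ /= rmorphM /= map_Cpow.
apply/matrixP => i j; rewrite mxE /L_minus.
by case: (ord2P i) => ->; case: (ord2P j) => ->;
  rewrite ?(Lmx00, Lmx01, Lmx10, Lmx11) ?rmorphD ?rmorphM /= ?kE ?eE ?fE.
Qed.

Lemma map_Lcoef m : map_mx phi (Lcoef q g false m) = Lcoef q h false m.
Proof.
rewrite /Lcoef; case: ifP => _; last exact: map_mx0.
by rewrite -map_L_minus -!map_mx_comp; apply/matrixP => i j; rewrite !mxE.
Qed.

Lemma map_Rcoef dir n : map_mx phi (Rcoef q A dir n) = Rcoef q B dir n.
Proof. by apply/matrixP => i j; rewrite !mxE linearZ /= rmorph1. Qed.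

Lemma map_tens m n p r (M : 'M[A]_(m, n)) (N : 'M[A]_(p, r)) :
  map_mx phi (M *t N) = map_mx phi M *t map_mx phi N.
Proof. by apply/matrixP => i j; rewrite !mxE rmorphM. Qed.

Lemma map_RLL a b : map_mx phi (RLL q g true 1 false false a b)
  = RLL q h true 1 false false a b.
Proof.
rewrite /RLL map_mx_sum; apply: eq_bigr => n _.
by rewrite !expr1n !scale1r 2!map_mxM /= !map_tens !map_Lcoef !map_mx1 map_Rcoef.
Qed.

Lemma map_LLR a b : map_mx phi (LLR q g true 1 false false a b)
  = LLR q h true 1 false false a b.
Proof.
rewrite /LLR map_mx_sum; apply: eq_bigr => n _.
by rewrite !expr1n !scale1r 2!map_mxM /= !map_tens !map_Lcoef !map_mx1 map_Rcoef.
Qed.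
End MorphismImage.

(** The defining relations equate entries over the free algebra; the whole matrices have to be
    carried along the quotient map before they apply. *)
Lemma Uq_RLL (F : fieldType) (q : F) a b :
  RLL q (Uq_elt q) true 1 false false a b = LLR q (Uq_elt q) true 1 false false a b.
Proof.
pose pi : {lrmorphism free_alg F Uq_gen -> Uq q} := quo_pi (@Uq_consistent F q).
have := map_RLL q pi (@free_gen F Uq_gen) a b => <-.
have := map_LLR q pi (@free_gen F Uq_gen) a b => <-.
apply/matrixP => i j; rewrite [LHS]mxE [RHS]mxE.
by apply: quo_rel; exact: Uq_RLL_same.
Qed.

Section PolynomialRMatrix.
Variables (F : fieldType) (q : F).
Hypothesis q0 : q != 0.
Local Notation m := (q - q^-1).

(* Clearing the denominator of \tilde R leaves a polynomial of degree 1, which turns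
   the infinite sums of the RTT relation into sums with two terms. *)
Definition Rpoly : 'M[fps F]_(2 * 2) :=
  let d := fpsC q * 'T - fpsC q^-1 in
  rows_mx (2 * 2) (2 * 2) [:: [:: d; 0; 0; 0];
                              [:: 0; 'T - 1; fpsC m * 'T; 0];
                              [:: 0; fpsC m; 'T - 1; 0];
                              [:: 0; 0; 0; d]].

Lemma Rpoly_Rtilde x y : (fpsC q * 'T - fpsC q^-1) * Rtilde q true x y = Rpoly x y.
Proof.
set d := fpsC q * 'T - fpsC q^-1.
set d' := fpsC (- q) * invS (1 - fpsC (q ^+ 2) * 'T).
have fpsCC (s t : fps F) : s * t = t * s by apply: ccomm_mul => i j; exact: mulrC.
have dd' : d * d' = 1.
  have -> : d = fpsC (- q^-1) * (1 - fpsC (q ^+ 2) * 'T).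
    apply/fpsP => n; rewrite fpsBE !fpsCM fpsBE fps1E fpsCM.
    by case: n => [|[|n]] /=; field.
  rewrite /d' mulrA -(mulrA (fpsC (- q^-1))) [_ * fpsC (- q)]fpsCC mulrA -rmorphM /=.
  by rewrite mulrNN mulVf // rmorph1 mul1r mulS_invS // fpsBE fps1E fpsCM mulr0 subr0.
rewrite /Rtilde /Rmx /Rpoly -/d -/d' !mxE.
by move: x y => [[|[|[|[|x]]]] //= ?] [[|[|[|[|y]]]] //= ?];
  rewrite ?mulr1 ?mulr0 // [X in d * X]fpsCC mulrA dd' mul1r.
Qed.

Lemma Rpoly_coef n x y : Rpoly x y n =
  q * (if n is n'.+1 then Rtilde q true x y n' else 0) - q^-1 * Rtilde q true x y n.
Proof.
rewrite -Rpoly_Rtilde mulrBl fpsBE -mulrA !fpsCM fpsTM.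
by case: n.
Qed.

Lemma Rpoly_deg1 n x y : Rpoly x y n.+2 = 0.
Proof.
have [c cE] : {c : fps F -> F | c = (fun s => s n.+2)} by exists (fun s => s n.+2).
have c0 : c 0 = 0 by rewrite cE.
have c1 : c (fpsC q * 'T - fpsC q^-1) = 0 by rewrite cE fpsBE fpsCM subr0 mulr0.
have c2 : c ('T - 1) = 0 by rewrite cE fpsBE fps1E subr0.
have c3 : c (fpsC m * 'T) = 0 by rewrite cE fpsCM mulr0.
have c4 : c (fpsC m) = 0 by rewrite cE.
have -> : Rpoly x y n.+2 = c (Rpoly x y) by rewrite cE.
rewrite mxE; move: x y => [[|[|[|[|x]]]] //= ?] [[|[|[|[|y]]]] //= ?];
  by rewrite ?c0 ?c1 ?c2 ?c3 ?c4.
Qed.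

Local Notation ip i p := (mxtens_index (i, p)).

Lemma sum_mxtens (V : nmodType) (f : 'I_(2 * 2) -> V) :
  \sum_z f z = (f (ip 0 0) + f (ip 0 1)) + (f (ip 1 0) + f (ip 1 1)).
Proof.
rewrite !big_ord_recl big_ord0 addr0 !addrA.
by congr (f _ + f _ + f _ + f _); apply/val_inj.
Qed.

(** Coefficients of T and of 1 in [Rpoly]: [rd] at the entry (ip, ip), [re] at the entry (ip,
    pi). *)
Definition rd1 (i p : 'I_2) : F := if i == p then q else 1.
Definition rd0 (i p : 'I_2) : F := if i == p then - q^-1 else - 1.
Definition re1 (i p : 'I_2) : F := if i == p then 0 else if i == 0 then m else 0.
Definition re0 (i p : 'I_2) : F := if i == p then 0 else if i == 0 then 0 else m.

Lemma Rpoly_entry (c : fps F -> F) dc d1 e1 e2 i p i' p' :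
  c 0 = 0 -> c (fpsC q * 'T - fpsC q^-1) = dc -> c ('T - 1) = d1 ->
  c (fpsC m * 'T) = e1 -> c (fpsC m) = e2 ->
  c (Rpoly (ip i p) (ip i' p')) =
    if (i' == i) && (p' == p) then (if i == p then dc else d1)
    else if (i' == p) && (p' == i) then (if i == 0 then e1 else e2) else 0.
Proof.
move=> c0 c1 c2 c3 c4; rewrite mxE.
by case: (ord2P i) => ->; case: (ord2P p) => ->; case: (ord2P i') => ->;
  case: (ord2P p') => ->; rewrite /= ?c0 ?c1 ?c2 ?c3 ?c4.
Qed.

Lemma Rpoly1_entry i p i' p' : Rpoly (ip i p) (ip i' p') 1%N =
  if (i' == i) && (p' == p) then rd1 i p
  else if (i' == p) && (p' == i) then re1 i p else 0.
Proof.
rewrite (@Rpoly_entry (fun s => s 1%N) q 1 m 0) //.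
- by case: (ord2P i) => ->; case: (ord2P p) => ->; case: (ord2P i') => ->;
    case: (ord2P p') => ->.
- by rewrite fpsBE fpsCM subr0 mulr1.
- by rewrite fpsBE fps1E subr0.
- by rewrite fpsCM mulr1.
Qed.

Lemma Rpoly0_entry i p i' p' : Rpoly (ip i p) (ip i' p') 0%N =
  if (i' == i) && (p' == p) then rd0 i p
  else if (i' == p) && (p' == i) then re0 i p else 0.
Proof.
rewrite (@Rpoly_entry (fun s => s 0%N) (- q^-1) (- 1) 0 m) //.
- by case: (ord2P i) => ->; case: (ord2P p) => ->; case: (ord2P i') => ->;
    case: (ord2P p') => ->.
- by rewrite fpsBE fpsCM mulr0 sub0r.
- by rewrite fpsBE fps1E sub0r.
- by rewrite fpsCM mulr0.
Qed.

Lemma Rpoly_row (V : lmodType F) (u v : 'I_(2 * 2) -> V) i p :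
  \sum_z (Rpoly (ip i p) z 0%N *: u z + Rpoly (ip i p) z 1%N *: v z)
  = (rd1 i p *: v (ip i p) + rd0 i p *: u (ip i p))
    + (re1 i p *: v (ip p i) + re0 i p *: u (ip p i)).
Proof.
rewrite sum_mxtens !Rpoly0_entry !Rpoly1_entry.
case: (ord2P i) => ->; case: (ord2P p) => ->;
  rewrite /= ?scale0r ?addr0 ?add0r;
  by [exact: addrC | rewrite (addrC (rd0 _ _ *: _))
     | rewrite [LHS]addrC (addrC (rd0 _ _ *: _))].
Qed.

Lemma Rpoly_col (V : lmodType F) (u v : 'I_(2 * 2) -> V) k s :
  \sum_z (Rpoly z (ip k s) 0%N *: u z + Rpoly z (ip k s) 1%N *: v z)
  = (rd1 k s *: v (ip k s) + rd0 k s *: u (ip k s))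
    + (re1 s k *: v (ip s k) + re0 s k *: u (ip s k)).
Proof.
rewrite sum_mxtens !Rpoly0_entry !Rpoly1_entry.
case: (ord2P k) => ->; case: (ord2P s) => ->;
  rewrite /= ?scale0r ?addr0 ?add0r;
  by [exact: addrC | rewrite (addrC (rd0 _ _ *: _))
     | rewrite [LHS]addrC (addrC (rd0 _ _ *: _))].
Qed.

Section Relation.
Variables (A : algType F) (g : Uq_gen -> A).
Hypothesis RLL_LLR : forall a b,
  RLL q g true 1 false false a b = LLR q g true 1 false false a b.
Local Notation Lc := (Lcoef q g false).

Lemma Lcoef_pos (a : int) : 0 < a -> Lc a = 0.
Proof. by move=> a0; rewrite /Lcoef leNgt a0. Qed.

Let X a b : 'M[A]_(2 * 2) := (Lc a *t 1%:M) *m (1%:M *t Lc b).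
Let Y a b : 'M[A]_(2 * 2) := (1%:M *t Lc b) *m (Lc a *t 1%:M).

(** Multiplication by q T - q^{-1} shifts the first sum by one index; the combined coefficients are
    those of [Rpoly], which has degree 1. *)
Lemma Rtilde_sum (w : nat -> A) x y N : (1 < N)%N ->
  q *: (\sum_(n < N) Rtilde q true x y n *: w n.+1)
    - q^-1 *: (\sum_(n < N.+1) Rtilde q true x y n *: w n)
  = Rpoly x y 0%N *: w 0%N + Rpoly x y 1%N *: w 1%N.
Proof.
case: N => [|[|N]] // _.
transitivity (\sum_(n < N.+3) Rpoly x y n *: w n).
  under [RHS]eq_bigr => n _ do rewrite Rpoly_coef scalerBl -!scalerA.
  rewrite sumrB -!scaler_sumr; congr (_ *: _ - _).
  by rewrite [RHS]big_ord_recl scale0r add0r.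
rewrite 2!big_ord_recl big1 ?addr0 // => n _.
by rewrite Rpoly_deg1 scale0r.
Qed.

Lemma big_trunc (V : nmodType) (u : nat -> V) N N' : (N <= N')%N ->
  (forall n, (N <= n)%N -> u n = 0) -> \sum_(n < N') u n = \sum_(n < N) u n.
Proof.
move=> leN u0; rewrite (big_ord_widen N' u leN) [RHS]big_mkcond.
by apply: eq_bigr => n _; case: ltnP => // /u0.
Qed.

Lemma X_pos a b : 0 < b -> X a b = 0.
Proof. by move=> b0; rewrite /X (Lcoef_pos b0) tensmx0 mulmx0. Qed.

Lemma Y_pos a b : 0 < b -> Y a b = 0.
Proof. by move=> b0; rewrite /Y (Lcoef_pos b0) tensmx0 mul0mx. Qed.

(** L^-(w) has no positive powers of w, so the terms with b + n > 0 vanish and the sum may be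
    lengthened freely. *)
Lemma RLL_sum a b N x y : (`|a| + `|b| < N)%N ->
  RLL q g true 1 false false a b x y
  = \sum_z \sum_(n < N) Rtilde q true x z n *: X (a - n%:Z) (b + n%:Z) z y.
Proof.
move=> ltN.
pose u n := \sum_z Rtilde q true x z n *: X (a - n%:Z) (b + n%:Z) z y.
transitivity (\sum_(n < N) u n); last by rewrite exchange_big.
rewrite (big_trunc (u := u) ltN) => [|n len]; last first.
  by rewrite /u big1 // => z _; rewrite X_pos ?mxE ?scaler0 //; lia.
rewrite summxE; apply: eq_bigr => n _.
rewrite expr1n scale1r -mulmxA mxE; apply: eq_bigr => z _.
by rewrite [X in X * _]mxE mulr_algl.
Qed.

Lemma LLR_sum a b N x y : (`|a| + `|b| < N)%N ->
  LLR q g true 1 false false a b x y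
  = \sum_z \sum_(n < N) Rtilde q true z y n *: Y (a - n%:Z) (b + n%:Z) x z.
Proof.
move=> ltN.
pose u n := \sum_z Rtilde q true z y n *: Y (a - n%:Z) (b + n%:Z) x z.
transitivity (\sum_(n < N) u n); last by rewrite exchange_big.
rewrite (big_trunc (u := u) ltN) => [|n len]; last first.
  by rewrite /u big1 // => z _; rewrite Y_pos ?mxE ?scaler0 //; lia.
rewrite summxE; apply: eq_bigr => n _.
rewrite expr1n scale1r mxE; apply: eq_bigr => z _.
by rewrite [X in _ * X]mxE mulr_algr.
Qed.

(** q times the relation at z^{a-1} w^{b+1} minus q^{-1} times the relation at z^a w^b. N exceeds
    the summation bounds of both. *)
Lemma RLL_poly a b x y :
  \sum_z (Rpoly x z 0%N *: X a b z y + Rpoly x z 1%N *: X (a - 1) (b + 1) z y)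
  = \sum_z (Rpoly z y 0%N *: Y a b x z + Rpoly z y 1%N *: Y (a - 1) (b + 1) x z).
Proof.
pose N := (absz a + absz b + absz (a - 1)%R + absz (b + 1)%R + 2)%N.
have e1 : RLL q g true 1 false false (a - 1) (b + 1) x y
    = LLR q g true 1 false false (a - 1) (b + 1) x y by rewrite RLL_LLR.
have e2 : RLL q g true 1 false false a b x y
    = LLR q g true 1 false false a b x y by rewrite RLL_LLR.
rewrite (@RLL_sum _ _ N) ?(@LLR_sum _ _ N) in e1; last 2 first; try lia.
rewrite (@RLL_sum _ _ N.+1) ?(@LLR_sum _ _ N.+1) in e2; last 2 first; try lia.
have shift c n : c - 1 - n%:Z = c - n.+1%:Z by lia.
have shift' c n : c + 1 + n%:Z = c + n.+1%:Z by lia.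
transitivity (q *: (\sum_z \sum_(n < N) Rtilde q true x z n *: X (a - 1 - n%:Z) (b + 1 + n%:Z) z y)
  - q^-1 *: (\sum_z \sum_(n < N.+1) Rtilde q true x z n *: X (a - n%:Z) (b + n%:Z) z y)).
  rewrite !scaler_sumr -sumrB; apply: eq_bigr => z _.
  under [X in _ = q *: X - _]eq_bigr => n _ do rewrite shift shift'.
  rewrite (@Rtilde_sum (fun n => X (a - n%:Z) (b + n%:Z) z y)) ?subr0 ?addr0 //.
  lia.
rewrite e1 e2 !scaler_sumr -sumrB; apply: eq_bigr => z _.
under [X in q *: X - _ = _]eq_bigr => n _ do rewrite shift shift'.
rewrite (@Rtilde_sum (fun n => Y (a - n%:Z) (b + n%:Z) x z)) ?subr0 ?addr0 //.
lia.
Qed.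

Lemma X_entry a b i p k s : X a b (ip i p) (ip k s) = Lc a i k * Lc b p s.
Proof.
rewrite mxE sum_mxtens !tensmxE !mxE.
by case: (ord2P p) => ->; case: (ord2P k) => ->;
  rewrite /= !(mulr1n, mulr0n, mulr0, mul0r, addr0, add0r, mulr1, mul1r).
Qed.

Lemma Y_entry a b i p k s : Y a b (ip i p) (ip k s) = Lc b p s * Lc a i k.
Proof.
rewrite mxE sum_mxtens !tensmxE !mxE.
by case: (ord2P i) => ->; case: (ord2P s) => ->;
  rewrite /= !(mulr1n, mulr0n, mulr0, mul0r, addr0, add0r, mulr1, mul1r).
Qed.

Local Notation L := (L_minus q g).

Lemma Lcoef_opp n i k : Lc (- n%:Z) i k = L i k n.
Proof. by rewrite /Lcoef ifT ?mxE ?abszN ?absz_nat //; lia. Qed.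

Lemma Lcoef_1opp n i k : Lc (1 - n%:Z) i k = if n is n'.+1 then L i k n' else 0.
Proof.
case: n => [|n]; first by rewrite subr0 Lcoef_pos ?mxE.
by rewrite -Lcoef_opp; congr (Lc _ i k); lia.
Qed.

Lemma L_minus_RTT : RTT_rel (Rdiag A q 1) (Rexch A q 1)
  (fun i k => in_z (L i k)) (fun i k => in_w (L i k)).
Proof.
move=> i p k s; apply/fpsP => w; apply/fpsP => z.
have DE i' p' : Rdiag A q 1 i' p' = xy_lin A (rd1 i' p') (rd0 i' p').
  by rewrite /Rdiag /rd1 /rd0; case: ifP; rewrite ?mulr1.
have EE i' p' : Rexch A q 1 i' p' = xy_lin A (re1 i' p') (re0 i' p').
  rewrite /Rexch /re1 /re0; case: ifP => _; first by rewrite /xy_lin !scale0r addr0.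
  by case: ifP => _; rewrite ?mulr1.
(* [Rdiag] and [Rexch] are cleared by x y (zq - w q^{-1}), which is x (q z/w - q^{-1}); the factor x
   = z^{-1} shifts the exponent of z to 1 - z. *)
have := RLL_poly (1 - z%:Z) (- w%:Z) (ip i p) (ip k s).
rewrite Rpoly_row Rpoly_col !X_entry !Y_entry.
rewrite (_ : 1 - z%:Z - 1 = - z%:Z); last by lia.
rewrite (_ : - w%:Z + 1 = 1 - w%:Z); last by lia.
rewrite !Lcoef_opp !Lcoef_1opp !DE !EE => H.
by rewrite [LHS]fps2DE [RHS]fps2DE !xy_lin_zw_coef !xy_lin_wz_coef.
Qed.
End Relation.
End PolynomialRMatrix.

(** * The Drinfeld elements *)

Section FreeInduction.
Variables (F : fieldType) (X : choiceType).

Lemma free_alg_ind (P : free_alg F X -> Prop) :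
  P 1 -> (forall x a, P a -> P (free_gen F x * a)) ->
  (forall c a, P a -> P (c *: a)) -> (forall a b, P a -> P b -> P (a + b)) ->
  forall a, P a.
Proof.
move=> P1 PM PZ PD a; rewrite [a]monalgE; apply: big_ind => //.
  by rewrite -(scale0r (1 : free_alg F X)); exact: PZ.
move=> k _; suff Pk : P << k >>%R.
  have -> : (<< a@_k *g k >> : free_alg F X) = a@_k *: << k >>%R; last exact: PZ.
  by rewrite -mul_malgC malgM_def fgmulUU mul1m mulr1.
case: k => s; elim: s => [|x s IH].
  by rewrite -fmoneE.
have -> : << FMonom (x :: s) >>%R = free_gen F x * << FMonom s >>%R.
  rewrite /free_gen malgM_def fgmulUU mulr1; congr (<< _ >>)%R.
  by apply/eqP; rewrite fmP fmM fmuE.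
exact: PM.
Qed.
End FreeInduction.

Lemma comm_gen_central (F : fieldType) (X : choiceType) (A : algType F)
    (phi : {lrmorphism free_alg F X -> A}) y :
  (forall x, y * phi (free_gen F x) = phi (free_gen F x) * y) ->
  forall a, y * phi a = phi a * y.
Proof.
move=> yx; elim/free_alg_ind => [|x a IH|c a IH|a b IHa IHb].
- by rewrite rmorph1 mulr1 mul1r.
- by rewrite rmorphM mulrA yx -mulrA IH mulrA.
- by rewrite linearZ /= -scalerAr IH scalerAl.
- by rewrite rmorphD mulrDr mulrDl IHa IHb.
Qed.

Section CentralPowers.
Variables (F : fieldType) (A : algType F) (g : Uq_gen -> A).
Hypothesis Chalf_central : forall a, g Chalf * a = a * g Chalf.
Hypothesis Chalfinv_central : forall a, g Chalfinv * a = a * g Chalfinv.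
Hypothesis ChalfK : g Chalf * g Chalfinv = 1.
Local Notation C_ := (Cpow g).

Lemma Cpow_central i a : C_ i * a = a * C_ i.
Proof.
by apply/esym; case: i => n; apply: commrX; rewrite /GRing.comm
  ?Chalf_central ?Chalfinv_central.
Qed.

Lemma CpowD_nat (m n : nat) : C_ (m%:Z - n%:Z) = C_ m * C_ (- n%:Z).
Proof.
have CN k : C_ (- k%:Z) = g Chalfinv ^+ k by case: k.
rewrite CN -[C_ m]/(g Chalf ^+ m).
elim: m n => [|m IH] [|n]; rewrite ?expr0 ?mul1r ?mulr1 ?subr0 ?sub0r ?CN //.
rewrite (_ : m.+1%:Z - n.+1%:Z = m%:Z - n%:Z); last by lia.
by rewrite IH exprSr exprS -!mulrA (mulrA _ (g Chalfinv)) ChalfK mul1r.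
Qed.

Lemma Cpow_subS (m n : nat) : C_ (m%:Z - n%:Z + 1) = C_ m.+1 * C_ (- n%:Z).
Proof. by rewrite -CpowD_nat; congr (C_ _); lia. Qed.
End CentralPowers.

Section UqRelations.
Variables (F : fieldType) (q : F).
Local Notation U := (Uq q).
Local Notation elt := (Uq_elt q).

Let pi : {lrmorphism free_alg F Uq_gen -> U} := quo_pi (@Uq_consistent F q).

Let relE x y : Uq_rel q (@free_gen F Uq_gen) x y -> pi x = pi y.
Proof. exact: quo_rel. Qed.

Lemma KplusK i : elt (Kplus i 0) * elt (Kminus i 0) = 1.
Proof.
exact: etrans (esym (rmorphM pi _ _)) (etrans (relE (Uq_kpkm _ _ i)) (rmorph1 pi)).
Qed.

Lemma KminusK i : elt (Kminus i 0) * elt (Kplus i 0) = 1.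
Proof.
exact: etrans (esym (rmorphM pi _ _)) (etrans (relE (Uq_kmkp _ _ i)) (rmorph1 pi)).
Qed.

Lemma ChalfK : elt Chalf * elt Chalfinv = 1.
Proof.
exact: etrans (esym (rmorphM pi _ _)) (etrans (relE (Uq_CCinv _ _)) (rmorph1 pi)).
Qed.

Lemma Chalf_central a : elt Chalf * a = a * elt Chalf.
Proof.
elim/quo_ind: a; apply: (@comm_gen_central _ _ _ pi) => x.
exact: etrans (esym (rmorphM pi _ _)) (etrans (relE (Uq_Ccentral _ _ x)) (rmorphM pi _ _)).
Qed.

Lemma Chalfinv_central a : elt Chalfinv * a = a * elt Chalfinv.
Proof.
elim/quo_ind: a; apply: (@comm_gen_central _ _ _ pi) => x.
exact: etrans (esym (rmorphM pi _ _)) (etrans (relE (Uq_Cinvcentral _ _ x)) (rmorphM pi _ _)).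
Qed.

Lemma Uq_L_minus_RTT : q != 0 -> RTT_rel (Rdiag U q 1) (Rexch U q 1)
  (fun i k => in_z (L_minus q elt i k)) (fun i k => in_w (L_minus q elt i k)).
Proof. by move=> q0; exact (L_minus_RTT q0 (@Uq_RLL F q)). Qed.
End UqRelations.

(** * The images of the generating series *)

Section Images.
Variables (F : fieldType) (q : F).
Hypotheses (q0 : q != 0) (m0 : q - q^-1 != 0).
Hypothesis char0 : [pchar F] =i pred0.
Hypothesis qn0 : forall n, q ^+ n.+1 + q ^- n.+1 != 0.
Variables (A : algType F) (g : Uq_gen -> A).
Hypothesis Chalf_comm : forall a, g Chalf * a = a * g Chalf.
Hypothesis Chalfinv_comm : forall a, g Chalfinv * a = a * g Chalfinv.
Hypothesis ChalfVK : g Chalf * g Chalfinv = 1.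
Hypothesis kpmK : forall i, g (Kplus i 0) * g (Kminus i 0) = 1.
Hypothesis kmpK : forall i, g (Kminus i 0) * g (Kplus i 0) = 1.
Local Notation C_ := (Cpow g).
Local Notation m := (q - q^-1).
Local Notation p := (q + q^-1).
Variables (kk : 'I_2 -> fps A) (e f : fps A).
Local Notation k1 := (kk 0).
Local Notation k2 := (kk 1).
Local Notation kp1 := (g (Kplus 0 0)).
Local Notation kp2 := (g (Kplus 1 0)).
Local Notation dil := (dilate (q ^+ 2)).
Local Notation L := (fun i j : 'I_2 => Lmx k1 k2 e f i j).
Hypothesis rtt : RTT_rel (Rdiag A q 1) (Rexch A q 1)
  (fun i j => in_z (L i j)) (fun i j => in_w (L i j)).

Hypothesis kk0 : forall i, kk i 0%N = g (Kminus i 0).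
Hypothesis e0 : e 0%N = 0.
Hypothesis eE : forall n, e n.+1 = - m *: (q ^+ n.+1 *: (C_ n.+1 * g (Xminus n.+1))).
Hypothesis fE : forall n, f n = - m *: (q ^+ n *: (C_ (- n%:Z) * g (Xplus n))).

Let kpkK i : g (Kplus i 0) * kk i 0%N = 1.
Proof. by rewrite kk0. Qed.
Let kkpK i : kk i 0%N * g (Kplus i 0) = 1.
Proof. by rewrite kk0. Qed.
Let kp1k1 : kp1 * k1 0%N = 1 := kpkK 0.
Let k1kp1 : k1 0%N * kp1 = 1 := kkpK 0.
Let kp2k2 : kp2 * k2 0%N = 1 := kpkK 1.
Let k2kp2 : k2 0%N * kp2 = 1 := kkpK 1.

(** The exponent in k^-_i(z) = k^-_{i,0} exp(...): its n-th coefficient is - (q - q^{-1})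
    a_{i,n}. *)
Definition lnk (i : 'I_2) : fps A := lnS (fpsC (g (Kplus i 0)) * kk i).

Let kpk0 i : (fpsC (g (Kplus i 0)) * kk i) 0%N = 1.
Proof. by rewrite fpsCM kpkK. Qed.

Lemma lnk0 i : lnk i 0%N = 0.
Proof. exact: (lnSP (kpk0 i)).1. Qed.

Lemma expS_lnk i : expS (lnk i) = fpsC (g (Kplus i 0)) * kk i.
Proof. exact: (lnSP (kpk0 i)).2. Qed.

Let ccomm_kp s i : ccomm s (kk i) -> ccomm s (fpsC (g (Kplus i 0))).
Proof. by move=> si; exact: (@ccomm_inv0 _ _ s (kk i) _ (kpkK i) (kkpK i) si). Qed.

Lemma ccomm_lnk s i : ccomm s (kk i) -> ccomm s (lnk i).
Proof.
by move=> si; apply: ccomm_lnS (kpk0 i) _; apply: ccommM => //; exact: ccomm_kp.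
Qed.

Lemma ccomm_kk i j : ccomm (kk i) (kk j).
Proof.
case: (ord2P i) => ->; case: (ord2P j) => ->.
- exact: (ccomm_k1k1 q0 rtt).
- exact: (ccomm_k1k2 q0 m0 rtt kp1k1 k1kp1).
- by apply: ccomm_sym; exact: (ccomm_k1k2 q0 m0 rtt kp1k1 k1kp1).
- exact: (ccomm_k2k2 q0 m0 rtt kp1k1 k1kp1).
Qed.

Lemma ccomm_lnk_k i j : ccomm (kk i) (lnk j).
Proof. by apply: ccomm_lnk; exact: ccomm_kk. Qed.

Lemma ccomm_lnk_lnk i j : ccomm (lnk i) (lnk j).
Proof. by apply: ccomm_lnk; apply: ccomm_sym; exact: ccomm_lnk_k. Qed.

Definition lnqdet : fps A := lnk 0 + dil (lnk 1).

Lemma lnqdet0 : lnqdet 0%N = 0.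
Proof. by rewrite fpsDE /= !lnk0 scaler0 addr0. Qed.

Let qd := qdet q L.

Lemma expS_lnqdet : expS lnqdet = fpsC (kp1 * kp2) * qd.
Proof.
rewrite /lnqdet expSD ?lnk0 //=; last 2 first.
- by rewrite lnk0 scaler0.
- by apply: ccomm_mul; apply: ccomm_dilate; exact: ccomm_lnk_lnk.
rewrite expS_dilate !expS_lnk rmorphM /= dilateC.
have -> : qd = k1 * dil k2 := qdetE q0 m0 rtt k1kp1.
rewrite rmorphM /= -!mulrA; congr (_ * _); rewrite !mulrA; congr (_ * _).
by apply: ccomm_mul; apply: ccomm_kp; exact: ccomm_kk.
Qed.

Lemma ccomm_kp12 s : ccomm s qd -> ccomm s (fpsC (kp1 * kp2)).
Proof.
move=> sq; have qd0 : qd 0%N = k1 0%N * k2 0%N.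
  have -> : qd = k1 * dil k2 := qdetE q0 m0 rtt k1kp1.
  by rewrite fpsME big_ord_recl big_ord0 addr0 /= expr0 invr1 scale1r.
have kpC : kp2 * kp1 = kp1 * kp2.
  by have := @ccomm_kp (fpsC kp2) 0 (ccomm_sym (ccomm_kp (ccomm_kk _ _))) 0%N 0%N.
apply: (@ccomm_inv0 _ _ s qd) => //; rewrite qd0 -?kpC.
- by rewrite -mulrA (mulrA kp1) kpkK mul1r kpkK.
- by rewrite -mulrA (mulrA (k2 0%N)) kkpK mul1r kkpK.
Qed.

Lemma ccomm_lnqdet s : ccomm s qd -> ccomm s lnqdet.
Proof.
move=> sq; have -> : lnqdet = lnS (expS lnqdet).
  have [l0 le] := lnSP (expS0 lnqdet).
  exact: (expS_inj lnqdet0 l0 (esym le)).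
apply: ccomm_lnS; first exact: expS0.
by rewrite expS_lnqdet; apply: ccommM => //; exact: ccomm_kp12.
Qed.

Lemma sum0_ext w (a : nat -> A) (s : fps A) :
  (forall k, a k = s k) -> sum0 w a = sum0 w s.
Proof. by move=> as_; apply/fpsP => n /=; rewrite as_. Qed.

Lemma sum1_ext w (a : nat -> A) (s : fps A) :
  s 0%N = 0 -> (forall k, a k = s k.+1) -> sum1 w a = sum0 w s.
Proof. by move=> s0 as_; apply: sum0_ext => -[|k]; rewrite ?s0 ?as_. Qed.

Lemma sum2_ext w (b : nat -> nat -> A) c (s t : fps A) : s 0%N = 0 ->
  (forall k l, b k l = c *: (s k.+1 * t l)) -> sum2 w b = sum0 w (c *: (s * t)).
Proof.
move=> s0 bE; apply: sum1_ext => [|k].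
  by rewrite fpsZE fpsME big_ord_recl big_ord0 s0 mul0r addr0 scaler0.
rewrite fpsZE fpsME [in RHS]big_ord_recl s0 mul0r add0r scaler_sumr.
by apply: eq_bigr => i _; rewrite bE lift0 subSS.
Qed.

(* The formulas of Defs, over A instead of Uq: in Uq itself unification
   unfolds the quotient. *)
Local Notation Kelt := (g (Kminus 1 0) * g (Kplus 0 0)).
Local Notation Kinv := (g (Kminus 0 0) * g (Kplus 1 0)).
Definition gen_qu2_inv : fps A := q^-1 *: 'T ^+ 2.
Definition gen_ql : A := q^-1 *: C_ (- 3).
Local Notation iota := gen_qu2_inv.
Local Notation ql_ := gen_ql.
Local Notation S := (sum0 ql_).
Local Notation epsm_ := ((q * p) *: C_ (- 2)).

Definition gen_a (i : 'I_2) (n : nat) : A := - m^-1 *: lnk i n.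
Definition gen_gamma (n : nat) : A := q ^+ n *: gen_a 0 n + q ^- n *: gen_a 1 n.
Definition gen_h (n : nat) : A := q ^- n *: (gen_a 0 n - gen_a 1 n).
Definition gen_psi : fps A :=
  fpsC Kelt * expS (m *: Fps (fun k => if k == 0%N then 0 else gen_h k)).
Definition gen_gamma' (n : nat) : A :=
  - (m ^+ (2 * n - 1) / n%:R)
    *: ((epsp q / (rho q * q)) *: (epsm_ * C_ 3)) ^+ n.
Definition gen_exp (u : nat -> A) : fps A :=
  expS (- m *: sum1 ql_ (fun k => (q ^+ k.+1 + q ^- k.+1)^-1 *: u k.+1)).
Local Notation gen_g := (gen_exp (fun n => gen_h n + gen_gamma' n)).
Local Notation gen_c := (gen_exp gen_gamma').
Local Notation gen_cc := (gen_exp gen_gamma).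
Definition gen_psi_u : fps A := sum0 (C_ (- 3)) gen_psi.

Definition gen_N_plus : fps A :=
  gen_g * (- (kbarm q * (q ^+ 2 + 1)) *: (iota * sum0 ql_ (fun k =>
               q ^+ k *: (C_ (- k%:Z) * Kinv * g (Xplus k))))
           + epsp q *: (iota * fpsC Kinv)).

Definition gen_N_minus : fps A :=
  (- (kbarp q * (q ^- 2 + 1)) *: sum1 ql_ (fun k =>
       q ^+ k.+1 *: (C_ k.+1 * g (Xminus k.+1)))
   + fpsC epsm_ * (q^-1 *: (iota *
       (gen_psi_u + m ^+ 2 *: sum2 ql_ (fun k l =>
          q ^ (k%:Z - l%:Z) *: (C_ (k%:Z - l%:Z + 1) * g (Xminus k.+1) * g (Xplus l))))))) * gen_g.

Definition gen_M_plus : fps A :=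
  ((rho q / m)%:A
   - fpsC epsm_ * ((kbarm q * q^-1 * (q ^+ 2 - q ^- 2)) *: (iota *
       sum0 ql_ (fun k => q ^- k *: (C_ (- k%:Z) * g (Xplus k))))))
  * gen_g - (rho q / m)%:A.

Definition gen_M_minus : fps A :=
  gen_g * ((rho q / m) *: (fpsC Kinv * gen_psi_u)
   - (epsp q * kbarp q * (q ^+ 2 - q ^- 2)) *: sum1 ql_ (fun k =>
       q ^ (- k%:Z + 1) *: (C_ k.+1 * g (Xminus k.+1) * Kinv))
   + (rho q * m) *: sum2 ql_ (fun k l =>
       q ^ (- k%:Z + l%:Z) *:
         (C_ (k%:Z - l%:Z + 1) * Kinv * g (Xminus k.+1) * g (Xplus l))))
  - (rho q / m)%:A.

Let C_central i (a : A) : C_ i * a = a * C_ i.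
Proof. exact: Cpow_central. Qed.

Let qlC (a : A) : ql_ * a = a * ql_.
Proof. by rewrite /gen_ql -scalerAl C_central scalerAr. Qed.

Let SM (s t : fps A) : S (s * t) = S s * S t. Proof. exact: sum0M. Qed.
Let SD (s t : fps A) : S (s + t) = S s + S t. Proof. exact: sum0D. Qed.
Let SZ c (s : fps A) : S (c *: s) = c *: S s. Proof. exact: sum0Z. Qed.
Let SC (a : A) : S (fpsC a) = fpsC a. Proof. exact: sum0C. Qed.

(** The exponent of [gen_exp] as a series in z^{-1}, before [S] substitutes z = q u^2 lambda. *)
Definition wlogser (u : nat -> A) : fps A := - m *: Fps (fun n =>
  if n is k.+1 then (q ^+ k.+1 + q ^- k.+1)^-1 *: u k.+1 else 0).

Lemma wlogser0 u : wlogser u 0%N = 0. Proof. exact: scaler0. Qed.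

Lemma gen_expE u : gen_exp u = S (expS (wlogser u)).
Proof. by rewrite /gen_exp -expS_sum0 ?wlogser0 // /wlogser SZ. Qed.

Lemma wlogserD u v : wlogser (fun n => u n + v n) = wlogser u + wlogser v.
Proof.
apply/fpsP => -[|n]; rewrite fpsDE !fpsZE /= ?scaler0 ?addr0 //.
by rewrite !scalerDr.
Qed.

(** gamma_n = q^n (a_{1,n} + q^{-2n} a_{2,n}), and up to the factor - (q - q^{-1}) the bracket is
    the n-th coefficient of the logarithm of k_1(z) k_2(q^2 z), normalised. *)
Lemma gen_gammaE n : gen_gamma n = - m^-1 *: (q ^+ n *: lnqdet n).
Proof.
rewrite /gen_gamma /gen_a fpsDE scalerDr scalerDr !scalerA.
congr (_ *: _ + _ *: _); first by rewrite mulrC.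
rewrite exprAC; move: (q - q^-1) m0 => mm mm0.
by field; rewrite mm0 expf_neq0.
Qed.

(** h_n + gamma_n = (q^n + q^{-n}) a_{1,n}, and the weights divide by q^n + q^{-n}. *)
Lemma wlogser_h_gamma : wlogser gen_h + wlogser gen_gamma = lnk 0.
Proof.
apply/fpsP => -[|n]; rewrite fpsDE !fpsZE /=.
  by rewrite scaler0 addr0 lnk0.
have cancel x y (a b : A) : y *: (a - b) + (x *: a + y *: b) = (x + y) *: a.
  by rewrite scalerBr addrCA subrK scalerDl.
rewrite -!scalerDr /gen_h /gen_gamma cancel /gen_a !scalerA.
rewrite -(mulrA (- m)) mulVf // mulr1 mulrNN mulfV //.
by rewrite scale1r.
Qed.

Lemma ccomm_wlogser_gamma s : ccomm s qd -> ccomm s (wlogser gen_gamma).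
Proof.
move=> /ccomm_lnqdet sl i [|j]; rewrite fpsZE /= ?scaler0 ?mulr0 ?mul0r //.
by rewrite gen_gammaE -!scalerAr -!scalerAl sl.
Qed.

Lemma ccomm_wlogser_gamma' s : ccomm s (wlogser gen_gamma').
Proof.
move=> i [|j]; rewrite fpsZE /= ?scaler0 ?mulr0 ?mul0r //.
rewrite /gen_gamma' -!scalerAr -!scalerAl; do 3!congr (_ *: _).
apply: commrX; rewrite /GRing.comm -!scalerAr -!scalerAl; do 2!congr (_ *: _).
by rewrite mulrA -[s i * _]C_central -mulrA -[s i * _]C_central mulrA.
Qed.

Let qdE : qd = k1 * dil k2 := qdetE q0 m0 rtt k1kp1.
Let qd_k1 : ccomm qd k1 := ccomm_qdet_k1 q0 m0 rtt.
Let qd_e : ccomm qd e := ccomm_qdet_e q0 m0 rtt kp1k1 k1kp1.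
Let qd_f : ccomm qd f := ccomm_qdet_f q0 m0 rtt kp1k1 k1kp1.
Let qd_k2 : ccomm qd k2 := ccomm_qdet_k2 q0 m0 rtt kp1k1 k1kp1.
Let qd_k i : ccomm qd (kk i).
Proof. by case: (ord2P i) => ->. Qed.

Let ccomm_km s i : ccomm s (kk i) -> ccomm s (fpsC (g (Kminus i 0))).
Proof. by move=> si; apply: ccommC => j; rewrite -kk0 (si j 0%N). Qed.

Lemma ccomm_qd_qd : ccomm qd qd.
Proof. by rewrite {2}qdE; apply: ccommM => //; apply: ccomm_dilate. Qed.

Lemma ccomm_wlogser : ccomm (wlogser gen_h + wlogser gen_gamma')
  (- wlogser gen_gamma' + wlogser gen_gamma).
Proof.
have gg' s : ccomm s qd -> ccomm s (- wlogser gen_gamma' + wlogser gen_gamma).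
  move=> sq; apply: ccommD; last exact: ccomm_wlogser_gamma.
  by apply: ccommN; exact: ccomm_wlogser_gamma'.
apply: gg'; apply: ccomm_sym; apply: ccommD; last exact: ccomm_wlogser_gamma'.
rewrite -[X in ccomm _ X](addrK (wlogser gen_gamma)) wlogser_h_gamma.
apply: ccommD; first exact: ccomm_lnk.
by apply: ccommN; apply: ccomm_wlogser_gamma; exact: ccomm_qd_qd.
Qed.

Local Notation Z := (invS gen_c * gen_cc).

Lemma ZE : Z = S (expS (- wlogser gen_gamma' + wlogser gen_gamma)).
Proof.
have w0 := wlogser0.
rewrite !gen_expE -(expS_sum0 qlC (w0 gen_gamma')).
have Sw0 : S (wlogser gen_gamma') 0%N = 0 by rewrite -[LHS]/(wlogser gen_gamma' 0%N * 1) w0 mul0r.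
rewrite (invS_expS char0 Sw0) -scaleN1r -SZ scaleN1r expS_sum0 ?fpsNE ?w0 ?oppr0 //.
rewrite -SM -expSD ?fpsNE ?w0 ?oppr0 //.
rewrite mulNr mulrN; congr (- _).
by apply: ccomm_mul; apply: ccomm_sym; exact: ccomm_wlogser_gamma'.
Qed.

(** The exponents commute and add up to those of h + gamma' - gamma' + gamma. *)
Lemma gZ : gen_g * Z = S (fpsC kp1 * k1).
Proof.
have w0 := wlogser0.
rewrite ZE gen_expE wlogserD -SM -(expSD char0); last 1 first.
- exact: ccomm_mul ccomm_wlogser.
- by rewrite -addrA addNKr wlogser_h_gamma expS_lnk.
- by rewrite fpsDE !w0 addr0.
- by rewrite fpsDE fpsNE !w0 oppr0 addr0.
Qed.

Lemma Z_comm t : ccomm qd t -> S t * Z = Z * S t.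
Proof.
move=> /ccomm_sym tq; rewrite ZE -SM ccomm_mul ?SM //.
apply: ccomm_expS; apply: ccommD; last exact: ccomm_wlogser_gamma.
by apply: ccommN; exact: ccomm_wlogser_gamma'.
Qed.

Lemma iotaC s : iota * s = s * iota.
Proof.
by rewrite /gen_qu2_inv -scalerAl -scalerAr expr2 -mulrA 2!fpsTC -mulrA.
Qed.

Lemma fpsC_Cpow i s : fpsC (C_ i) * s = s * fpsC (C_ i).
Proof.
by apply: ccomm_mul; apply: ccomm_sym; apply: ccommC => j; rewrite C_central.
Qed.

Let S1 : S (1 : fps A) = 1. Proof. exact: SC. Qed.

Let kp_comm i s : ccomm s (kk i) -> fpsC (g (Kplus i 0)) * s = s * fpsC (g (Kplus i 0)).
Proof. by move=> si; apply/esym/ccomm_mul/ccomm_kp. Qed.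

Let mVK (v : A) : - m^-1 *: (- m *: v) = v.
Proof. by rewrite scalerA mulrNN mulVf ?scale1r. Qed.

Let kpk_Kinv : fpsC kp1 * k1 * fpsC Kinv = fpsC kp2 * k1.
Proof.
rewrite rmorphM /= mulrA -(mulrA (fpsC kp1)) (ccomm_mul (ccomm_km (ccomm_kk _ _))).
rewrite mulrA -rmorphM /= kpmK rmorph1 mul1r.
by rewrite (kp_comm (ccomm_kk _ _)).
Qed.

Let Kinv_f_coef k : q ^+ k *: (C_ (- k%:Z) * Kinv * g (Xplus k))
  = (- m^-1 *: (fpsC Kinv * f)) k.
Proof.
rewrite fpsZE fpsCM fE.
rewrite -!scalerAr; apply/esym; etransitivity; first exact: mVK.
by rewrite (mulrA Kinv) -(C_central _ Kinv).
Qed.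

(** With g on the left, Z has to pass the remaining factor [x] to meet g; it can, since [x] commutes
    with [qdet]. K^{-1} then turns k^+_{1,0} k_1 into k^+_{2,0} k_1. *)
Lemma N_plus_image : gen_N_plus * invS gen_c * gen_cc
  = (p * q) *: (iota * S (fpsC kp2 * (L 0 1 + q^-1 *: L 0 0))).
Proof.
pose x : fps A := p *: (fpsC Kinv * (q *: f + 1)).
have E : - (kbarm q * (q ^+ 2 + 1)) *: (iota * sum0 ql_ (fun k =>
               q ^+ k *: (C_ (- k%:Z) * Kinv * g (Xplus k))))
           + epsp q *: (iota * fpsC Kinv) = iota * S x.
  rewrite (sum0_ext _ Kinv_f_coef) !scalerAr -mulrDr; congr (_ * _).
  rewrite /x -scalerAr !SZ !SM SD SZ S1 !SC [in RHS]mulrDr mulr1 scalerDr -scalerAr !scalerA.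
  congr (_ *: _ + _ *: _); rewrite /kbarm /epsp;
    move: (q - q^-1) m0 => mm mm0; by field; rewrite q0 mm0.
have xq : ccomm qd x.
  apply: ccommZ; apply: ccommM; first by rewrite rmorphM; apply: ccommM;
    [exact: ccomm_km|exact: ccomm_kp].
  by apply: ccommD; [exact: ccommZ|exact: ccomm1].
have zE : fpsC kp1 * k1 * x
    = (p * q) *: (fpsC kp2 * (L 0 1 + q^-1 *: L 0 0)).
  rewrite /x Lmx01 Lmx00 -scalerAr (mulrA (fpsC kp1 * k1)) kpk_Kinv -scalerA; congr (_ *: _).
  rewrite -mulrA scalerAr; congr (_ * _).
  by rewrite scalerDr scalerA mulfV // scale1r mulrDr mulr1 -scalerAr.
rewrite /gen_N_plus E mulrA -(iotaC gen_g) -!mulrA (Z_comm xq) (mulrA gen_g) gZ -SM.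
by rewrite zE SZ scalerAr.
Qed.

Let e_coef k : q ^+ k.+1 *: (C_ k.+1 * g (Xminus k.+1)) = (- m^-1 *: e) k.+1.
Proof. by rewrite fpsZE eE mVK. Qed.

Let me0 : (- m^-1 *: e) 0%N = 0.
Proof. by rewrite fpsZE e0 scaler0. Qed.

Lemma sum0_dilate w c (s : fps A) : sum0 w (dilate c s) = sum0 (c^-1 *: w) s.
Proof.
apply/fpsP => n; rewrite !sum0E; case: ifP => // _.
by rewrite /= exprZn exprVn -scalerAl scalerAr.
Qed.

(** Up to constants, k_2(z) k_1(z)^{-1}. The argument u^2 lambda = z/q of psi is compensated by the
    factor q^{-n} in h_n. *)
Let psi0 : fps A := fpsC Kelt * expS (lnk 1 - lnk 0).

Lemma gen_psi_uE : gen_psi_u = S psi0.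
Proof.
have dM (s t : fps A) : dilate q (s * t) = dilate q s * dilate q t by exact: rmorphM.
rewrite /gen_psi_u -(sum0_dilate (C_ (- 3)) q psi0) /psi0 dM dilateC -expS_dilate.
rewrite /gen_psi; congr (sum0 _ (_ * expS _)).
apply/fpsP => n; rewrite fpsZE -[RHS]/(q ^- n *: (lnk 1 - lnk 0) n) fpsBE.
case: n => [|n]; first by rewrite !lnk0 subrr !scaler0.
rewrite -[LHS]/(m *: (q ^- n.+1 *: (gen_a 0 n.+1 - gen_a 1 n.+1))) /gen_a -scalerBr.
rewrite scalerA mulrC -scalerA; congr (_ *: _).
by rewrite scaleNr scalerN scalerA mulfV // scale1r opprB.
Qed.

Lemma psi0_k1 : psi0 * (fpsC kp1 * k1) = fpsC kp1 * k2.
Proof.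
rewrite -(expS_lnk 0) /psi0 -mulrA -(expSD char0) ?fpsBE ?lnk0 ?subr0 //.
  rewrite subrK expS_lnk rmorphM /= -!mulrA.
  rewrite (mulrA (fpsC kp1)) (kp_comm (ccomm_sym (ccomm_kp (ccomm_kk 0 1)))).
  by rewrite -mulrA mulrA -rmorphM /= kmpK rmorph1 mul1r.
by apply: ccomm_mul; apply: ccomm_sym; apply: ccommD; last apply: ccommN;
  exact: ccomm_lnk_lnk.
Qed.

Let qz k l : q ^ (k%:Z - l%:Z) = q ^+ k / q ^+ l.
Proof. by rewrite expfzDr // -invr_expz. Qed.

(** e_{k+1} carries q^{k+1} and f_l carries q^l, so the weight q^{-l} means that f is taken at q^2
    z. In [Kinv_ef_coef] the opposite weight dilates e. *)
Let e_dilf_coef k l : q ^ (k%:Z - l%:Z) *: (C_ (k%:Z - l%:Z + 1) * g (Xminus k.+1) * g (Xplus l))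
  = (q^-1 * m ^- 2) *: (e k.+1 * dil f l).
Proof.
rewrite Cpow_subS // eE -[dil f l]/((q ^+ 2) ^- l *: f l) fE qz.
rewrite -!scalerAl -!scalerAr !scalerA; congr (_ *: _).
  rewrite exprAC (exprS q k); move: (q - q^-1) m0 => mm mm0.
  by field; rewrite q0 mm0 expf_neq0.
by rewrite -[in RHS]mulrA (mulrA (g _)) -(C_central _ (g _)) !mulrA.
Qed.

Local Notation sC := (fpsC (C_ (- 2)) * iota).

Let sC_comm (s : fps A) : sC * s = s * sC.
Proof. by rewrite -mulrA iotaC mulrA fpsC_Cpow -mulrA. Qed.

(** [dilate_f_k1] turns q^{-1} e f(q^2 z) k_1 into e k_1 f, and psi contributes k_2; together they
    form L_{11}. *)
Lemma N_minus_image : gen_N_minus * invS gen_c * gen_cc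
  = p *: ((q ^- 2 *: S (L 1 0) + sC * S (L 1 1)) * fpsC kp1).
Proof.
pose y : fps A := psi0 + q^-1 *: (e * dil f).
have E : - (kbarp q * (q ^- 2 + 1)) *: sum1 ql_ (fun k =>
       q ^+ k.+1 *: (C_ k.+1 * g (Xminus k.+1)))
   + fpsC epsm_ * (q^-1 *: (iota *
       (gen_psi_u + m ^+ 2 *: sum2 ql_ (fun k l =>
          q ^ (k%:Z - l%:Z) *: (C_ (k%:Z - l%:Z + 1) * g (Xminus k.+1) * g (Xplus l))))))
   = p *: (q ^- 2 *: S e + sC * S y).
  rewrite (sum1_ext _ me0 e_coef) (sum2_ext _ e0 e_dilf_coef) gen_psi_uE !SZ scalerDr.
  rewrite !scalerA; congr (_ *: _ + _).
    rewrite /kbarp; move: (q - q^-1) m0 => mm mm0.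
    by field; rewrite q0 mm0.
  rewrite fpsCZ -scalerAl -scalerAr scalerA mulrA mulrAC mulfV // mul1r; congr (_ *: (_ * _)).
  rewrite /y SD SZ; congr (_ + _ *: _).
  move: (q - q^-1) m0 => mm mm0.
  by field; rewrite q0 mm0.
have kp1k : fpsC kp1 * k1 = k1 * fpsC kp1 by apply: kp_comm; exact: ccomm_kk.
have e1 : e * (fpsC kp1 * k1) = L 1 0 * fpsC kp1 by rewrite Lmx10 kp1k mulrA.
have y1 : y * (fpsC kp1 * k1) = L 1 1 * fpsC kp1.
  rewrite mulrDl psi0_k1 (kp_comm (ccomm_kk 1 0)) Lmx11 mulrDl; congr (_ + _).
  rewrite kp1k -scalerAl -!mulrA (mulrA (dil f)) (dilate_f_k1 q0 m0 rtt kp1k1).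
  by rewrite -scalerAl -scalerAr scalerA mulVf // scale1r -mulrA.
rewrite /gen_N_minus E -(mulrA _ (invS _)) -(mulrA _ gen_g) gZ.
rewrite -scalerAl; congr (_ *: _).
rewrite mulrDl -scalerAl -(mulrA sC) -2!SM e1 y1 2!SM SC mulrDl -scalerAl -(mulrA sC).
by [].
Qed.

Let dilf_coef k : q ^- k *: (C_ (- k%:Z) * g (Xplus k)) = (- m^-1 *: dil f) k.
Proof.
rewrite fpsZE -[dil f k]/((q ^+ 2) ^- k *: f k) fE !scalerA; congr (_ *: _).
rewrite exprAC; move: (q - q^-1) m0 => mm mm0.
by field; rewrite mm0 expf_neq0.
Qed.

Let pmE : q ^+ 2 - q ^- 2 = p * m.
Proof. by field. Qed.

Lemma M_plus_image : (gen_M_plus + (rho q / m)%:A) * invS gen_c * gen_cc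
  = (p ^+ 2 * m * q) *: ((q ^- 2 *: S (L 0 0) + sC * S (L 0 1)) * fpsC kp1).
Proof.
have E : (rho q / m)%:A - fpsC epsm_ * ((kbarm q * q^-1 * (q ^+ 2 - q ^- 2)) *: (iota *
       sum0 ql_ (fun k => q ^- k *: (C_ (- k%:Z) * g (Xplus k)))))
    = (p ^+ 2 * m) *: (q^-1 *: (1 : fps A) + sC * S (dil f)).
  rewrite (sum0_ext _ dilf_coef) SZ fpsCZ -scalerAl -scalerAr scalerA -scalerAr -scalerAr.
  rewrite scalerA -scaleNr scalerDr scalerA mulrA; congr (_ *: _ + _ *: _).
    rewrite /rho pmE; move: (q - q^-1) m0 => mm mm0.
    by field; rewrite q0 mm0.
  rewrite pmE /kbarm; move: (q - q^-1) m0 => mm mm0.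
  by field; rewrite q0 mm0.
have kp1k : fpsC kp1 * k1 = k1 * fpsC kp1 by apply: kp_comm; exact: ccomm_kk.
have f1 : dil f * (fpsC kp1 * k1) = q *: (L 0 1 * fpsC kp1).
  by rewrite Lmx01 kp1k mulrA (dilate_f_k1 q0 m0 rtt kp1k1) -scalerAl.
rewrite /gen_M_plus subrK E -(mulrA _ (invS _)) -(mulrA _ gen_g) gZ.
rewrite -scalerAl -[in RHS]scalerA; congr (_ *: _).
rewrite mulrDl -scalerAl mul1r -(mulrA sC) -SM f1 kp1k Lmx00.
rewrite SZ 2!SM SC mulrDl -scalerAl -(mulrA sC) scalerDr scalerA -scalerAr; congr (_ *: _ + _).
by field.
Qed.

(** Each of the two factors of K^{-1} contributes q^{-1}. This moves K^{-1} to the left of x^- in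
    the single sum of [gen_M_minus], where it already stands in the double sum. *)
Let e_Kinv : dil e * fpsC Kinv = q ^- 2 *: (fpsC Kinv * dil e).
Proof.
have km1_e : e * fpsC (g (Kminus 0 0)) = q^-1 *: (fpsC (g (Kminus 0 0)) * e).
  by rewrite -kk0 (k10_e q0 rtt kp1k1 k1kp1 e0) scalerA mulVf // scale1r.
have H : e * fpsC Kinv = q ^- 2 *: (fpsC Kinv * e).
  rewrite rmorphM /= mulrA km1_e -scalerAl -(mulrA _ e).
  rewrite (kp2_e q0 m0 rtt kp1k1 k1kp1 kp2k2 k2kp2 e0) -scalerAr scalerA mulrA.
  by rewrite -invfM.
have := congr1 (dilate (q ^+ 2)) H.
have dM (s t : fps A) : dil (s * t) = dil s * dil t by exact: rmorphM.
by rewrite linearZ /= !dM dilateC.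
Qed.

Let eKinv_coef k : q ^ (- k%:Z + 1) *: (C_ k.+1 * g (Xminus k.+1) * Kinv)
  = ((- m^-1 * q ^+ 2) *: (dil e * fpsC Kinv)) k.+1.
Proof.
rewrite fpsZE mulfpsC -[dil e k.+1]/((q ^+ 2) ^- k.+1 *: e k.+1) eE -!scalerAl !scalerA.
congr (_ *: _); rewrite addrC (qz 1 k) expr1 exprAC (exprS q k).
move: (q - q^-1) m0 => mm mm0.
by field; rewrite q0 mm0 expf_neq0.
Qed.

Let Kinv_ef_coef k l : q ^ (- k%:Z + l%:Z) *:
    (C_ (k%:Z - l%:Z + 1) * Kinv * g (Xminus k.+1) * g (Xplus l))
  = (q * m ^- 2) *: ((fpsC Kinv * dil e) k.+1 * f l).
Proof.
rewrite Cpow_subS // fpsCM -[dil e k.+1]/((q ^+ 2) ^- k.+1 *: e k.+1) eE fE addrC qz.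
rewrite -!scalerAr -!scalerAl !scalerA; congr (_ *: _).
  rewrite exprAC (exprS q k); move: (q - q^-1) m0 => mm mm0.
  by field; rewrite q0 mm0 !expf_neq0.
rewrite -[in LHS](mulrA (C_ _)) C_central.
by rewrite [in RHS]mulrA -(C_central _ (Kinv * _)) !mulrA.
Qed.

Lemma M_minus_image : (gen_M_minus + (rho q / m)%:A) * invS gen_c * gen_cc
  = (p ^+ 2 * m * q^-1) *: S (fpsC kp2 * (L 1 1 + q^-1 *: L 1 0)).
Proof.
pose x : fps A := (p ^+ 2 * m) *: (q^-1 *: (fpsC Kinv * psi0)
  + q *: (dil e * fpsC Kinv) + fpsC Kinv * dil e * f).
have Ke0 : (fpsC Kinv * dil e) 0%N = 0.
  by rewrite fpsCM -[dil e 0%N]/((q ^+ 2) ^- 0 *: e 0%N) e0 scaler0 mulr0.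
have eK0 : ((- m^-1 * q ^+ 2) *: (dil e * fpsC Kinv)) 0%N = 0.
  by rewrite fpsZE mulfpsC -[dil e 0%N]/((q ^+ 2) ^- 0 *: e 0%N) e0 scaler0 mul0r scaler0.
have E : (rho q / m) *: (fpsC Kinv * gen_psi_u)
   - (epsp q * kbarp q * (q ^+ 2 - q ^- 2)) *: sum1 ql_ (fun k =>
       q ^ (- k%:Z + 1) *: (C_ k.+1 * g (Xminus k.+1) * Kinv))
   + (rho q * m) *: sum2 ql_ (fun k l =>
       q ^ (- k%:Z + l%:Z) *:
         (C_ (k%:Z - l%:Z + 1) * Kinv * g (Xminus k.+1) * g (Xplus l))) = S x.
  rewrite (sum1_ext _ eK0 eKinv_coef) (sum2_ext _ Ke0 Kinv_ef_coef) gen_psi_uE.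
  rewrite /x !SZ !SD !SZ !scalerDr !scalerA (SM (fpsC Kinv) psi0) SC -scaleNr.
  congr (_ *: _ + _ *: _ + _ *: _); rewrite /rho ?pmE /epsp /kbarp;
    move: (q - q^-1) m0 => mm mm0; by field; rewrite q0 mm0.
have kKinv s : (forall i, ccomm s (kk i)) -> ccomm s (fpsC Kinv).
  by move=> sk; rewrite rmorphM; apply: ccommM; [exact: ccomm_km|exact: ccomm_kp].
have kpsi s : (forall i, ccomm s (kk i)) -> ccomm s psi0.
  move=> sk; apply: ccommM.
    by rewrite rmorphM; apply: ccommM; [exact: ccomm_km|exact: ccomm_kp].
  apply: ccomm_expS; apply: ccommD; last apply: ccommN; exact: ccomm_lnk.
have xq : ccomm qd x.
  apply: ccommZ; apply: ccommD; last first.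
    apply: ccommM => //; apply: ccommM; [exact: kKinv|exact: ccomm_dilate].
  apply: ccommD; apply: ccommZ; apply: ccommM;
    [exact: kKinv|exact: kpsi|exact: ccomm_dilate|exact: kKinv].
have kKpsi : fpsC kp1 * k1 * (fpsC Kinv * psi0) = fpsC kp2 * k2.
  have kC i : ccomm (fpsC kp1 * k1) (kk i).
    apply: ccomm_sym; apply: ccommM; last exact: ccomm_kk.
    by apply: ccomm_kp; exact: ccomm_kk.
  rewrite ccomm_mul; last by apply: ccommM; [exact: kKinv|exact: kpsi].
  rewrite -mulrA psi0_k1 mulrA; congr (_ * _); rewrite rmorphM /= -mulrA.
  rewrite -(kp_comm (ccomm_sym (ccomm_kp (ccomm_kk 0 1)))) mulrA -rmorphM /=.
  by rewrite kmpK rmorph1 mul1r.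
have kKe : fpsC kp1 * k1 * (fpsC Kinv * dil e) = q^-1 *: (fpsC kp2 * L 1 0).
  rewrite mulrA kpk_Kinv -mulrA (k1_dilate_e q0 m0 rtt k1kp1) -scalerAr Lmx10.
  by [].
have zE : fpsC kp1 * k1 * x
    = (p ^+ 2 * m * q^-1) *: (fpsC kp2 * (L 1 1 + q^-1 *: L 1 0)).
  rewrite /x -scalerAr -scalerA; congr (_ *: _).
  rewrite e_Kinv 2!mulrDr -3!scalerAr kKpsi kKe (mulrA (fpsC kp1 * k1)) kKe.
  rewrite Lmx11 Lmx10 !mulrDr !scalerDr -!scalerAl -!scalerAr !scalerA.
  rewrite -!mulrA -!addrA; congr (_ + _); rewrite addrC; congr (_ + _ *: _).
  by field.
rewrite /gen_M_minus subrK E -(mulrA _ (invS _)) -(mulrA gen_g) (Z_comm xq).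
by rewrite (mulrA gen_g) gZ -SM zE SZ.
Qed.

Lemma dilate_S (s : fps A) : dilate q (S s) = S (dil s).
Proof.
apply/fpsP => n; rewrite -[LHS]/(q ^- n *: S s n) !sum0E.
case: ifPn => odn; first by rewrite scaler0.
rewrite scalerAl -[dil s _]/((q ^+ 2) ^- n./2 *: s n./2) -exprM mul2n.
by rewrite -[in q ^- n](odd_double_half n) (negPf odn).
Qed.

Lemma dilate_iota : dilate q iota = q ^- 2 *: iota.
Proof.
have T2 : dilate q ('T ^+ 2 : fps A) = q ^- 2 *: 'T ^+ 2.
  by rewrite rmorphXn /= dilateT exprZn exprVn.
by rewrite /gen_qu2_inv linearZ /= T2 !scalerA mulrC.
Qed.

Let dM (s t : fps A) : dilate q (s * t) = dilate q s * dilate q t.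
Proof. exact: rmorphM. Qed.
Let dD (s t : fps A) : dilate q (s + t) = dilate q s + dilate q t.
Proof. exact: rmorphD. Qed.
Let dZ c (s : fps A) : dilate q (c *: s) = c *: dilate q s.
Proof. exact: linearZ. Qed.

Lemma dilate_sC : dilate q sC = q ^- 2 *: sC.
Proof. by rewrite dM dilateC dilate_iota scalerAr. Qed.

Local Notation SL i j := (S (L i j)).
Local Notation SL' i j := (S (dil (L i j))).
Let K := fpsC (kp1 * kp2).
(** The common value of the two halves of Gamma, which the factor 1/2 of P^- averages. *)
Let X := (q^-1 * p ^+ 2) *: ((sC - 1) * S (K * qd)).

Local Notation Yp := (gen_N_plus * invS gen_c * gen_cc).
Local Notation Ym := (gen_N_minus * invS gen_c * gen_cc).
Local Notation Zp := ((gen_M_plus + (rho q / m)%:A) * invS gen_c * gen_cc).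
Local Notation Zm := ((gen_M_minus + (rho q / m)%:A) * invS gen_c * gen_cc).

Lemma S_antisym k l : SL 0 k * SL' 1 l - (q^-1)%:A * (SL 1 k * SL' 0 l)
  = if k == l then 0 else if k == 0 then S qd else - (q^-1)%:A * S qd.
Proof.
have S0 : S (0 : fps A) = 0 by have := SZ 0 0; rewrite !scale0r.
have SN (s : fps A) : S (- s) = - S s by rewrite -scaleN1r SZ scaleN1r.
rewrite -!SM mulr_algl -SZ -SN -SD (qdet_antisym q0 rtt m0).
case: ifP => // _; case: ifP => // _.
by rewrite SZ -scaleNr mulr_algl.
Qed.

Let algC c (s : fps A) : c%:A * s = s * c%:A.
Proof. by rewrite mulr_algl mulr_algr. Qed.

Let oneC (s : fps A) : 1 * s = s * 1.
Proof. by rewrite mulr1 mul1r. Qed.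

Lemma fpsT2 : ('T ^+ 2 : fps A) = q *: iota.
Proof. by rewrite /gen_qu2_inv scalerA mulfV // scale1r. Qed.

Let p0 : p != 0 := qn0 0.

Let coef_sum c1 c2 (M1 M2 M : fps A) : c1 = p ^+ 2 * q -> c2 = p ^+ 2 ->
  M1 - (q^-1)%:A * M2 = q^-1 *: M ->
  c1 *: (iota * M1) - c2 *: (iota * M2) = p ^+ 2 *: (iota * M).
Proof.
move=> -> -> e12; have -> : p ^+ 2 *: (iota * M2) = (p ^+ 2 * q) *: (iota * ((q^-1)%:A * M2)).
  by rewrite mulr_algl -scalerAr scalerA mulfK.
by rewrite -scalerBr -mulrBr e12 -scalerAr scalerA mulfK.
Qed.

Let wC (s : fps A) : (sC - 1) * s = s * (sC - 1).
Proof. by rewrite mulrBl mulrBr sC_comm mul1r mulr1. Qed.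

Let T2X : 'T ^+ 2 * X = p ^+ 2 *: (iota * ((sC - 1) * S (K * qd))).
Proof.
rewrite fpsT2 /X -scalerAl -scalerAr scalerA; congr (_ *: _).
by rewrite mulrA mulfV // mul1r.
Qed.

Let rho0 : rho q != 0.
Proof. by rewrite /rho pmE mulf_neq0 ?expf_neq0 ?invr_eq0 ?mulf_neq0. Qed.

Let rho_inv : (rho q)^-1 * q * (p ^+ 2 * m) ^+ 2 * q ^- 2 = p ^+ 2.
Proof.
have pp := p0; rewrite /rho pmE; move: (q - q^-1) m0 => mm mm0.
move: (q + q^-1) pp => pp pp0.
by field; rewrite q0 mm0 pp0.
Qed.

(** Y_+ and Z_- give rows 0 and 1 of L against (q^{-1}, 1). At uq, Y_- and Z_+ give rows 1 and 0 of
    L' against (1, sC): the dilation multiplies sC by q^{-2}, so q^{-2} factors out. *)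
Lemma first_half :
  q ^+ 2 *: (Yp * dilate q Ym) - (rho q)^-1 *: ('T ^+ 2 * (Zm * dilate q Zp)) = 'T ^+ 2 * X.
Proof.
pose r i := SL i 0 * (q^-1)%:A + SL i 1 * 1.
pose t i := SL' i 0 * 1 + SL' i 1 * sC.
have rE i : S (fpsC kp2 * (L i 1 + q^-1 *: L i 0)) = fpsC kp2 * r i.
  by rewrite SM SC SD SZ /r mulr1 mulr_algr addrC.
have tE i : dilate q ((q ^- 2 *: SL i 0 + sC * SL i 1) * fpsC kp1) = q ^- 2 *: (t i * fpsC kp1).
  rewrite dM dD dZ dM dilateC dilate_sC !dilate_S /t mulr1 -sC_comm.
  by rewrite -scalerAl -scalerDr -scalerAl.
have E : r 0 * t 1 - (q^-1)%:A * (r 1 * t 0) = S qd * ((q^-1)%:A * sC - (q^-1)%:A * (1 * 1)).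
  exact: (@qdet_pairing _ (q^-1)%:A (S qd) (fun i j => SL i j) (fun i j => SL' i j)
    _ _ _ _ (algC _) (algC _) oneC S_antisym).
have qK1 : S qd * fpsC kp1 = fpsC kp1 * S qd.
  by rewrite -SC -!SM (ccomm_mul (ccomm_kp (qd_k 0))).
have kk12 : fpsC kp2 * fpsC kp1 = K.
  by rewrite /K rmorphM /= (kp_comm (ccomm_sym (ccomm_kp (ccomm_kk 0 1)))).
rewrite N_plus_image N_minus_image M_plus_image M_minus_image !rE !dZ !tE T2X.
have -> : q ^+ 2 *: ((p * q) *: (iota * (fpsC kp2 * r 0)) * (p *: (q ^- 2 *: (t 1 * fpsC kp1))))
  = (p ^+ 2 * q) *: (iota * (fpsC kp2 * (r 0 * t 1) * fpsC kp1)).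
  move: gen_qu2_inv => J; rewrite -!scalerAl -!scalerAr !scalerA !mulrA; congr (_ *: _).
  by field.
have -> : (rho q)^-1 *: ('T ^+ 2 * ((p ^+ 2 * m / q) *: (fpsC kp2 * r 1) *
    ((p ^+ 2 * m * q) *: (q ^- 2 *: (t 0 * fpsC kp1)))))
  = p ^+ 2 *: (iota * (fpsC kp2 * (r 1 * t 0) * fpsC kp1)).
  rewrite fpsT2; move: gen_qu2_inv => J.
  rewrite -!scalerAl -!scalerAr !scalerA !mulrA; congr (_ *: _).
  by rewrite -[RHS]rho_inv; field; rewrite q0 rho0.
apply: coef_sum => //.
have -> : (q^-1)%:A * (fpsC kp2 * (r 1 * t 0) * fpsC kp1)
    = fpsC kp2 * ((q^-1)%:A * (r 1 * t 0)) * fpsC kp1.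
  by rewrite !mulr_algl -scalerAr -scalerAl.
rewrite -mulrBl -mulrBr E mulr1 !mulr_algl -scalerBr.
move: (sC - 1) wC => w wC'; rewrite -!scalerAr -scalerAl; congr (_ *: _).
by rewrite -wC' mulrA -wC' -!mulrA qK1 (mulrA (fpsC kp2)) kk12 SM SC.
Qed.

(** The columns are exchanged, (q^{-2}, sC) for L and (q^{-1}, 1) for L', and Y_- puts row 1 of L
    first. This costs a factor - q, which turns the q-determinant - q^{-2}(sC - 1) into q^{-1}(sC -
    1). *)
Lemma second_half :
  q ^+ 2 *: (Ym * dilate q Yp) - (rho q)^-1 *: ('T ^+ 2 * (Zp * dilate q Zm)) = 'T ^+ 2 * X.
Proof.
pose r i := SL' i 0 * (q^-1)%:A + SL' i 1 * 1.
pose v i := SL i 0 * (q ^- 2)%:A + SL i 1 * sC.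
have rE i : dilate q (S (fpsC kp2 * (L i 1 + q^-1 *: L i 0))) = fpsC kp2 * r i.
  by rewrite SM SC dM dilateC SD SZ dD dZ !dilate_S /r mulr1 mulr_algr addrC.
have vE i : (q ^- 2 *: SL i 0 + sC * SL i 1) * fpsC kp1 = v i * fpsC kp1.
  by rewrite /v mulr_algr -sC_comm.
have E : v 0 * r 1 - (q^-1)%:A * (v 1 * r 0)
    = S qd * ((q ^- 2)%:A * 1 - (q^-1)%:A * (sC * (q^-1)%:A)).
  exact: (@qdet_pairing _ (q^-1)%:A (S qd) (fun i j => SL i j) (fun i j => SL' i j)
    _ _ _ _ (algC _) (algC _) sC_comm S_antisym).
(* Here k^+_{1,0} k^+_{2,0} stands between the two factors. It passes L' as the inverse of the
   constant term of [qdet]. *)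
have Kr i : K * r i = r i * K.
  have KL i' j : K * SL' i' j = SL' i' j * K.
    have SK : S K = K by exact: SC.
    rewrite -SK -!SM ccomm_mul //; apply: ccomm_dilate; apply: ccomm_sym.
    by apply: ccomm_kp12; apply: ccomm_sym; exact: (ccomm_qdet q0 rtt m0).
  by rewrite /r mulr1 mulr_algr mulrDr mulrDl -scalerAr -scalerAl !KL.
have kk12 : fpsC kp1 * fpsC kp2 = K by rewrite /K rmorphM.
have mid s i : s * fpsC kp1 * (iota * (fpsC kp2 * r i)) = iota * (s * r i * K).
  rewrite (mulrA (s * _)) -(iotaC (s * _)) -(mulrA iota); congr (_ * _).
  by rewrite -(mulrA s) (mulrA (fpsC kp1)) kk12 Kr mulrA.
have mid2 s i : s * fpsC kp1 * (fpsC kp2 * r i) = s * r i * K.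
  by rewrite -(mulrA s) (mulrA (fpsC kp1)) kk12 Kr mulrA.
rewrite N_plus_image N_minus_image M_plus_image M_minus_image !vE !dZ dM !rE dilate_iota T2X.
have -> : q ^+ 2 *: (p *: (v 1 * fpsC kp1) * ((p * q) *: (q ^- 2 *: iota * (fpsC kp2 * r 0))))
  = (p ^+ 2 * q) *: (iota * (v 1 * r 0 * K)).
  rewrite -mid; move: gen_qu2_inv => J; rewrite -!scalerAl -!scalerAr !scalerA; congr (_ *: _).
  by field.
have -> : (rho q)^-1 *: ('T ^+ 2 * ((p ^+ 2 * m * q) *: (v 0 * fpsC kp1) *
    ((p ^+ 2 * m / q) *: (fpsC kp2 * r 1))))
  = p ^+ 2 *: (iota * (q ^+ 2 *: (v 0 * r 1 * K))).
  rewrite fpsT2; move: gen_qu2_inv => J.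
  rewrite -!scalerAl -!scalerAr mid2 !scalerA; congr (_ *: _).
  by rewrite -[in RHS]rho_inv; field; rewrite q0 rho0.
apply: coef_sum => //.
have lin (a b : fps A) : a - (q^-1)%:A * (q ^+ 2 *: b) = - q *: (b - (q^-1)%:A * a).
  rewrite !mulr_algl scalerA scalerBr scalerA mulNr mulfV // scaleN1r opprK addrC.
  by rewrite scaleNr; congr (- (_ *: _) + _); field.
rewrite lin (mulrA (q^-1)%:A) -mulrBl.
rewrite E mulr1 mulr_algr mulr_algl.
have -> : (q ^- 2)%:A - q^-1 *: (q^-1 *: sC) = - q ^- 2 *: (sC - 1).
  by rewrite scalerA -invfM scaleNr scalerBr opprB.
move: (sC - 1) wC => w wC'; rewrite -scalerAr -scalerAl scalerA mulrNN.
rewrite -wC' -mulrA SM SC; congr (_ *: (_ * _)); first by field.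
rewrite -SC -!SM ccomm_mul; first by rewrite SM SC.
by apply: ccomm_sym; exact: ccomm_kp12 ccomm_qd_qd.
Qed.

(** The n-th coefficient of [lnqdet] is - (q - q^{-1}) q^{-n} gamma_n; the power q^{-n} turns q u^2
    lambda into q^2 u^2 lambda. *)
Lemma qdet_image :
  (q ^+ 3 * m ^+ 2)^-1 *:
    ((epsp q * m ^+ 2) *: (fpsC epsm_ * 'T ^+ 2)
     - (q ^+ 3 * kbarp q * kbarm q * p ^+ 2)%:A)
  * expS (- m *: sum1 (q ^- 2 *: C_ (- 3)) (fun k => gen_gamma k.+1)) = X.
Proof.
have -> : expS (- m *: sum1 (q ^- 2 *: C_ (- 3)) (fun k => gen_gamma k.+1)) = S (K * qd).
  rewrite -expS_lnqdet -expS_sum0 ?lnqdet0 //; congr expS.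
  rewrite (@sum1_ext _ _ (- m^-1 *: dilate q^-1 lnqdet)).
  - rewrite sum0Z scalerA mulrNN mulfV // scale1r sum0_dilate invrK scalerA.
    congr (sum0 (_ *: _) _); by field.
  - by rewrite fpsZE -[dilate _ _ _]/((q^-1) ^- 0 *: lnqdet 0%N) lnqdet0 !scaler0.
  move=> k; rewrite gen_gammaE fpsZE -[dilate _ _ _]/((q^-1) ^- k.+1 *: lnqdet k.+1).
  by rewrite exprVn invrK.
rewrite /X [RHS]scalerAl; congr (_ * _).
rewrite fpsT2 fpsCZ -scalerAl -scalerAr !scalerBr !scalerA.
congr (_ *: _ - _ *: _); rewrite /epsp /kbarp /kbarm;
  move: (q - q^-1) m0 => mm mm0; by field; rewrite q0 mm0.
Qed.
End Images.

(** * The trace formula *)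

Section TraceFormula.
Variables (F : fieldType) (q : F) (A : algType F).
Hypotheses (q0 : q != 0) (m0 : q - q^-1 != 0) (p0 : q + q^-1 != 0).
Local Notation m := (q - q^-1).
Local Notation p := (q + q^-1).
Local Notation ip i p := (mxtens_index (i, p)).

Definition gen_Kop (yp ym zp zm : fps A) : 'M[fps A]_2 :=
  rows_mx 2 2
    [:: [:: q *: mulu yp;
            (kbarm q * p)^-1 *: zp + (kbarp q * p / m)%:A];
        [:: (kbarp q * p)^-1 *: zm + (kbarm q * p / m)%:A;
            q *: mulu ym]].

Definition gen_R0 : 'M[fps A]_(2 * 2) :=
  rows_mx (2 * 2) (2 * 2) [:: [:: 1; 0        ; 0        ; 0];
                              [:: 0; (q^-1)%:A; 0        ; 0];
                              [:: 0; 0        ; (q^-1)%:A; 0];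
                              [:: 0; 0        ; 0        ; 1]].

Definition gen_Pmx : 'M[fps A]_(2 * 2) :=
  rows_mx (2 * 2) (2 * 2) [:: [:: 1; 0; 0; 0];
                              [:: 0; 0; 1; 0];
                              [:: 0; 1; 0; 0];
                              [:: 0; 0; 0; 1]].

Definition gen_Gamma (yp ym zp zm : fps A) : fps A :=
  \tr (((2^-1 : F)%:A *: (1%:M - gen_Pmx)) *m (gen_Kop yp ym zp zm *t 1%:M) *m gen_R0
       *m (1%:M *t map_mx (dilate q) (gen_Kop yp ym zp zm))).

Lemma KRK_entry (M N : 'M[fps A]_2) i j k l :
  ((M *t 1%:M) *m gen_R0 *m (1%:M *t N)) (ip i j) (ip k l)
  = M i k * (if k == j then 1 else (q^-1)%:A) * N j l.
Proof.
have R0E k' j' k'' j'' : gen_R0 (ip k' j') (ip k'' j'') =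
    if (k' == k'') && (j' == j'') then (if k' == j' then 1 else (q^-1)%:A) else 0.
  rewrite mxE; by case: (ord2P k') => ->; case: (ord2P j') => ->;
    case: (ord2P k'') => ->; case: (ord2P j'') => ->.
have KR k' l' : ((M *t 1%:M) *m gen_R0) (ip i j) (ip k' l') =
    if j == l' then M i k' * (if k' == l' then 1 else (q^-1)%:A) else 0.
  rewrite mxE sum_mxtens !tensmxE !R0E !mxE.
  by case: (ord2P j) => ->; case: (ord2P k') => ->; case: (ord2P l') => ->;
    rewrite /= !(mulr1n, mulr0n, mulr0, mul0r, addr0, add0r, mulr1).
rewrite mxE sum_mxtens !tensmxE !KR !mxE.
by case: (ord2P j) => ->; case: (ord2P k) => ->;
  rewrite /= !(mulr1n, mulr0n, mulr0, mul0r, addr0, add0r, mulr1, mul1r).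
Qed.

(** P^- is supported on the basis vectors 01 and 10, and each contributes one half. *)
Lemma trace_formula (M N : 'M[fps A]_2) :
  \tr (((2^-1 : F)%:A *: (1%:M - gen_Pmx)) *m (M *t 1%:M) *m gen_R0 *m (1%:M *t N))
  = 2^-1 *: ((q^-1 *: (M 0 0 * N 1 1) - M 1 0 * N 0 1)
             + (q^-1 *: (M 1 1 * N 0 0) - M 0 1 * N 1 0)).
Proof.
rewrite -!mulmxA (mulmxA (M *t 1%:M)) /mxtrace sum_mxtens.
have PE i j i' j' : ((2^-1 : F)%:A *: (1%:M - gen_Pmx)) (ip i j) (ip i' j') =
    if i == j then 0 else if (i' == i) && (j' == j) then (2^-1)%:A
    else if (i' == j) && (j' == i) then - (2^-1)%:A else 0.
  rewrite !mxE.
  by case: (ord2P i) => ->; case: (ord2P j) => ->; case: (ord2P i') => ->;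
    case: (ord2P j') => -> //=; rewrite ?subrr ?subr0 ?sub0r ?mulr0 ?mulr1 ?mulrN1.
move: ((2^-1 : F)%:A *: (1%:M - gen_Pmx)) PE => P PE.
have PKRK i j : (P *m ((M *t 1%:M) *m gen_R0 *m (1%:M *t N))) (ip i j) (ip i j) =
    if i == j then 0
    else 2^-1 *: (q^-1 *: (M i i * N j j) - M j i * N i j).
  rewrite mxE sum_mxtens !PE !KRK_entry.
  case: (ord2P i) => ->; case: (ord2P j) => ->; rewrite /=.
  - by rewrite !mul0r !addr0.
  - by rewrite !mul0r addr0 add0r mulr1 mulNr !mulr_algl mulr_algr -scalerAl scalerBr.
  - by rewrite !mul0r addr0 add0r mulr1 mulNr !mulr_algl mulr_algr -scalerAl scalerBr addrC.
  - by rewrite !mul0r !addr0.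
rewrite !PKRK /= add0r addr0.
by rewrite -scalerDr.
Qed.

Hypothesis two0 : (2 : F) != 0.

(** The factor u^{-2} undoes the two [mulu], with an extra q from the dilated one. Since rho is the
    product of the denominators of the off-diagonal entries, their constants become the shift by
    [r]. *)
Lemma Gamma_halves (yp ym zp zm : fps A) : yp 0%N = 0 -> ym 0%N = 0 ->
  let r : fps A := (rho q / m)%:A in
  'T ^+ 2 * gen_Gamma yp ym zp zm = 2^-1 *:
    ((q ^+ 2 *: (yp * dilate q ym)
        - (rho q)^-1 *: ('T ^+ 2 * ((zm + r) * dilate q (zp + r))))
     + (q ^+ 2 *: (ym * dilate q yp)
        - (rho q)^-1 *: ('T ^+ 2 * ((zp + r) * dilate q (zm + r))))).
Proof.
move=> yp0 ym0 r; rewrite /gen_Gamma trace_formula.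
have kp0 : kbarp q * p != 0 by rewrite !mulf_neq0 ?invr_eq0.
have km0 : kbarm q * p != 0 by rewrite mulf_neq0.
have rhoE : rho q = (kbarm q * p) * (kbarp q * p).
  by rewrite /rho /kbarm /kbarp; field.
have cancel (a b : F) : a != 0 -> a^-1 * (a * b / m) = b / m by move=> a0; rewrite mulrA mulKf.
have B : gen_Kop yp ym zp zm 0 1 = (kbarm q * p)^-1 *: (zp + r).
  by rewrite mxE /= scalerDr /r scalerA rhoE cancel.
have C : gen_Kop yp ym zp zm 1 0 = (kbarp q * p)^-1 *: (zm + r).
  by rewrite mxE /= scalerDr /r scalerA rhoE (mulrC (kbarm q * p) (kbarp q * p)) cancel.
have AA : gen_Kop yp ym zp zm 0 0 = q *: mulu yp by rewrite mxE.
have DD : gen_Kop yp ym zp zm 1 1 = q *: mulu ym by rewrite mxE.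
have NE i j : map_mx (dilate q) (gen_Kop yp ym zp zm) i j = dilate q (gen_Kop yp ym zp zm i j).
  by rewrite mxE.
rewrite !NE AA DD B C.
have muluT (s t : fps A) : s 0%N = 0 -> t 0%N = 0 ->
    'T ^+ 2 * (q^-1 *: ((q *: mulu s) * dilate q (q *: mulu t))) = q ^+ 2 *: (s * dilate q t).
  move=> s0 t0; rewrite -[in RHS](mulfpsTu s0) -[in RHS](mulfpsTu t0).
  rewrite rmorphM /= dilateT linearZ /= -scalerAl -!scalerAr -scalerAl -scalerAr !scalerA.
  rewrite expr2 -!mulrA (mulrA (mulu s) 'T) -(fpsTC (mulu s)) !mulrA.
  by congr (_ *: _); field.
rewrite -!scalerAr; congr (_ *: _).
have halfT (s t : fps A) (c d : F) : 'T ^+ 2 * (c *: s * dilate q (d *: t)) =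
    (c * d) *: ('T ^+ 2 * (s * dilate q t)).
  by rewrite linearZ /= -scalerAl -!scalerAr scalerA.
rewrite mulrDr !mulrBr !muluT // !halfT -!invfM rhoE [X in X^-1 *: ('T ^+ 2 * ((zm + r) * _))]mulrC.
by [].
Qed.
End TraceFormula.

(** * Transport of the trace along a morphism *)

Section Inclusion.
Variables (F : fieldType) (A : algType F) (S : A -> Prop).
Definition subalg_incl : subalg S -> A := \val.
HB.instance Definition _ := GRing.RMorphism.copy subalg_incl (\val : subalg S -> A).
HB.instance Definition _ := GRing.Linear.copy subalg_incl (\val : subalg S -> A).
End Inclusion.

Lemma map_fps_dilate (F : fieldType) (A B : algType F) (f : {lrmorphism A -> B}) (c : F)
    (s : fps A) : map_fps f (dilate c s) = dilate c (map_fps f s).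
Proof. by apply/fpsP => n; rewrite /= linearZ. Qed.

Lemma map_fpsT (A B : nzRingType) (f : {rmorphism A -> B}) : map_fps f 'T = 'T.
Proof. by apply/fpsP => n; rewrite /= rmorph_nat. Qed.

Lemma Gamma_image (F : fieldType) (q : F) (A B : algType F) (f : {lrmorphism A -> B})
    (yp ym zp zm : fps A) (Yp Ym Zp Zm X : fps B) :
  let r : fps B := (rho q / (q - q^-1))%:A in
  q != 0 -> q - q^-1 != 0 -> q + q^-1 != 0 -> (2 : F) != 0 ->
  yp 0%N = 0 -> ym 0%N = 0 ->
  [/\ map_fps f yp = Yp, map_fps f ym = Ym,
      map_fps f zp = Zp - r & map_fps f zm = Zm - r] ->
  q ^+ 2 *: (Yp * dilate q Ym) - (rho q)^-1 *: ('T ^+ 2 * (Zm * dilate q Zp)) = 'T ^+ 2 * X ->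
  q ^+ 2 *: (Ym * dilate q Yp) - (rho q)^-1 *: ('T ^+ 2 * (Zp * dilate q Zm)) = 'T ^+ 2 * X ->
  map_fps f (gen_Gamma q yp ym zp zm) = X.
Proof.
move=> r q0 m0 p0 two0 yp0 ym0 [fyp fym fzp fzm] half1 half2.
have fZ c (s : fps A) : map_fps f (c *: s) = c *: map_fps f s by rewrite linearZ.
have fM (s t : fps A) : map_fps f (s * t) = map_fps f s * map_fps f t by rewrite rmorphM.
have frA (c : F) : map_fps f c%:A = c%:A by rewrite linearZ /= rmorph1.
have fzpr : map_fps f (zp + (rho q / (q - q^-1))%:A) = Zp.
  by rewrite rmorphD /= frA fzp subrK.
have fzmr : map_fps f (zm + (rho q / (q - q^-1))%:A) = Zm.
  by rewrite rmorphD /= frA fzm subrK.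
have fT2 : map_fps f ('T ^+ 2) = 'T ^+ 2 by rewrite rmorphXn /= map_fpsT.
apply: (@fpsTX_lreg _ 2); rewrite -[in LHS]fT2 -fM Gamma_halves //.
move: fzpr fzmr; move: (zp + _) (zm + _) => zp' zm' fzp' fzm'.
rewrite fZ rmorphD !rmorphB /= !fZ !fM map_fpsT -expr2.
rewrite !map_fps_dilate fyp fym fzp' fzm' half1 half2.
by rewrite -mulr2n -scaler_nat scalerA mulVf // scale1r.
Qed.

(** * Nonvanishing in C(q) *)

Section RationalFunctions.
Variable R : realType.
Local Notation q := (q_ R).

Lemma q_neq0 : q != 0.
Proof. by rewrite /q_ tofrac_eq0 polyX_eq0. Qed.

(** X^{n+1} - c has leading coefficient 1. The constant 1 then excludes q = q^{-1}, and the constant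
    - 1 excludes q^k = - q^{-k} for k > 0. *)
Lemma q_exp_neq_const n (c : R[i]) : q ^+ n.+1 != tofrac c%:P.
Proof.
rewrite /q_ -tofracXn -subr_eq0 -tofracB tofrac_eq0 subr_eq0.
by apply/eqP => /(congr1 (fun s : {poly _} => s`_n.+1)) /eqP;
   rewrite coefXn coefC eqxx oner_eq0.
Qed.

Lemma Cq_pchar : [pchar Cq R] =i pred0.
Proof.
apply/pcharf0P => n; rewrite -(rmorph_nat (@tofrac _)) tofrac_eq0.
by rewrite -polyC_natr polyC_eq0 pnatr_eq0.
Qed.

Lemma q_sub_neq0 : q - q^-1 != 0.
Proof.
apply: contra (q_exp_neq_const 1 1) => /eqP/subr0_eq qE.
by rewrite expr2 {2}qE mulfV ?q_neq0 // polyC1 tofrac1.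
Qed.

Lemma q_exp_add_neq0 n : q ^+ n.+1 + q ^- n.+1 != 0.
Proof.
apply: contra (q_exp_neq_const (n + n.+1) (- 1)); rewrite addr_eq0 => /eqP qE.
rewrite -addSn exprD {2}qE mulrN mulfV ?expf_neq0 ?q_neq0 //.
by rewrite polyCN polyC1 tofracN tofrac1.
Qed.
End RationalFunctions.

(* The constants to be unfolded are listed explicitly: otherwise conversion unfolds
   the multiplication of the quotient Uq and does not terminate in practice. *)
Section Instances.
Variables (F : fieldType) (q : F).
Local Notation kk := (k_minus (Uq_elt q)).

Lemma g_serE :
  g_ser q = gen_exp q (Uq_elt q) (fun n => gen_h q (Uq_elt q) kk n + gen_gamma' q (Uq_elt q) n).
Proof.
unfold g_ser, gen_exp, h_elt, gen_h, a_elt, gen_a, lnk,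
  gen_gamma', gamma', ql, gen_ql, lambda_inv, lambda, epsm.
reflexivity.
Qed.

Lemma c_serE : c_ser q = gen_exp q (Uq_elt q) (gen_gamma' q (Uq_elt q)).
Proof.
unfold c_ser, gen_exp, gen_gamma', gamma', ql, gen_ql,
  lambda_inv, lambda, epsm.
reflexivity.
Qed.

Lemma cc_serE : cc_ser q = gen_exp q (Uq_elt q) (gen_gamma q (Uq_elt q) kk).
Proof.
unfold cc_ser, gen_exp, gen_gamma, gamma, gen_a, a_elt,
  lnk, ql, gen_ql, lambda_inv, lambda, epsm.
reflexivity.
Qed.

Lemma N_plusE : N_plus q = gen_N_plus q (Uq_elt q) kk.
Proof.
unfold N_plus, gen_N_plus; rewrite g_serE.
unfold ql, gen_ql, lambda_inv, xp, xm, Kinv, qu2_inv, gen_qu2_inv.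
reflexivity.
Qed.

Lemma psi_uE : psi_u q = gen_psi_u q (Uq_elt q) kk.
Proof.
unfold psi_u, gen_psi_u, psi, gen_psi, lambda_inv, Kelt,
  h_elt, gen_h, a_elt, gen_a, lnk.
reflexivity.
Qed.

Lemma N_minusE : N_minus q = gen_N_minus q (Uq_elt q) kk.
Proof.
unfold N_minus, gen_N_minus; rewrite g_serE psi_uE.
unfold ql, gen_ql, lambda_inv, xp, xm, Kinv, qu2_inv,
  gen_qu2_inv, epsm.
reflexivity.
Qed.

Lemma M_plusE : M_plus q = gen_M_plus q (Uq_elt q) kk.
Proof.
unfold M_plus, gen_M_plus; rewrite g_serE.
unfold ql, gen_ql, lambda_inv, xp, xm, Kinv, qu2_inv,
  gen_qu2_inv, epsm.
reflexivity.
Qed.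

Lemma M_minusE : M_minus q = gen_M_minus q (Uq_elt q) kk.
Proof.
unfold M_minus, gen_M_minus; rewrite g_serE psi_uE.
unfold ql, gen_ql, lambda_inv, xp, xm, Kinv, qu2_inv,
  gen_qu2_inv, epsm.
reflexivity.
Qed.

Lemma GammaE : Gamma q =
  gen_Gamma q (Y_plus_ser q) (Y_minus_ser q) (Z_plus_ser q) (Z_minus_ser q).
Proof.
unfold Gamma, gen_Gamma, Pminus, Pmx, gen_Pmx, Kop,
  gen_Kop, R0, gen_R0.
reflexivity.
Qed.

Lemma gammaE : gamma q = gen_gamma q (Uq_elt q) kk.
Proof.
unfold gamma, gen_gamma, a_elt, gen_a, lnk.
reflexivity.
Qed.
End Instances.

Lemma map_Gamma (F : fieldType) (q : F)
    (mu : {lrmorphism UqT q -> Uprime q}) (hmu : mu_spec mu) :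
  q != 0 -> q - q^-1 != 0 -> [pchar F] =i pred0 ->
  (forall n, q ^+ n.+1 + q ^- n.+1 != 0) ->
  map_fps (fun x => subalg_val (mu x)) (Gamma q) =
    ((q ^+ 3 * (q - q^-1) ^+ 2)^-1 *:
       ((epsp q * (q - q^-1) ^+ 2) *: (fpsC (epsm q) * 'T ^+ 2)
        - (q ^+ 3 * kbarp q * kbarm q * (q + q^-1) ^+ 2)%:A))
    * expS (- (q - q^-1) *:
        sum1 (q ^- 2 *: lambda_inv q) (fun k => gamma q k.+1)).
Proof.
move=> q0 m0 char0 qn0.
have two0 : (2 : F) != 0 by have /pcharf0P -> := char0.
have e0 : e_minus q (Uq_elt q) 0%N = 0 := scaler0 _ _.
have CC := @Chalf_central _ q; have CVC := @Chalfinv_central _ q.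
have kpm := @KplusK _ q; have kmp := @KminusK _ q.
have rtt := Uq_L_minus_RTT q0.
have half1 := first_half (f := f_minus q (Uq_elt q)) q0 m0 char0 qn0 CC CVC (ChalfK q) kpm kmp
  rtt (fun=> erefl) e0 (fun=> erefl) (fun=> erefl).
have half2 := second_half (f := f_minus q (Uq_elt q)) q0 m0 char0 qn0 CC CVC (ChalfK q) kpm kmp
  rtt (fun=> erefl) e0 (fun=> erefl) (fun=> erefl).
have qdetE := qdet_image (f := f_minus q (Uq_elt q)) q0 m0 char0 CC CVC kpm kmp
  rtt (fun=> erefl).
pose f : {lrmorphism UqT q -> Uq q} :=
  @subalg_incl _ _ (@Uprime_gen _ q) \o (mu : {lrmorphism UqT q -> subalg (@Uprime_gen _ q)}).
move: hmu; rewrite /mu_spec N_plusE N_minusE M_plusE M_minusE c_serE cc_serE => fE.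
rewrite GammaE gammaE.
have Gf := @Gamma_image _ q _ _ f (Y_plus_ser q) (Y_minus_ser q) (Z_plus_ser q) (Z_minus_ser q)
  _ _ _ _ _ q0 m0 (qn0 0%N) two0 (mul0r _) (mul0r _) fE half1 half2.
exact: etrans Gf (esym qdetE).
Qed.

Theorem corollary4p10 (R : realType)
    (mu : {lrmorphism UqT (q_ R) -> Uprime (q_ R)}) (hmu : mu_spec mu) :
  let q := q_ R in
  map_fps (fun x => subalg_val (mu x)) (Gamma q) =
    (* the prefactor, with numerator and denominator divided by u^2 *)
    ((q ^+ 3 * (q - q^-1) ^+ 2)^-1 *:
       ((epsp q * (q - q^-1) ^+ 2) *: (fpsC (epsm q) * 'T ^+ 2)
        - (q ^+ 3 * kbarp q * kbarm q * (q + q^-1) ^+ 2)%:A))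
    * expS (- (q - q^-1) *:
        sum1 (q ^- 2 *: lambda_inv q) (fun k => gamma q k.+1)).
Proof.
exact: map_Gamma hmu (q_neq0 R) (q_sub_neq0 R) (@Cq_pchar R) (@q_exp_add_neq0 R).
Qed.
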